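(* Let $d\ge 3$ and $m\ge 1$ be integers, let $\beta>2$ be real, and let $n\ge 2m+2$ be an integer. There is $\gamma>0$ such that, for any $\delta\in(0,\tfrac12)$, there are $p>0$ and $s\in\mathbb Z_{\ge0}$ for which the CAT Markov chain $(\mathcal C_t)_{t\ge0}$ with parameters $(d,m,\beta)$ satisfies $$\mathbf P_C\Big(\mathrm{diam}(\mathcal C_t)\ge\gamma\,(t-s)^{\frac12-\delta}\ \text{ for every } t\ge s\Big)\ge p$$ for every $n$-element subset $C$ of $\mathbb Z^d$.
   Context: $\|\cdot\|$ is the Euclidean norm; $\mathrm{diam}(A)=\sup_{x,y\in A}\|x-y\|$. For $A\subset\mathbb Z^d$, $\partial A=\{x\in\mathbb Z^d\setminus A:\ \|x-y\|=1\text{ for some }y\in A\}$. Let $\phi(u,v)=\max\{\|u-v\|,1\}^{-\beta}$ for $u,v\in\mathbb Z^d$. CAT (chain activation and transport) is the Markov chain $(\mathcal C_t)_{t\ge0}$ on $\mathcal S=\{S\subset\mathbb Z^d: m+1\le|S|<\infty\}$ with the following step. Given $\mathcal C_t$, choose $x_1$ uniformly at random in $\mathcal C_t$; for $l=1,\dots,m-1$, given $x_1,\dots,x_l$, choose $x_{l+1}\in\mathcal C_t\setminus\{x_1,\dots,x_l\}$ with probability proportional to $\phi(x_l,x_{l+1})$; then for $l=m,\dots,2m-1$, given $x_1,\dots,x_l$, choose $x_{l+1}\in\partial\big((\mathcal C_t\setminus\{x_1,\dots,x_m\})\cup\{x_{m+1},\dots,x_l\}\big)$ with probability proportional to $\phi(x_l,x_{l+1})$.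 Set $\mathcal C_{t+1}=(\mathcal C_t\setminus\{x_1,\dots,x_m\})\cup\{x_{m+1},\dots,x_{2m}\}$. $\mathbf P_C$ is the law of the chain started from $\mathcal C_0=C$. *)

(* Defs.v *)
From HB Require Import structures.
From mathcomp Require Import all_boot all_order all_algebra finmap.
From mathcomp Require Import all_classical all_reals all_analysis.

Set Implicit Arguments.
Unset Strict Implicit.
Unset Printing Implicit Defensive.

Import Order.TTheory GRing.Theory Num.Theory.

Local Open Scope classical_set_scope.
Local Open Scope ring_scope.

Notation lattice d := ('rV[int]_d).

Definition enorm (R : realType) (d : nat) (x : lattice d) : R :=
  Num.sqrt (\sum_(i < d) ((x 0 i)%:~R) ^+ 2).

Definition diam (R : realType) (d : nat) (A : {fset lattice d}) : R :=
  sup [set r : R | exists x y, [/\ x \in A, y \in A & r = enorm R (x - y)]].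

Definition boundary (R : realType) (d : nat) (A : {fset lattice d}) :
    set (lattice d) :=
  [set x | x \notin A /\ exists2 y, y \in A & enorm R (x - y) = 1].

Definition phi (R : realType) (d : nat) (beta : R) (u v : lattice d) : R :=
  Num.max (enorm R (u - v)) 1 `^ (- beta).

(* Probability of drawing [x] from [F] with probability proportional to [w].
   The sum is a finitely supported one, so [F] must be finite for this to be
   meaningful: below, [F] is a finite set or the boundary of one. *)
Definition draw (R : realType) (T : choiceType) (F : set T) (w : T -> R)
    (x : T) : R :=
  \1_F x * (w x / \sum_(y \in F) w y).

(* The set (C \ {x_1, ..., x_m}) U {x_(m+1), ..., x_l}, where [xs] lists
   x_1, ..., x_l and m <= l. *)
Definition transport (d m : nat) (C : {fset lattice d}) (xs : seq (lattice d)) :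
    {fset lattice d} :=
  ((C `\` [fset x in take m xs]) `|` [fset x in drop m xs])%fset.

(* Conditional probability that x_(l+1) = [x], given that [xs] lists
   x_1, ..., x_l. *)
Definition next_prob (R : realType) (d m : nat) (beta : R)
    (C : {fset lattice d}) (xs : seq (lattice d)) (x : lattice d) : R :=
  if (size xs == 0)%N then draw [set` C] (fun=> 1) x
  else if (size xs < m)%N then
    draw [set` (C `\` [fset y in xs])%fset] (phi beta (last 0 xs)) x
  else draw (boundary R (transport m C xs)) (phi beta (last 0 xs)) x.

Definition sequence_prob (R : realType) (d m : nat) (beta : R)
    (C : {fset lattice d}) (xs : (2 * m).-tuple (lattice d)) : R :=
  \prod_(l < 2 * m) next_prob m beta C (take l xs) (tnth xs l).

Definition cat_state (d m : nat) : Type :=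
  {C : {fset lattice d} | (m + 1 <= #|` C|)%N}.

(* Only finitely many sequences have nonzero probability. *)
Definition cat_kernel (R : realType) (d m : nat) (beta : R)
    (C C' : cat_state d m) : R :=
  \sum_(xs \in [set xs : (2 * m).-tuple (lattice d) |
                transport m (val C) xs = val C'])
    sequence_prob beta (val C) xs.

(* [X] is a time-homogeneous Markov chain on the countable (discrete) state
   space [S], defined on the probability space ([T], [P]), with transition
   matrix [K] and started from [x0]. *)
Definition markov_chain (R : realType) (S : countType) (K : S -> S -> R)
    (x0 : S) (disp : measure_display) (T : measurableType disp)
    (P : probability T R) (X : nat -> T -> S) : Prop :=
  [/\ forall t x, measurable [set w | X t w = x],
      P [set w | X 0%N w = x0] = 1%E &
      forall (t : nat) (a : nat -> S),
        P [set w | forall i, (i <= t.+1)%N -> X i w = a i] =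
        (P [set w | forall i, (i <= t)%N -> X i w = a i] *
         (K (a t) (a t.+1))%:E)%E].

(* Main.v *)
(** Split the configuration into at least two clusters of [m + 1] to [2 m + 1] sites.
    While the clusters are at distance [r] from each other, CAT moves them
    independently up to an error of order [r ^ - beta]. Observed when all clusters are
    straight segments, the differences of their barycentres are random walks with
    centred increments whose law is symmetric under the reflections of the lattice,
    so that after rescaling the coordinates the covariance is isotropic. In dimension
    [d >= 3] the sum of [|gap| ^ (- 2 a)] over pairs of clusters, with [a] small, is
    therefore a strict supermartingale, which loses a multiple of [r ^ (- 2 - 2 a)] in
    each step; this dominates the interaction because [beta > 2 + 2 a]. The loss is of
    order [f ^ (1 + 1 / a)] for the resulting Lyapunov function [f], so that
    [t ^ (a * (1 - 2 delta)) * f] is still a supermartingale up to a summable error. It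
    exceeds [1] as soon as the diameter is less than [t ^ (1 / 2 - delta)]; hence, from
    clusters which are far enough apart, the diameter stays above this bound with
    probability at least [1 / 2]. Finally, from any configuration such clusters are
    reached in a bounded number of steps with probability bounded below: clusters
    with at most [m] sites can be merged into others, and larger ones can crawl away. *)
Require Import Defs.
From HB Require Import structures.
From mathcomp Require Import all_boot all_order all_algebra finmap.
From mathcomp Require Import all_classical all_reals all_analysis.
From mathcomp Require Import zify ring lra.

Set Implicit Arguments.
Unset Strict Implicit.
Unset Printing Implicit Defensive.

Import Order.TTheory GRing.Theory Num.Theory.
Import numFieldNormedType.Exports.

Local Open Scope classical_set_scope.
Local Open Scope ring_scope.

(** * Real inequalities *)

(** Two obstacles shape the proof. A cluster of arbitrary shape may have a barycentre with a drift
    that nothing cancels; reflections fix a configuration only at canonical times. But the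
    interaction has to be paid at every step. So the potential is extended to all configurations, as
    its expected value at the next canonical time plus a running cost, and the drift inequality
    holds step by step. Secondly, between canonical times the diameter [D] of a cluster is
    unbounded, while the interaction is of order [((1 + D) / (1 + r)) ^ beta]; hence the loss
    carries a power [q >= beta] of the diameter. This is harmless, since the time to a canonical
    configuration has a geometric tail, uniformly in the shapes, which absorbs polynomial growth.
    The bounds on the sizes serve two ends: more than [m] sites let a cluster perform CAT alone, and
    at most [2 m + 1] sites cannot form two pieces of more than [m] sites, so that a cluster left
    alone can be made connected and then straight. Expectations are finite nested sums; the
    probability space enters only at the end. *)

Section RealAnalysis.
Variable R : realType.
Implicit Types (a w x y z u v rho : R).

(** The right side minus the left, as a function of [y = 1 + w], has a derivative [df] with the sign
    of [y - 1], so it is minimal at [y = 1]. The coefficient 3/5 only has to be close enough to 1/2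
    for the numerical margin in dimension three. *)
Lemma ln_taylor_ge w : - 2^-1 <= w -> w - 3 / 5 * w ^+ 2 - w ^+ 4 <= ln (1 + w).
Proof.
move=> w_ge; pose f (y : R) := ln y - (y - 1) + 3 / 5 * (y - 1) ^+ 2 + (y - 1) ^+ 4.
pose df (y : R) := y^-1 - 1 + 6 / 5 * (y - 1) + 4 * (y - 1) ^+ 3.
have dfP (y : R) : 0 < y -> is_derive y 1 f (df y).
  move=> y0; have ? := is_derive1_ln y0.
  rewrite /f; apply: is_derive_eq.
  rewrite /df /GRing.scale /=; ring.
have f1 : f 1 = 0 by rewrite /f ln1; ring.
have sgn (y : R) : 2^-1 <= y -> 0 <= (y - 1) * df y.
  move=> y_ge; have y0 : 0 < y by lra.
  have -> : (y - 1) * df y = (y - 1) ^+ 2 * ((6 / 5 * y - 1 + 4 * y * (y - 1) ^+ 2) / y).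
    rewrite /df; field; lra.
  rewrite mulr_ge0 ?sqr_ge0 // divr_ge0 ?(ltW y0) //.
  have h1 : 0 <= (y - 2^-1) * (y - 1) ^+ 2 by rewrite mulr_ge0 ?sqr_ge0 // subr_ge0.
  have h2 := sqr_ge0 (y - 7 / 10); nra.
suff : 0 <= f (1 + w) by rewrite /f; nra.
have cont (b c : R) : 0 < b -> {within `[b, c], continuous f}.
  move=> b0; apply: derivable_within_continuous => y; rewrite in_itv /= => /andP [by_ _].
  by have [] := dfP y (lt_le_trans b0 by_).
have [w0|w0|->] := ltgtP w 0; last by rewrite addr0 f1.
- have l1 : (1 + w < 1 :> R)%O by lra.
  have d1 (z : R) : z \in `]1 + w, 1[ -> is_derive z 1 f (df z).
    by rewrite in_itv /= => /andP [h _]; apply: dfP; lra.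
  have p0 : 0 < 1 + w by lra.
  have [z] := MVT l1 d1 (cont _ _ p0).
  rewrite in_itv /= f1 => /andP [z1 z2] e; have z3 : 2^-1 <= z by lra.
  have := sgn z z3; have z4 : 0 < 1 - z by lra.
  rewrite -[z - 1]opprB mulNr oppr_ge0 pmulr_rle0 // => h.
  have : df z * (1 - (1 + w)) <= 0 by rewrite mulr_le0_ge0 //; lra.
  lra.
- have l1 : (1 < 1 + w :> R)%O by lra.
  have d1 (z : R) : z \in `]1, 1 + w[ -> is_derive z 1 f (df z).
    by rewrite in_itv /= => /andP [h _]; apply: dfP; lra.
  have [z] := MVT l1 d1 (cont _ _ ltr01).
  rewrite in_itv /= f1 => /andP [z1 z2] e; have z3 : 2^-1 <= z by lra.
  have := sgn z z3; have z4 : 0 < z - 1 by lra.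
  rewrite pmulr_rge0 // => h.
  have : 0 <= df z * (1 + w - 1) by rewrite mulr_ge0 //; lra.
  lra.
Qed.

(** [expR y <= 1 / (1 - y)], and [(1 - y) * (1 + y + 2 * y ^+ 2) = 1 + y ^+ 2 * (1 - 2 * y)]. *)
Lemma expR_le_quad y : y <= 2^-1 -> expR y <= 1 + y + 2 * y ^+ 2.
Proof.
move=> y_le; have e := expR_ge1Dx (- y); rewrite expRN in e.
have e0 := expR_gt0 y; have y1 : 0 < 1 - y by lra.
have h : expR y * (1 - y) <= 1 by rewrite -ler_pdivlMl // mulr1.
have h2 : 0 <= y ^+ 2 * (1 - 2 * y) by rewrite mulr_ge0 ?sqr_ge0 //; lra.
rewrite -(ler_pM2r y1); apply: le_trans h _.
by rewrite -subr_ge0; apply: le_trans h2 _; rewrite le_eqVlt; apply/orP; left; apply/eqP; ring.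
Qed.

(** The bound on [ln] is inserted into the exponential. The square of the exponent adds at most
    [9 / 200 * a * w ^+ 2], because [a <= 1 / 100] and [|ln (1 + w)| <= 3 / 2 * |w|]; and 3/5 +
    9/200 < 13/20. *)
Lemma powR_taylor a w : 0 < a <= 1 / 100 -> - 2^-1 <= w ->
  (1 + w) `^ (- a) <= 1 - a * w + 13 / 20 * a * w ^+ 2 + a * w ^+ 4.
Proof.
move=> /andP [a0 a1] w_ge; have w1 : 0 < 1 + w by lra.
rewrite /powR gt_eqF //; set l := ln (1 + w).
have l_ge := ln_taylor_ge w_ge; have l_le : l <= w by apply: le_ln1Dx; lra.
rewrite -/l in l_ge.
have l2 : l ^+ 2 <= 9 / 4 * w ^+ 2.
  have [w0|w0] := lerP 0 w.
    have l0 : 0 <= l by apply: ln_ge0; lra.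
    have : l ^+ 2 <= w ^+ 2 by rewrite ler_sqr ?nnegrE.
    by have := sqr_ge0 w; lra.
  have w2 : w ^+ 2 <= - w / 2 by rewrite expr2; nra.
  have w4 : w ^+ 4 <= - w / 8.
    have -> : w ^+ 4 = w ^+ 2 * w ^+ 2 by rewrite -exprD.
    have := sqr_ge0 w; nra.
  have : - l <= - (3 / 2 * w) by lra.
  have l0 : 0 <= - l by lra.
  move=> h; have : (- l) ^+ 2 <= (- (3 / 2 * w)) ^+ 2 by rewrite ler_sqr ?nnegrE // (le_trans l0).
  by rewrite !sqrrN exprMn; lra.
have l_ge1 : - 2 <= l.
  have [w0|w0] := lerP 0 w.
    have l0 : 0 <= l by apply: ln_ge0; lra.
    lra.
  have w2 : w ^+ 2 <= - w / 2 by rewrite expr2; nra.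
  have w4 : w ^+ 4 <= - w / 8.
    have -> : w ^+ 4 = w ^+ 2 * w ^+ 2 by rewrite -exprD.
    have := sqr_ge0 w; nra.
  lra.
have y_le : - a * l <= 2^-1 by nra.
apply: le_trans (expR_le_quad y_le) _.
have : a * (w - 3 / 5 * w ^+ 2 - w ^+ 4) <= a * l by rewrite ler_wpM2l // ltW.
have : (- a * l) ^+ 2 <= a * (9 / 400 * w ^+ 2).
  rewrite mulNr sqrrN exprMn expr2 -mulrA ler_wpM2l ?(ltW a0) //.
  have := sqr_ge0 l; nra.
nra.
Qed.

(** For [v / u < - 1 / 2] the expansion fails, but then the left side is at most 1 while
    [u ^ (- a) >= 1 / u], so the last term alone suffices. Its sixth power makes it of order
    [u ^ (- 2)] once the sixth moment of [v] is of order [u ^ 3]. *)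
Lemma powR_taylor_ge1 a u v : 0 < a <= 1 / 100 -> 1 <= u -> 1 <= u + v ->
  (u + v) `^ (- a) <= u `^ (- a) * (1 - a * (v / u) + 13 / 20 * a * (v / u) ^+ 2
     + a * (v / u) ^+ 4 + 64 * u * (v / u) ^+ 6).
Proof.
move=> a01 u1 uv1; have u0 : 0 < u by lra.
set w := v / u; have vE : v = u * w by rewrite /w mulrC divfK // gt_eqF.
have uvE : u + v = u * (1 + w) by rewrite vE; ring.
have w6 : 0 <= 64 * u * w ^+ 6.
  by rewrite mulr_ge0 ?exprn_even_ge0 // mulr_ge0 // ltW.
have [w_ge|w_lt] := lerP (- 2^-1) w.
  rewrite uvE powRM ?(ltW u0) //; last by lra.
  rewrite ler_wpM2l ?powR_ge0 //; apply: le_trans (powR_taylor a01 w_ge) _.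
  by rewrite lerDl.
case/andP: a01 => a0 a1.
have lhs : (u + v) `^ (- a) <= 1.
  rewrite powRN invf_le1 ?powR_gt0 //; last by lra.
  by rewrite -(powRr0 (u + v)) ler_powR // ltW.
apply: le_trans lhs _.
have ua : u^-1 <= u `^ (- a).
  by rewrite -powR_inv1 ?(ltW u0) // ler_powR //; lra.
have w6' : 1 <= 64 * w ^+ 6.
  have -> : 64 * w ^+ 6 = ((2 * w) ^+ 2) ^+ 3 by ring.
  by rewrite exprn_ege1 // expr2; nra.
apply: le_trans (_ : u^-1 * (64 * u * w ^+ 6) <= _).
  have -> : u^-1 * (64 * u * w ^+ 6) = 64 * w ^+ 6 by field; rewrite gt_eqF.
  by [].
apply: ler_pM => //; first by rewrite invr_ge0 ltW.
have w4 : 0 <= w ^+ 4 by rewrite exprn_even_ge0.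
have w2 : 0 <= w ^+ 2 by rewrite sqr_ge0.
rewrite lerDr; nra.
Qed.

Lemma geometric_le rho N : 0 <= rho < 1 -> \sum_(t < N) rho ^+ t <= (1 - rho)^-1.
Proof.
move=> /andP [r0 r1]; have r1' : 0 < 1 - rho by rewrite subr_gt0.
rewrite -[leRHS]mul1r ler_pdivlMr //.
by have := subrX1 rho N; have := exprn_ge0 N r0; lra.
Qed.

(** With [s = (1 + rho) / 2] one has [rho <= s * s]. One copy of [s ^+ t] absorbs a factor [t.+1],
    since [t.+1 * s ^+ t] is at most a geometric sum. *)
Lemma poly_geometric rho q : 0 <= rho < 1 -> exists2 M : R, 0 <= M &
  forall t, (t.+1%:R) ^+ q * rho ^+ t <= M.
Proof.
elim: q rho => [|q IH] rho r01; have /andP [r0 r1] := r01.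
  by exists 1 => // t; rewrite expr0 mul1r exprn_ile1 // ltW.
pose s := (1 + rho) / 2; have s01 : 0 <= s < 1 by apply/andP; rewrite /s; split; lra.
have /andP [s0 s1] := s01; have [M M0 hM] := IH s s01.
exists (M * (1 - s)^-1); first by rewrite mulr_ge0 // invr_ge0 subr_ge0 ltW.
move=> t; have rs : rho <= s * s by rewrite /s; nra.
apply: le_trans (_ : (t.+1%:R ^+ q * s ^+ t) * (t.+1%:R * s ^+ t) <= _).
  rewrite mulrACA -exprSr -exprMn ler_wpM2l ?exprn_ge0 //.
  by apply: lerXn2r => //; rewrite nnegrE // mulr_ge0.
apply: ler_pM => //; rewrite ?mulr_ge0 ?exprn_ge0 //.
apply: le_trans (geometric_le t.+1 s01).
have -> : t.+1%:R * s ^+ t = \sum_(j < t.+1) s ^+ t by rewrite sumr_const card_ord mulr_natl.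
by apply: ler_sum => j _; rewrite ler_wiXn2l // ?ltW // -ltnS.
Qed.

Lemma poly_geometric_sum rho q : 0 <= rho < 1 -> exists2 M : R, 0 <= M &
  forall N, \sum_(t < N) (t.+1%:R) ^+ q * rho ^+ t <= M.
Proof.
move=> /andP [r0 r1]; pose s := (1 + rho) / 2.
have s01 : 0 <= s < 1 by apply/andP; rewrite /s; split; lra.
have /andP [s0 s1] := s01; have [M M0 hM] := poly_geometric q s01.
exists (M * (1 - s)^-1); first by rewrite mulr_ge0 // invr_ge0 subr_ge0 ltW.
move=> N; have rs : rho <= s * s by rewrite /s; nra.
apply: le_trans (ler_wpM2l M0 (geometric_le N s01)).
rewrite mulr_sumr; apply: ler_sum => t _.
apply: le_trans (_ : t.+1%:R ^+ q * s ^+ t * s ^+ t <= _).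
  rewrite -mulrA -exprMn ler_wpM2l ?exprn_ge0 //.
  by apply: lerXn2r => //; rewrite nnegrE // mulr_ge0.
by rewrite ler_wpM2r ?exprn_ge0.
Qed.

Lemma sqr_sum_le n (t : 'I_n -> R) : (\sum_i t i) ^+ 2 <= n%:R * \sum_i (t i) ^+ 2.
Proof.
have h i j : t i * t j <= 2^-1 * (t i) ^+ 2 + 2^-1 * (t j) ^+ 2.
  by have := sqr_ge0 (t i - t j); rewrite sqrrB mulr2n; lra.
rewrite expr2 big_distrlr /=; apply: le_trans (ler_sum _ (fun i _ => ler_sum _ (fun j _ => h i j))) _.
set S := \sum_i t i ^+ 2.
have -> : \sum_(i < n) \sum_(j < n) (2^-1 * t i ^+ 2 + 2^-1 * t j ^+ 2) =
    \sum_(i < n) (n%:R * (2^-1 * t i ^+ 2) + 2^-1 * S).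
  by apply: eq_bigr => i _; rewrite big_split /= sumr_const card_ord -mulr_sumr mulr_natl.
rewrite big_split /= sumr_const card_ord -!mulr_sumr -/S -[(2^-1 * S) *+ n]mulr_natl; lra.
Qed.

Lemma powR_bernoulli (th y : R) : 0 < th < 1 -> 0 <= y -> y `^ th <= 1 - th + th * y.
Proof.
move=> /andP [t0 t1] y0.
have := @conjugate_powR R (y `^ th) 1 th^-1 (1 - th)^-1 (powR_ge0 _ _) ler01.
rewrite !invr_gt0 subr_gt0 !invrK mulr1 powR1 mul1r -powRrM mulfV ?gt_eqF // powRr1 //.
move=> /(_ t0 t1) h; rewrite addrC mulrC; apply: h; ring.
Qed.

(** Young's inequality with the conjugate exponents [1 + 1 / a] and [1 + a], applied to [e * f] and
    [x / e]; as [e <= 1], the power of [e] in the first term is at most [e <= c]. *)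
Lemma young_power a c : 0 < a -> 0 < c -> exists2 C : R, 0 <= C &
  forall f x : R, 0 <= f -> 0 <= x -> x * f <= c * f `^ (1 + a^-1) + C * x `^ (1 + a).
Proof.
move=> a0 c0; pose e := Num.min 1 c.
have e0 : 0 < e by rewrite lt_min ltr01.
have e1 : e <= 1 by rewrite ge_min lexx.
have ec : e <= c by rewrite ge_min lexx orbT.
have p1 : 1 <= 1 + a^-1 by rewrite lerDl invr_ge0 ltW.
have q1 : 1 <= 1 + a by rewrite lerDl ltW.
exists (e^-1 `^ (1 + a)); first exact: powR_ge0.
move=> f x f0 x0.
have -> : x * f = (e * f) * (e^-1 * x) by field; rewrite gt_eqF.
apply: le_trans (@conjugate_powR R (e * f) (e^-1 * x) (1 + a^-1) (1 + a) _ _ _ _ _) _;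
  rewrite ?mulr_ge0 ?invr_ge0 ?(ltW e0) //; try lra.
- by field; apply/andP; split; rewrite gt_eqF //; lra.
- apply: lerD.
    rewrite powRM ?(ltW e0) // ler_pdivrMr; last by lra.
    rewrite mulrAC; apply: ler_wpM2r; first exact: powR_ge0.
    have h1 : e `^ (1 + a^-1) <= e.
      by rewrite -[leRHS]powRr1 ?(ltW e0) // ger_powR // e0 e1.
    have h2 : c <= c * (1 + a^-1) by rewrite ler_peMr // ltW.
    by rewrite (le_trans h1) // (le_trans ec).
  rewrite powRM ?invr_ge0 ?(ltW e0) // ler_pdivrMr; last by lra.
  by rewrite ler_peMr // mulr_ge0 ?powR_ge0.
Qed.

End RealAnalysis.

(** * Drift of a negative power of a quadratic form *)

Section QuadraticDrift.
Variables (R : realType) (X : Type) (n : nat).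
Implicit Types (phi : X -> R) (z : 'I_n -> X -> R) (sig h : 'I_n -> R).

(* A sub-probability with symmetric law and covariance close to [diag sig]; in
   the metric [\sum_c x_c ^+ 2 / sig c] it looks isotropic, which is why
   dimension three suffices for a superharmonic power. *)
Lemma quadratic_drift (a M : R) sig : (3 <= n)%N -> 0 < a <= 1 / 100 -> 0 <= M ->
  (forall c, 0 < sig c) -> exists2 K0 : R, 1 <= K0 &
  forall (E : (X -> R) -> R) z,
  (forall phi phi', (forall x, phi x <= phi' x) -> E phi <= E phi') ->
  (forall (I : Type) (s : seq I) (c : I -> R) (F : I -> X -> R),
     E (fun x => \sum_(l <- s) c l * F l x) = \sum_(l <- s) c l * E (F l)) ->
  E (fun=> 1) <= 1 ->
  (forall c, E (z c) = 0) ->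
  (forall c c', c != c' -> E (fun x => z c x * z c' x) = 0) ->
  (forall c c', E (fun x => z c x * z c' x ^+ 2) = 0) ->
  (forall c, 9 / 10 * sig c <= E (fun x => z c x ^+ 2) <= sig c) ->
  (forall p : nat, (2 <= p <= 6)%N -> E (fun x => (1 + \sum_c z c x ^+ 2 / sig c) ^+ p) <= M) ->
  forall (K u : R) h, K0 <= K -> u = K + \sum_c h c ^+ 2 / sig c ->
  E (fun x => (K + \sum_c (h c + z c x) ^+ 2 / sig c) `^ (- a)) <=
    u `^ (- a) * (1 - a / 20 / u).
Proof.
move=> n3 a01 M0 sig0; have /andP [a0 a1] := a01.
pose C4 : R := (8 * n%:R + 2) ^+ 2; pose C6 : R := (8 * n%:R + 2) ^+ 3.
pose T := (a * M + a * C4 * M + 64 * C6 * M).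
exists (1 + 20 * T / a).
  have T0 : 0 <= T.
    by rewrite /T /C4 /C6 !addr_ge0 ?mulr_ge0 ?exprn_ge0 ?addr_ge0 ?mulr_ge0 // ltW.
  by rewrite lerDl divr_ge0 ?mulr_ge0 // ltW.
move=> E z Ele Elin E1 Ez Ezz Ezzz Ez2 Eq K u' h KK u'E.
pose u := K + \sum_c h c ^+ 2 / sig c; rewrite {}u'E -/u {u'}.
have n0 : (0 <= n%:R :> R) by [].
have T0 : 0 <= T.
  by rewrite /T /C4 /C6 !addr_ge0 ?mulr_ge0 ?exprn_ge0 ?addr_ge0 ?mulr_ge0 // ltW.
have K1 : 1 <= K.
  by apply: le_trans KK; rewrite lerDl divr_ge0 ?mulr_ge0 // ltW.
have EZ c f : E (fun x => c * f x) = c * E f.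
  have := Elin unit [:: tt] (fun=> c) (fun=> f); rewrite big_seq1 => <-.
  by congr E; apply: funext => x; rewrite big_seq1.
have ED f g : E (fun x => f x + g x) = E f + E g.
  have := Elin bool [:: true; false] (fun=> 1) (fun b => if b then f else g).
  rewrite big_cons big_seq1 !mul1r => <-.
  by congr E; apply: funext => x; rewrite big_cons big_seq1 !mul1r.
have Esum (c : 'I_n -> R) F : E (fun x => \sum_i c i * F i x) = \sum_i c i * E (F i).
  exact: Elin.
pose q x := \sum_c z c x ^+ 2 / sig c.
pose B x := \sum_c h c / sig c * z c x.
pose v x := 2 * B x + q x.
have q0 x : 0 <= q x by apply: sumr_ge0 => c _; rewrite divr_ge0 ?sqr_ge0 // ltW.
have h2 : \sum_c h c ^+ 2 / sig c <= u by rewrite lerDr (le_trans ler01).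
have u1 : 1 <= u.
  by rewrite ler_wpDr //; apply: sumr_ge0 => c _; rewrite divr_ge0 ?sqr_ge0 // ltW.
have u0 : 0 < u by lra.
have uv x : K + \sum_c (h c + z c x) ^+ 2 / sig c = u + v x.
  rewrite /u /v /B /q mulr_sumr -!addrA -!big_split /=; congr (_ + _).
  by apply: eq_bigr => c _; field; rewrite gt_eqF.
have uv1 x : 1 <= u + v x.
  rewrite -uv ler_wpDr //; apply: sumr_ge0 => c _.
  by rewrite divr_ge0 ?sqr_ge0 // ltW.
have B2 x : B x ^+ 2 <= n%:R * (u * q x).
  apply: le_trans (sqr_sum_le _) _; rewrite ler_wpM2l // /q mulr_sumr.
  apply: ler_sum => c _; have s0 := sig0 c.
  have hc : h c ^+ 2 / sig c <= u.
    apply: le_trans h2; rewrite (bigD1 c) //= lerDl.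
    by apply: sumr_ge0 => j _; rewrite divr_ge0 ?sqr_ge0 // ltW.
  have -> : (h c / sig c * z c x) ^+ 2 = h c ^+ 2 / sig c * (z c x ^+ 2 / sig c).
    by field; rewrite gt_eqF.
  by apply: ler_wpM2r => //; rewrite divr_ge0 ?sqr_ge0 // ltW.
have v2 x : v x ^+ 2 <= u * ((8 * n%:R + 2) * (1 + q x) ^+ 2).
  have : v x ^+ 2 <= 2 * (4 * B x ^+ 2) + 2 * q x ^+ 2.
    by rewrite /v; have := sqr_ge0 (2 * B x - q x); lra.
  have := B2 x; have := q0 x.
  set b2 := B x ^+ 2; set qx := q x => qx0 hB /le_trans; apply.
  have e1 : 2 * (4 * b2) <= 8 * n%:R * (u * qx) by lra.
  have e2 : 2 * qx ^+ 2 <= u * (2 * (1 + qx) ^+ 2).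
    have : 0 <= (u - 1) * (2 * (1 + qx) ^+ 2) by rewrite mulr_ge0 ?subr_ge0 // mulr_ge0 ?sqr_ge0.
    by rewrite expr2; nra.
  have e3 : 8 * n%:R * (u * qx) <= u * (8 * n%:R * (1 + qx) ^+ 2).
    rewrite mulrCA ler_wpM2l ?(ltW u0) // ler_wpM2l ?mulr_ge0 // expr2; nra.
  lra.
(* This is where dimension three enters: [E v >= 3 * 9 / 10], whereas the quadratic term costs
   [13 / 20 * 4 = 26 / 10]. The leading coefficient is thus [- a / 10], half of which is left after
   the remainder. *)
have Ev : 27 / 10 <= E v.
  rewrite /v (ED (fun x => 2 * B x)) EZ /B Esum big1 ?mulr0 ?add0r; last first.
    by move=> c _; rewrite Ez mulr0.
  have -> : E q = \sum_c (sig c)^-1 * E (fun x => z c x ^+ 2).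
    by rewrite -Esum; congr E; apply: funext => x; apply: eq_bigr => c _; rewrite mulrC.
  apply: le_trans (_ : \sum_(c < n) 9 / 10 <= _).
    rewrite sumr_const card_ord -mulr_natl.
    have : 3 <= n%:R :> R by rewrite ler_nat.
    lra.
  apply: ler_sum => c _; have /andP [lo _] := Ez2 c.
  by rewrite ler_pdivlMl // mulrC.
have EB2 : E (fun x => B x ^+ 2) <= u.
  have -> : (fun x => B x ^+ 2) =
      (fun x => \sum_c 1 * (\sum_c' (h c / sig c * (h c' / sig c')) * (z c x * z c' x))).
    apply: funext => x; rewrite expr2 /B big_distrlr /=; apply: eq_bigr => c _.
    by rewrite mul1r; apply: eq_bigr => c' _; rewrite mulrACA.
  rewrite Esum; apply: le_trans h2; apply: ler_sum => c _; rewrite mul1r Esum.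
  rewrite (bigD1 c) //= [X in _ + X]big1 ?addr0; last first.
    by move=> c' cc; rewrite Ezz ?mulr0 // eq_sym.
  have /andP [_ hi] := Ez2 c; have s0 := sig0 c.
  have -> : (fun x => z c x * z c x) = (fun x => z c x ^+ 2) by apply: funext => x; rewrite expr2.
  apply: le_trans (ler_wpM2l _ hi) _; first by rewrite -expr2 sqr_ge0.
  by rewrite le_eqVlt; apply/orP; left; apply/eqP; field; rewrite gt_eqF.
have EBq : E (fun x => B x * q x) = 0.
  have -> : (fun x => B x * q x) =
      (fun x => \sum_c 1 * (\sum_c' (h c / sig c / sig c') * (z c x * z c' x ^+ 2))).
    apply: funext => x; rewrite /B /q big_distrlr /=; apply: eq_bigr => c _.
    by rewrite mul1r; apply: eq_bigr => c' _; ring.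
  rewrite Esum big1 // => c _; rewrite mul1r Esum big1 // => c' _.
  by rewrite Ezzz mulr0.
have Ev2 : E (fun x => v x ^+ 2) <= 4 * u + M.
  have -> : (fun x => v x ^+ 2) = (fun x => (4 * B x ^+ 2 + 4 * (B x * q x)) + q x ^+ 2).
    by apply: funext => x; rewrite /v; ring.
  rewrite ED ED EZ EZ EBq mulr0 addr0; apply: lerD; first by rewrite ler_wpM2l.
  apply: le_trans (Eq 2%N isT); apply: Ele => x; rewrite -/(q x).
  by apply: lerXn2r; [rewrite nnegrE|rewrite nnegrE addr_ge0|rewrite lerDr].
have Ev4 : E (fun x => v x ^+ 4) <= u ^+ 2 * (C4 * M).
  apply: le_trans (_ : E (fun x => u ^+ 2 * C4 * (1 + q x) ^+ 4) <= _).
    apply: Ele => x; have -> : v x ^+ 4 = (v x ^+ 2) ^+ 2 by rewrite -exprM.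
    have -> : u ^+ 2 * C4 * (1 + q x) ^+ 4 = (u * ((8 * n%:R + 2) * (1 + q x) ^+ 2)) ^+ 2.
      by rewrite /C4; ring.
    apply: lerXn2r => //; rewrite nnegrE ?sqr_ge0 //.
    by rewrite (le_trans _ (v2 x)) ?sqr_ge0.
  rewrite EZ -mulrA ler_wpM2l ?sqr_ge0 // ler_wpM2l ?sqr_ge0 //; exact: Eq.
have Ev6 : E (fun x => v x ^+ 6) <= u ^+ 3 * (C6 * M).
  have u3 : 0 <= u ^+ 3 by rewrite exprn_ge0 // ltW.
  have c6 : 0 <= C6 by rewrite exprn_ge0 // addr_ge0 // mulr_ge0.
  apply: le_trans (_ : E (fun x => u ^+ 3 * C6 * (1 + q x) ^+ 6) <= _).
    apply: Ele => x; have -> : v x ^+ 6 = (v x ^+ 2) ^+ 3 by rewrite -exprM.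
    have -> : u ^+ 3 * C6 * (1 + q x) ^+ 6 = (u * ((8 * n%:R + 2) * (1 + q x) ^+ 2)) ^+ 3.
      by rewrite /C6; ring.
    apply: lerXn2r => //; rewrite nnegrE ?sqr_ge0 //.
    by rewrite (le_trans _ (v2 x)) ?sqr_ge0.
  rewrite EZ -mulrA ler_wpM2l // ler_wpM2l //; exact: Eq.
have ua0 : 0 <= u `^ (- a) by apply: powR_ge0.
pose b := 13 / 20 * a.
apply: le_trans (_ : E (fun x => u `^ (- a) * (((1 + - (a / u) * v x) + b / u ^+ 2 * v x ^+ 2) +
    a / u ^+ 4 * v x ^+ 4 + 64 * u / u ^+ 6 * v x ^+ 6)) <= _).
  apply: Ele => x; rewrite uv; apply: le_trans (powR_taylor_ge1 a01 u1 (uv1 x)) _.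
  rewrite ler_wpM2l // le_eqVlt; apply/orP; left; apply/eqP.
  by rewrite /b; field; rewrite gt_eqF.
rewrite EZ ler_wpM2l // !ED !EZ.
have Ku : K <= u.
  by rewrite /u lerDl; apply: sumr_ge0 => c _; rewrite divr_ge0 ?sqr_ge0 // ltW.
have uK : 20 * T / a <= u by lra.
have uT : 20 * T <= u * a by rewrite -ler_pdivrMr.
pose iu := u^-1; have iu0 : 0 < iu by rewrite invr_gt0.
have iuE : u * iu = 1 by rewrite mulfV // gt_eqF.
have r1 : - (a / u) * E v <= - (a * iu) * (27 / 10).
  by rewrite ler_wnM2l // oppr_le0 mulr_ge0 ?(ltW a0) ?(ltW iu0).
have b0 : 0 <= b by rewrite mulr_ge0 // ltW.
have r2 : b / u ^+ 2 * E (fun x => v x ^+ 2) <= b * (4 * iu + M * iu ^+ 2).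
  apply: le_trans (ler_wpM2l _ Ev2) _; first by rewrite divr_ge0 ?exprn_ge0 // ltW.
  by rewrite le_eqVlt; apply/orP; left; apply/eqP; rewrite /iu; field; rewrite gt_eqF.
have r4 : a / u ^+ 4 * E (fun x => v x ^+ 4) <= a * C4 * M * iu ^+ 2.
  apply: le_trans (ler_wpM2l _ Ev4) _; first by rewrite divr_ge0 ?exprn_ge0 // ltW.
  by rewrite le_eqVlt; apply/orP; left; apply/eqP; rewrite /iu; field; rewrite gt_eqF.
have r6 : 64 * u / u ^+ 6 * E (fun x => v x ^+ 6) <= 64 * C6 * M * iu ^+ 2.
  apply: le_trans (ler_wpM2l _ Ev6) _; first by rewrite divr_ge0 ?exprn_ge0 ?mulr_ge0 // ltW.
  by rewrite le_eqVlt; apply/orP; left; apply/eqP; rewrite /iu; field; rewrite gt_eqF.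
have r7 : T * iu ^+ 2 <= a / 20 * iu.
  rewrite expr2 mulrA ler_pM2r // ler_pdivrMr // -/iu; lra.
have bM : b * M <= a * M by rewrite ler_wpM2r // /b; lra.
rewrite -[a / 20 / u]/(a / 20 * iu).
have i2 : 0 <= iu ^+ 2 by rewrite sqr_ge0.
have r8 : b * M * iu ^+ 2 <= a * M * iu ^+ 2 by rewrite ler_wpM2r.
move: r7; rewrite /T => r7.
have r9 : b * (4 * iu) = 13 / 5 * (a * iu) by rewrite /b; lra.
lra.
Qed.

End QuadraticDrift.

Lemma gt0_powRN_anti (R : realType) (b x y : R) :
  0 <= b -> 0 < x -> x <= y -> y `^ (- b) <= x `^ (- b).
Proof.
move=> b0 x0 xy; rewrite !powRN lef_pV2 ?posrE ?powR_gt0 //; last exact: lt_le_trans xy.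
by apply: ge0_ler_powR; rewrite ?nnegrE // ltW // (lt_le_trans x0).
Qed.

Lemma powR_inv_base (R : realType) (b x : R) : 0 <= x -> x^-1 `^ b = x `^ (- b).
Proof. by move=> x0; rewrite -powR_inv1 // -powRrM mulN1r. Qed.

(* With [w t := W * t ^ (a * (1 - 2 * delta))], the growth of [w t * f] in one step
   is absorbed by the loss [w t * c * f ^ (1 + 1 / a)] up to a summable error, by
   Young's inequality. *)
Lemma time_weights (R : realType) (a delta c W : R) : 0 < a <= 1 / 100 -> 0 < delta < 2^-1 ->
  0 < c -> 0 < W -> exists2 E : R, 0 <= E & forall tau f : R, 1 <= tau -> 0 <= f ->
  W * (tau + 1) `^ (a * (1 - 2 * delta)) * (f - c * f `^ (1 + a^-1)) +
    E * (tau + 1) `^ (- (2 * a * delta)) <=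
  W * tau `^ (a * (1 - 2 * delta)) * f + E * tau `^ (- (2 * a * delta)).
Proof.
move=> /andP [a0 a1] /andP [d0 d1] c0 W0.
have [CY CY0 hY] := young_power a0 c0.
set th := a * (1 - 2 * delta); set b := 2 * a * delta.
have th00 : 0 < th by rewrite mulr_gt0 //; lra.
have th0 := ltW th00; have th1 : th < 1 by rewrite /th; nra.
have b0 : 0 < b by rewrite !mulr_gt0.
have b1 : b < 1 by rewrite /b; nra.
(* One step lowers [tau ^ (- b)] by at least [b / (2 * tau)] times itself, so this constant gains
   [2 * W * CY * tau ^ (- b - 1)], which is the error left by Young's inequality. *)
exists (4 * W * CY / b); first by rewrite divr_ge0 ?(ltW b0) // !mulr_ge0 // ltW.
move=> tau f tau1 f0; have tau0 : 0 < tau by apply: lt_le_trans tau1.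
have tau10 : 0 < tau + 1 by apply: ltr_wpDl => //; exact: ltW.
have P0 s x : 0 <= x `^ s :> R by exact: powR_ge0.
have step1 : (tau + 1) `^ th <= tau `^ th * (1 + tau^-1).
  have -> : tau + 1 = tau * (1 + tau^-1) by rewrite mulrDr mulr1 mulfV // gt_eqF.
  have i0 : 0 <= tau^-1 by rewrite invr_ge0 ltW.
  rewrite powRM ?addr_ge0 ?(ltW tau0) // ler_wpM2l //.
  apply: le_trans (powR_bernoulli _ _) _; rewrite ?addr_ge0 ?th00 ?th1 //.
  by move: i0 th1 th0; move: (tau^-1) => y; nra.
have mono1 : tau `^ th <= (tau + 1) `^ th.
  by apply: ge0_ler_powR; rewrite ?nnegrE ?(ltW tau0) ?(ltW tau10) // lerDl.
have i1 : tau^-1 <= 1 by rewrite invf_le1.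
have step2 : (tau + 1) `^ (- b) <= tau `^ (- b) * (1 - b / (2 * tau)).
  have e : (tau + 1) `^ (- b) = tau `^ (- b) * (tau / (tau + 1)) `^ b.
    rewrite powRM ?invr_ge0 ?(ltW tau0) ?(ltW tau10) // mulrA -powRD; last first.
      by rewrite (gt_eqF tau0) implybT.
    by rewrite addNr powRr0 mul1r powR_inv_base ?(ltW tau10).
  rewrite e ler_wpM2l //; apply: le_trans (powR_bernoulli _ _) _.
  - by rewrite b0 b1.
  - by rewrite divr_ge0 ?(ltW tau0) ?(ltW tau10).
  have h : tau / (tau + 1) <= 1 - (2 * tau)^-1.
    rewrite ler_pdivrMr //.
    have -> : (1 - (2 * tau)^-1) * (tau + 1) = tau + 1 - 2^-1 - 2^-1 * tau^-1.
      by field; rewrite gt_eqF.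
    by move: i1; lra.
  by have := ler_wpM2l (ltW b0) h; rewrite mulrBr mulr1; move: (_ / (tau + 1)) ((2 * tau)^-1) => u v; lra.
(* [x] is the relative growth of the weight, at most [1 / tau]. Young's inequality for [x * f]
   leaves [x ^ (1 + a)], and [th - (1 + a) = - b - 1] makes the error summable. *)
pose x := ((tau + 1) `^ th - tau `^ th) / (tau + 1) `^ th.
have w'0 : 0 < (tau + 1) `^ th by exact: powR_gt0.
have x0 : 0 <= x by rewrite divr_ge0 ?subr_ge0.
have xt : x <= tau^-1.
  rewrite ler_pdivrMr //; have : tau^-1 * tau `^ th <= tau^-1 * (tau + 1) `^ th.
    by rewrite ler_wpM2l // invr_ge0 ltW.
  by move: step1; lra.
have xw : (tau + 1) `^ th * x = (tau + 1) `^ th - tau `^ th by rewrite mulrC divfK // gt_eqF.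
have hx : x `^ (1 + a) <= tau `^ (- (1 + a)).
  rewrite -powR_inv_base ?(ltW tau0) //; apply: ge0_ler_powR; rewrite ?nnegrE ?invr_ge0 ?(ltW tau0) //.
  by rewrite addr_ge0 // ltW.
have h1 : (tau + 1) `^ th * (x * f - c * f `^ (1 + a^-1)) <= 2 * tau `^ th * (CY * tau `^ (- (1 + a))).
  apply: le_trans (_ : (tau + 1) `^ th * (CY * tau `^ (- (1 + a))) <= _).
    rewrite ler_wpM2l //; have := hY f x f0 x0; have := ler_wpM2l CY0 hx; lra.
  rewrite ler_wpM2r ?mulr_ge0 //; apply: le_trans step1 _.
  by rewrite mulrC ler_wpM2r //; move: i1; lra.
have pE : tau `^ th * tau `^ (- (1 + a)) = tau `^ (- b) * tau^-1.
  rewrite -powR_inv1 ?(ltW tau0) // -!powRD ?(gt_eqF tau0) ?implybT //.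
  by congr (_ `^ _); rewrite /th /b; ring.
have EE : 4 * W * CY / b * b = 4 * W * CY by rewrite mulfVK // gt_eqF.
have h2 := ler_wpM2l (ltW W0) h1.
set Ec := 4 * W * CY / b in EE *.
have Ec0 : 0 <= Ec by rewrite divr_ge0 ?(ltW b0) // !mulr_ge0 // ltW.
have h3 := ler_wpM2l Ec0 step2.
have e3 : Ec * (tau `^ (- b) * (1 - b / (2 * tau))) =
    Ec * tau `^ (- b) - 2 * W * CY * (tau `^ (- b) * tau^-1).
  have -> : Ec * (tau `^ (- b) * (1 - b / (2 * tau))) =
    Ec * tau `^ (- b) - (Ec * b) / 2 * (tau `^ (- b) * tau^-1) by rewrite invfM; ring.
  by rewrite EE; congr (_ - _ * _); lra.
have e4 : W * (2 * tau `^ th * (CY * tau `^ (- (1 + a)))) = 2 * W * CY * (tau `^ (- b) * tau^-1).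
  by rewrite -pE; ring.
have e5 : W * (tau + 1) `^ th * (f - c * f `^ (1 + a^-1)) =
  W * tau `^ th * f + W * ((tau + 1) `^ th * (x * f - c * f `^ (1 + a^-1))).
  have -> : (tau + 1) `^ th * (x * f - c * f `^ (1 + a^-1)) =
    (tau + 1) `^ th * x * f - (tau + 1) `^ th * c * f `^ (1 + a^-1) by ring.
  by rewrite xw; ring.
by rewrite e5; move: h2 h3; rewrite e3 e4; lra.
Qed.

(** * Lattice geometry *)

(* [lia] does not see through matrix entries. *)
Ltac mlia :=
  rewrite /=; repeat match goal with
  | H : context [fun_of_matrix ?A ?i ?j] |- _ => move: H
  end;
  repeat match goal with
  | |- context [fun_of_matrix ?A ?i ?j] => move: (fun_of_matrix A i j) => ?
  end; lia.

Section Lattice.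
Variable d : nat.
Implicit Types x y z u v : lattice d.

(** Distances are measured in this norm: it takes values in [nat], has the same unit vectors in the
    lattice as the Euclidean norm, and exceeds that norm at most by the factor [d]. *)
Definition l1 x : nat := (\sum_(i < d) absz (x ord0 i))%N.

Lemma l10 : l1 0 = 0%N.
Proof. by rewrite /l1 big1 // => i _; rewrite mxE. Qed.

Lemma l1N x : l1 (- x) = l1 x.
Proof. by apply: eq_bigr => i _; rewrite mxE abszN. Qed.

Lemma l1D x y : (l1 (x + y) <= l1 x + l1 y)%N.
Proof. by rewrite /l1 -big_split; apply: leq_sum => i _ /=; rewrite mxE; mlia. Qed.

Lemma l1_sym x y : l1 (x - y) = l1 (y - x).
Proof. by rewrite -l1N opprB. Qed.

Lemma l1_tri y x z : (l1 (x - z) <= l1 (x - y) + l1 (y - z))%N.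
Proof. by apply: leq_trans (l1D _ _); rewrite addrA subrK. Qed.

Lemma l1_coord x i : (absz (x ord0 i) <= l1 x)%N.
Proof. by rewrite /l1 (bigD1 i) //= leq_addr. Qed.

Definition unitv (i : 'I_d) : lattice d := delta_mx 0 i.

Lemma unitvE i j : unitv i ord0 j = (i == j)%:R.
Proof. by rewrite mxE eqxx /= eq_sym. Qed.

Lemma l1_unitv i k : l1 (unitv i *+ k) = k.
Proof.
rewrite /l1 (bigD1 i) //= big1 ?addn0 => [|j /negPf ij].
  by rewrite mulmxnE unitvE eqxx; lia.
by rewrite mulmxnE unitvE eq_sym ij mul0rn.
Qed.

Definition unit_nbrs : seq (lattice d) :=
  [seq unitv i | i <- ord_enum d] ++ [seq - unitv i | i <- ord_enum d].

Lemma l1_1_unit x : l1 x = 1%N -> x \in unit_nbrs.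
Proof.
move=> x1; have /existsP [i xi] : [exists i, x ord0 i != 0].
  apply: contraT => /existsPn h; have : x = 0.
    by apply/rowP => i; rewrite mxE; apply/eqP/negPn/h.
  by move=> x0; move: x1; rewrite x0 l10.
have := x1; rewrite /l1 (bigD1 i) //= => s1.
have xi1 : absz (x ord0 i) = 1%N by mlia.
have s0 : (\sum_(j < d | j != i) absz (x ord0 j) = 0)%N.
  by move: s1; rewrite xi1 -[RHS]addn0 => /addnI.
have xj j : j != i -> x ord0 j = 0.
  move=> ji; apply/eqP; rewrite -absz_eq0 -leqn0; apply: leq_trans (eq_leq s0).
  by rewrite (bigD1 j) //= leq_addr.
have [xe|xe] : x ord0 i = 1 \/ x ord0 i = -1 by mlia.
  rewrite mem_cat; apply/orP; left; apply/mapP; exists i; rewrite ?mem_ord_enum //.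
  apply/rowP => j; rewrite unitvE; case: eqVneq => [<-//|ij].
  by rewrite xj // eq_sym.
rewrite mem_cat; apply/orP; right; apply/mapP; exists i; rewrite ?mem_ord_enum //.
apply/rowP => j; rewrite mxE unitvE; case: eqVneq => [<-//|ij].
by rewrite xj // eq_sym.
Qed.

Lemma size_unit_nbrs : size unit_nbrs = (2 * d)%N.
Proof. have s : size (ord_enum d) = d by rewrite -(size_map val) val_ord_enum size_iota.
by rewrite /unit_nbrs size_cat !size_map s mul2n addnn. Qed.

Section Norms.
Variable R : realType.

Lemma sum_sqr_le_sqr_sum n (F : 'I_n -> nat) :
  (\sum_(i < n) F i ^ 2 <= (\sum_(i < n) F i) ^ 2)%N.
Proof.
rewrite expnS expn1 big_distrl /=; apply: leq_sum => i _.
by rewrite expnS expn1 leq_mul2l (bigD1 i) //= leq_addr orbT.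
Qed.

Lemma enormE x : enorm R x = Num.sqrt ((\sum_(i < d) absz (x ord0 i) ^ 2)%N)%:R.
Proof.
rewrite /enorm natr_sum; congr Num.sqrt; apply: eq_bigr => i _.
by rewrite natrX natr_absz intr_norm real_normK ?num_real.
Qed.

Lemma enorm_le_l1 x : enorm R x <= (l1 x)%:R.
Proof.
rewrite enormE -[leRHS]ger0_norm // -sqrtr_sqr ler_sqrt ?sqr_ge0 //.
by rewrite -natrX ler_nat sum_sqr_le_sqr_sum.
Qed.

Lemma coord_le_enorm x i : (absz (x ord0 i))%:R <= enorm R x.
Proof.
rewrite enormE -[leLHS]ger0_norm // -sqrtr_sqr ler_sqrt ?ler0n //.
by rewrite -natrX ler_nat (bigD1 i) //= leq_addr.
Qed.

Lemma l1_le_enorm x : (l1 x)%:R <= d%:R * enorm R x.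
Proof.
rewrite /l1 natr_sum; apply: le_trans (ler_sum _ (fun i _ => coord_le_enorm x i)) _.
by rewrite sumr_const card_ord mulr_natl.
Qed.

Lemma enorm_eq1 x : enorm R x = 1 <-> l1 x = 1%N.
Proof.
rewrite enormE; have h : (l1 x <= \sum_(i < d) absz (x ord0 i) ^ 2)%N.
  by apply: leq_sum => i _; case: (absz _) => // k; rewrite expnS expn1 leq_pmulr.
have h' := sum_sqr_le_sqr_sum (fun i => absz (x ord0 i)).
split=> [e1|e1].
  have : (((\sum_(i < d) absz (x ord0 i) ^ 2)%N)%:R : R) = 1.
    by rewrite -[LHS]sqr_sqrtr ?ler0n // e1 expr1n.
  move=> /eqP; rewrite pnatr_eq1 => /eqP s1.
  have : l1 x != 0%N.
    apply/eqP => l0; move: h'; rewrite s1 (_ : (\sum_(i < d) _)%N = 0%N) //.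
  by move: h; rewrite s1; lia.
rewrite (_ : (\sum_(i < d) _)%N = 1%N) ?sqrtr1 //.
by apply/eqP; rewrite eqn_leq; move: h h'; rewrite -/(l1 x) e1 => -> ->.
Qed.

Variable beta : R.
Hypothesis beta0 : 0 <= beta.

Lemma phi_gt0 u v : 0 < phi beta u v.
Proof. by apply: powR_gt0; rewrite lt_max ltr01 orbT. Qed.

Lemma phi_ge u v : (1 + (l1 (u - v))%:R) `^ (- beta) <= phi beta u v.
Proof.
apply: gt0_powRN_anti => //; first by rewrite lt_max ltr01 orbT.
rewrite ge_max lerDl ler0n andbT (le_trans (enorm_le_l1 _)) //.
by rewrite lerDr.
Qed.

Lemma phi_le u v :
  phi beta u v <= (d.+1)%:R `^ beta * (1 + (l1 (u - v))%:R) `^ (- beta).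
Proof.
rewrite /phi !powRN; set M := Num.max _ _.
have M1 : 1 <= M by rewrite le_max lexx orbT.
have eM : enorm R (u - v) <= M by rewrite le_max lexx.
have M0 : 0 < M := lt_le_trans ltr01 M1.
have p0 : 0 < 1 + (l1 (u - v))%:R :> R by rewrite ltr_pwDl.
rewrite ler_pdivlMr ?powR_gt0 // mulrC ler_pdivrMr ?powR_gt0 //.
rewrite -powRM ?ler0n ?(ltW M0) //.
apply: ge0_ler_powR; rewrite ?nnegrE ?(ltW p0) ?mulr_ge0 ?ler0n ?(ltW M0) //.
rewrite -natr1 mulrDl mul1r addrC lerD //; apply: le_trans (l1_le_enorm _) _.
by rewrite ler_wpM2l ?ler0n.
Qed.

End Norms.
End Lattice.

(** * Expectations under one step *)

Lemma cvg_sum_seq (R : realType) (T : eqType) (s : seq T) (F : nat -> T -> R) (G : T -> R) :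
  (forall x, x \in s -> F n x @[n --> \oo] --> G x) ->
  \sum_(x <- s) F n x @[n --> \oo] --> \sum_(x <- s) G x.
Proof.
elim: s => [|x s IH] h.
  by rewrite big_nil; under eq_fun do rewrite big_nil; exact: cvg_cst.
rewrite big_cons; under eq_fun do rewrite big_cons.
apply: cvgD; first by apply: h; rewrite mem_head.
by apply: IH => y ys; apply: h; rewrite inE ys orbT.
Qed.

Section Step.
Variables (R : realType) (d m : nat) (beta : R).
Hypothesis m_gt0 : (0 < m)%N.
Hypothesis d_gt0 : (0 < d)%N.
Hypothesis beta_ge0 : 0 <= beta.
Notation L := (lattice d).
Implicit Types (A C : {fset L}) (x y z : L) (xs ys zs : seq L) (f g : seq L -> R).

(** The boundary as a finite set, so that draws become finite sums. *)
Definition bd A : {fset L} :=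
  [fset y in [seq (x + e)%R | x <- enum_fset A, e <- unit_nbrs d] | y \notin A]%fset.

Lemma bdP A y :
  reflect (y \notin A /\ exists2 x, x \in A & l1 (y - x) = 1%N) (y \in bd A).
Proof.
rewrite /bd !inE /=; apply: (iffP andP) => [[/allpairsP [[x e] /= [xA eu ye]] yA]|[yA [x xA yx]]].
  split=> //; exists x => //; rewrite ye addrC addKr.
  move: eu; rewrite mem_cat => /orP [] /mapP [i _ ->]; rewrite ?l1N.
    by have := l1_unitv i 1.
  by have := l1_unitv i 1.
split=> //; apply/allpairsP; exists (x, y - x); split=> //=; last by rewrite addrC subrK.
exact: l1_1_unit.
Qed.

Lemma boundary_bd A : boundary R A = [set` bd A].
Proof.
apply/seteqP; split=> y /=.
  by move=> [yA [x xA e]]; apply/bdP; split=> //; exists x => //; apply/(enorm_eq1 R).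
by move=> /bdP [yA [x xA e]]; split=> //; exists x => //; apply/enorm_eq1.
Qed.

Lemma card_bd A : (#|` bd A| <= #|` A| * (2 * d))%N.
Proof.
have h : (bd A `<=` [fset y in [seq (x + e)%R | x <- enum_fset A, e <- unit_nbrs d]])%fset.
  by apply/fsubsetP => y; rewrite /bd !inE => /andP [].
apply: leq_trans (fsubset_leq_card h) _.
rewrite card_imfset //= (leq_trans (size_undup _)) //.
by rewrite size_allpairs size_unit_nbrs.
Qed.

(** A coordinate ray from [x] has a last site in [A]; the next one is on the boundary. *)
Lemma bd_neq0 A x : x \in A -> exists y, y \in bd A.
Proof.
move=> xA; pose i := Ordinal d_gt0.
have [k [kA kmax]] : exists k : nat, x + unitv i *+ k \in A /\
    forall j, x + unitv i *+ j \in A -> (j <= k)%N.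
  have exA : exists k, x + unitv i *+ k \in A by exists 0%N; rewrite mulr0n addr0.
  have bnd k : x + unitv i *+ k \in A -> (k <= \sum_(y <- A) l1 (y - x))%N.
    move=> kA; rewrite (big_fsetD1 (x + unitv i *+ k)) //= addrC addKr l1_unitv.
    exact: leq_addr.
  by case: (ex_maxnP exA bnd) => k kA km; exists k; split=> // j /km.
exists (x + unitv i *+ k.+1); apply/bdP; split.
  by apply/negP => /kmax; rewrite ltnn.
exists (x + unitv i *+ k) => //; rewrite mulrS addrCA addrK; exact: (l1_unitv i 1).
Qed.

Definition supp C xs : {fset L} :=
  if (size xs == 0)%N then C
  else if (size xs < m)%N then (C `\` [fset y in xs])%fset
  else bd (transport m C xs).

Definition wt xs x : R := if (size xs == 0)%N then 1 else phi beta (last 0 xs) x.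

Definition pr C xs x : R := wt xs x / \sum_(y <- supp C xs) wt xs y.

Lemma wt_gt0 xs x : 0 < wt xs x.
Proof. by rewrite /wt; case: ifP => // _; apply: phi_gt0. Qed.

Lemma fsbig_fset (T : choiceType) (A : {fset T}) (w : T -> R) :
  \sum_(y \in [set` A]) w y = \sum_(y <- A) w y.
Proof. by rewrite fsbig_finite ?set_fsetK. Qed.

Lemma next_probE C xs x :
  next_prob m beta C xs x = (x \in supp C xs)%:R * pr C xs x.
Proof.
rewrite /next_prob /draw /pr /supp /wt; case: ifP => h0; first by rewrite fsbig_fset indicE mem_setE.
case: ifP => h1; first by rewrite fsbig_fset indicE mem_setE.
by rewrite boundary_bd fsbig_fset indicE mem_setE.
Qed.

(** Expectation of [f] over the next [k] draws, given the sites [xs] already drawn. The nested sums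
    allow induction draw by draw. *)
Fixpoint Eseq k C xs f : R :=
  if k is k'.+1 then \sum_(x <- supp C xs) pr C xs x * Eseq k' C (rcons xs x) f
  else f xs.

Definition Estep C (psi : {fset L} -> R) : R :=
  Eseq (2 * m) C [::] (fun xs => psi (transport m C xs)).

(** These are the prefixes of positive probability, as all weights are positive. *)
Inductive legal C : seq L -> Prop :=
| legal_nil : legal C [::]
| legal_rcons xs x : legal C xs -> x \in supp C xs -> legal C (rcons xs x).

Lemma pr_ge0 C xs x : 0 <= pr C xs x.
Proof.
apply: divr_ge0; first exact/ltW/wt_gt0.
by apply: sumr_ge0 => y _; apply/ltW/wt_gt0.
Qed.

Lemma sum_wt_gt0 C xs x : x \in supp C xs -> 0 < \sum_(y <- supp C xs) wt xs y.
Proof.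
move=> xs0; rewrite (big_fsetD1 x) //= ltr_pwDl ?wt_gt0 //.
by apply: sumr_ge0 => y _; apply/ltW/wt_gt0.
Qed.

Lemma sum_pr C xs x : x \in supp C xs -> \sum_(y <- supp C xs) pr C xs y = 1.
Proof.
move=> xs0; rewrite /pr -mulr_suml mulfV //.
by rewrite gt_eqF // (sum_wt_gt0 xs0).
Qed.

Lemma Eseq_le k C xs f g : legal C xs ->
  (forall zs, legal C zs -> size zs = (size xs + k)%N -> f zs <= g zs) ->
  Eseq k C xs f <= Eseq k C xs g.
Proof.
elim: k xs => [|k IH] xs lx h /=; first by apply: h; rewrite ?addn0.
rewrite big_seq [leRHS]big_seq; apply: ler_sum => x xs0.
apply: ler_wpM2l; first exact: pr_ge0.
apply: IH; first exact: legal_rcons.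
by move=> zs lz sz; apply: h => //; rewrite sz size_rcons addSnnS.
Qed.

Lemma Eseq_sum k C xs (I : Type) (s : seq I) (c : I -> R) (F : I -> seq L -> R) :
  Eseq k C xs (fun zs => \sum_(i <- s) c i * F i zs) = \sum_(i <- s) c i * Eseq k C xs (F i).
Proof.
elim: k xs => [|k IH] xs //=.
under eq_bigr do rewrite IH mulr_sumr.
rewrite exchange_big /=; apply: eq_bigr => i _; rewrite mulr_sumr.
by apply: eq_bigr => x _; rewrite mulrCA.
Qed.

Lemma supp_neq0 C xs : (m < #|` C|)%N -> exists x, x \in supp C xs.
Proof using d_gt0.
move=> mC.
have rem s : (size s <= m)%N -> exists x, x \in (C `\` [fset y in s])%fset.
  move=> sm; apply/fset0Pn; rewrite -cardfs_gt0 cardfsD subn_gt0.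
  apply: leq_ltn_trans (leq_ltn_trans sm mC).
  apply: leq_trans (fsubset_leq_card (fsubsetIr _ _)) _.
  by rewrite card_imfset //= size_undup.
rewrite /supp; case: ifP => _; last case: ifP => sm.
- have [x] := rem [::] isT; rewrite !inE /= => xC; exists x; exact: xC.
- exact/rem/ltnW.
- have tm : (size (take m xs) <= m)%N by rewrite size_take_min geq_minl.
  have [x xR] := rem _ tm.
  by apply: (@bd_neq0 _ x); rewrite in_fsetU xR.
Qed.

Lemma Eseq_cst k C xs (c : R) : (m < #|` C|)%N -> Eseq k C xs (fun=> c) = c.
Proof.
move=> mC; elim: k xs => [//|k IH] xs /=.
under eq_bigr do rewrite IH.
have [x xs0] := supp_neq0 xs mC.
by rewrite -mulr_suml (sum_pr xs0) mul1r.
Qed.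

Lemma Eseq_cvg k C xs (F : nat -> seq L -> R) f :
  (forall zs, legal C zs -> size zs = (size xs + k)%N -> F n zs @[n --> \oo] --> f zs) ->
  legal C xs -> Eseq k C xs (F n) @[n --> \oo] --> Eseq k C xs f.
Proof.
elim: k xs => [|k IH] xs h lx /=; first by apply: h; rewrite ?addn0.
apply: cvg_sum_seq => x xs0; apply: cvgM; first exact: cvg_cst.
apply: IH; last exact: legal_rcons.
by move=> zs lz sz; apply: h => //; rewrite sz size_rcons addSnnS.
Qed.

Lemma transport_rcons C xs x : (m <= size xs)%N ->
  transport m C (rcons xs x) = (x |` transport m C xs)%fset.
Proof.
move=> sx; rewrite /transport drop_rcons // -cats1 takel_cat //.
apply/fsetP => y; rewrite !inE /= mem_rcons inE.
by case: (y == x); rewrite ?orbT ?orbF.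
Qed.

Lemma transport_lt C xs : (size xs <= m)%N ->
  transport m C xs = (C `\` [fset y in xs])%fset.
Proof.
move=> sx; rewrite /transport take_oversize // drop_oversize //.
by apply/fsetP => y; rewrite !inE orbF.
Qed.

Lemma legal_prefix C xs : legal C xs -> (size xs <= m)%N ->
  uniq xs /\ {subset xs <= C}.
Proof.
elim=> [|ys x ly IH xs0]; first by split.
rewrite size_rcons => sm; have [uy yC] := IH (ltnW sm).
move: xs0; rewrite /supp sm; case: ifP => [/nilP -> xC|_].
  by split=> // z; rewrite inE => /eqP ->.
rewrite !inE => /andP [xy xC]; split; first by rewrite rcons_uniq xy.
by move=> z; rewrite mem_rcons inE => /orP [/eqP ->//|/yC].
Qed.

(** A transported site is put on the boundary, so it is new and adjacent to a site present: each
    draw adds one to the cardinality and at most one to the distance from [C]. *)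
Lemma legal_transport C xs : legal C xs -> (m <= #|` C|)%N -> (m <= size xs)%N ->
  (#|` transport m C xs| + m = #|` C| + (size xs - m))%N /\
  forall z, z \in transport m C xs ->
    exists2 y, y \in C & (l1 (z - y)%R <= size xs - m)%N.
Proof using m_gt0.
move=> lx mC; elim: lx => [|ys x ly IH xs0]; first by rewrite leqNgt m_gt0.
rewrite size_rcons leq_eqVlt => /orP [/eqP sm|]; last first.
  rewrite ltnS => sm; have [IH1 IH2] := IH sm.
  move: xs0; rewrite /supp; case: ifP => [/nilP e|_].
    by move: sm; rewrite e leqNgt m_gt0.
  rewrite ltnNge sm /= => /bdP [xn [y yT xy]].
  rewrite transport_rcons //; split; first by rewrite cardfsU1 xn add1n addSn IH1 subSn // addnS.
  move=> z; rewrite in_fset1U => /orP [/eqP ->|/IH2 [w wC zw]].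
    have [w wC yw] := IH2 _ yT; exists w => //.
    by apply: leq_trans (l1_tri y _ _) _; rewrite xy add1n subSn.
  by exists w => //; apply: leq_trans zw _; rewrite leq_sub2r.
have lr : legal C (rcons ys x) by apply: legal_rcons.
have sr : (size (rcons ys x) <= m)%N by rewrite size_rcons sm.
have [ur rC] := legal_prefix lr sr.
rewrite transport_lt // -sm subnn addn0; split; last first.
  by move=> z; rewrite !inE => /andP [_ zC]; exists z => //; rewrite subrr l10.
rewrite cardfsDS; last by apply/fsubsetP => z; rewrite !inE => /rC.
rewrite card_imfset //= undup_id // size_rcons -sm.
by rewrite subnK.
Qed.

Lemma legal_full C xs : legal C xs -> (m < #|` C|)%N -> size xs = (2 * m)%N ->
  #|` transport m C xs| = #|` C| /\
  forall z, z \in transport m C xs -> exists2 y, y \in C & (l1 (z - y)%R <= m)%N.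
Proof using m_gt0.
move=> lx mC sx; have sm : (size xs - m = m)%N by rewrite sx mul2n -addnn addnK.
have := legal_transport lx (ltnW mC); rewrite sm => -[|cT nr].
  by rewrite sx mul2n -addnn leq_addr.
by split=> //; move/addIn: cT.
Qed.

Fixpoint outcomes k C xs : seq (seq L) :=
  if k is k'.+1 then flatten [seq outcomes k' C (rcons xs x) | x <- supp C xs]
  else [:: xs].

Lemma take_rcons_inv xs x zs : take (size xs).+1 zs = rcons xs x ->
  nth 0 zs (size xs) = x /\ take (size xs) zs = xs.
Proof.
move=> tz; split.
  by rewrite -(nth_take _ (ltnSn _)) tz nth_rcons ltnn eqxx.
by rewrite -(take_takel _ (leqnSn _)) tz -cats1 take_size_cat.
Qed.

Lemma outcomesP k C xs zs : zs \in outcomes k C xs =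
  [&& size zs == (size xs + k)%N, take (size xs) zs == xs &
   all (fun l => nth 0 zs l \in supp C (take l zs)) (iota (size xs) k)].
Proof.
elim: k xs => [|k IH] xs /=.
  rewrite inE addn0 andbT; apply/eqP/andP => [->|[/eqP sz /eqP <-]].
    by rewrite take_size !eqxx.
  by rewrite -sz take_size.
apply/flatten_mapP/idP => [[x xs0]|].
  rewrite IH size_rcons => /and3P [/eqP sz /eqP tz a].
  have [xz tx] := take_rcons_inv tz.
  by rewrite sz addSnnS eqxx tx eqxx xz xs0 a.
move=> /and4P [/eqP sz /eqP tx xs0 a]; exists (nth 0 zs (size xs)); first by rewrite tx in xs0.
rewrite IH size_rcons sz addSnnS eqxx a andbT /=.
by rewrite (take_nth 0) ?tx // sz addnS ltnS leq_addr.
Qed.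

Lemma outcomes_uniq k C xs : uniq (outcomes k C xs).
Proof.
elim: k xs => [//|k IH] xs /=.
elim: (enum_fset _) (fset_uniq (supp C xs)) => //= x s IHs /andP [xs0 us].
rewrite cat_uniq IH IHs // andbT /=; apply/hasPn => zs /flatten_mapP [y ys].
rewrite !outcomesP !size_rcons => /and3P [_ /eqP t1 _]; apply/negP => /and3P [_ /eqP t2 _].
by move: t2; rewrite t1 => /rcons_inj [] e; move: xs0; rewrite -e ys.
Qed.

Lemma Eseq_outcomes k C xs f : Eseq k C xs f =
  \sum_(zs <- outcomes k C xs)
    (\prod_(l <- iota (size xs) k) next_prob m beta C (take l zs) (nth 0 zs l)) * f zs.
Proof.
elim: k xs => [|k IH] xs /=; first by rewrite big_seq1 big_nil mul1r.
rewrite big_flatten big_map /= big_seq [RHS]big_seq; apply: eq_bigr => x xs0.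
rewrite IH mulr_sumr big_seq [RHS]big_seq; apply: eq_bigr => zs.
rewrite outcomesP size_rcons => /and3P [_ /eqP tz _].
rewrite big_cons mulrA; congr (_ * _ * _).
have [-> ->] := take_rcons_inv tz.
by rewrite next_probE xs0 mul1r.
Qed.

Lemma sequence_probE C (xs : (2 * m).-tuple L) : sequence_prob beta C xs =
  \prod_(l <- iota 0 (2 * m)) next_prob m beta C (take l xs) (nth 0 xs l).
Proof.
have -> : iota 0 (2 * m) = index_iota 0 (2 * m) by rewrite /index_iota subn0.
rewrite big_mkord.
by apply: eq_bigr => l _; rewrite (tnth_nth 0).
Qed.

Lemma outcomes_legal k C xs zs : legal C xs -> zs \in outcomes k C xs -> legal C zs.
Proof.
elim: k xs => [|k IH] xs lx /=; first by rewrite inE => /eqP ->.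
by move=> /flatten_mapP [x xs0]; apply: IH; apply: legal_rcons.
Qed.

Lemma cat_stateP (C : cat_state d m) : (m < #|` val C|)%N.
Proof. by case: C => C /=; rewrite addn1. Qed.

(** The sum over tuples is regrouped by the configuration reached; [s] is any finite set of states
    containing all possible successors. *)
Lemma kernel_Estep (C : cat_state d m) (s : {fset cat_state d m}) (psi : {fset L} -> R) :
  (forall xs (C' : cat_state d m), xs \in outcomes (2 * m) (val C) [::] ->
     transport m (val C) xs = val C' -> C' \in s) ->
  \sum_(C' <- s) cat_kernel beta C C' * psi (val C') = Estep (val C) psi.
Proof.
move=> hs; pose O := outcomes (2 * m) (val C) [::].
have szO zs : zs \in O -> size zs = (2 * m)%N by rewrite outcomesP => /and3P [/eqP].
have [B BP] : exists B : {fset (2 * m).-tuple L}, forall t, (t \in B) = (val t \in O).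
  by exists [fset t in pmap insub O]%fset => t; rewrite !inE /= mem_pmap_sub.
have kE (C' : cat_state d m) : cat_kernel beta C C' =
    \sum_(t <- B | transport m (val C) t == val C') sequence_prob beta (val C) t.
  rewrite /cat_kernel [RHS]big_fset_condE /= -[RHS]fsbig_fset.
  (* A tuple outside the outcomes has a draw off its support, so its probability vanishes. *)
  apply/esym/fsbig_widen => [t /=|t /= [tC /negP]]; first by rewrite !inE => /andP [_ /eqP].
  rewrite !inE /= tC eqxx andbT BP outcomesP size_tuple add0n eqxx take0 eqxx /=.
  move=> /allPn [l lm lt]; rewrite sequence_probE.
  by rewrite (bigD1_seq l) ?iota_uniq //= next_probE (negPf lt) !mul0r.
under eq_bigr do rewrite kE mulr_suml.
rewrite (exchange_big_dep predT) //= /Estep Eseq_outcomes.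
transitivity (\sum_(t <- B) sequence_prob beta (val C) t * psi (transport m (val C) t)).
  rewrite big_seq [RHS]big_seq; apply: eq_bigr => t; rewrite BP => tO.
  have lt : legal (val C) t by apply: outcomes_legal tO; exact: legal_nil.
  have mC := cat_stateP C.
  have [cT _] := legal_full lt mC (size_tuple t).
  have cS : (m + 1 <= #|` transport m (val C) t|)%N by rewrite cT; exact: (valP C).
  have [C' C'E] : exists C' : cat_state d m, val C' = transport m (val C) t.
    by exists (exist (fun D : {fset L} => is_true (m + 1 <= #|` D|)%N) _ cS).
  have C's : C' \in s by apply: (hs t).
  rewrite big_mkcond (bigD1_seq C') ?fset_uniq //= -[sval C']/(val C') C'E eqxx.
  rewrite big1 ?addr0 // => D DC'; case: eqP => // e; case/negP: DC'.
  by apply/eqP/val_inj; rewrite /= -e -C'E.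
transitivity (\sum_(t <- pmap insub O : seq ((2 * m).-tuple L))
    sequence_prob beta (val C) t * psi (transport m (val C) t)).
  apply: perm_big; apply: uniq_perm.
  - exact: fset_uniq.
  - by apply: pmap_sub_uniq; apply: outcomes_uniq.
  - by move=> t; rewrite BP mem_pmap_sub.
rewrite big_pmap [LHS]/= big_seq [RHS]big_seq; apply: eq_bigr => zs zO.
by rewrite insubT ?szO //= => sz; rewrite sequence_probE.
Qed.

End Step.

(** * Possible moves: merging and crawling *)

Lemma near_arith (n a b c w : nat) :
  (a <= b + c -> b <= w -> c <= n -> 1 + a <= n.+1 * (1 + w))%N.
Proof. nia. Qed.

Section Moves.
Variables (R : realType) (d m : nat) (beta : R).
Hypothesis m_gt0 : (0 < m)%N.
Hypothesis d_gt0 : (0 < d)%N.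
Hypothesis beta_ge0 : 0 <= beta.
Notation L := (lattice d).
Implicit Types (A C : {fset L}) (x y z : L) (xs ys zs s : seq L) (ss : seq (seq L)).

(** Such a site is drawn with probability at least [c] divided by the number of candidates. *)
Definition good (c : R) C xs x : Prop :=
  x \in supp m C xs /\ forall y, y \in supp m C xs -> c * wt beta xs y <= wt beta xs x.

Inductive goodseq (c : R) C : seq L -> Prop :=
| good_nil : goodseq c C [::]
| good_rcons xs x : goodseq c C xs -> good c C xs x -> goodseq c C (rcons xs x).

Lemma goodseq_legal c C xs : goodseq c C xs -> legal m C xs.
Proof. by elim=> [|ys x _ IH [xs0 _]]; [exact: legal_nil|exact: legal_rcons]. Qed.

(** During the transport there are at most [#|C| + m <= 2 * #|C|] sites, with [2 * d] neighbours
    each. *)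
Lemma card_supp C xs : (size xs <= 2 * m)%N -> (m <= #|` C|)%N ->
  (#|` supp m C xs| <= 4 * d * #|` C|)%N.
Proof using d_gt0.
move=> sx mC; rewrite /supp.
have CN : (#|` C| <= 4 * d * #|` C|)%N by rewrite leq_pmull // muln_gt0.
case: ifP => // _; case: ifP => _.
  by apply: leq_trans CN; apply: fsubset_leq_card; apply: fsubsetDl.
apply: leq_trans (card_bd _) _.
have h : (#|` transport m C xs| <= #|` C| + m)%N.
  rewrite /transport; apply: leq_trans (leq_card_fsetU _ _).1 _; apply: leq_add.
    by apply: fsubset_leq_card; apply: fsubsetDl.
  by rewrite card_imfset //= (leq_trans (size_undup _)) // size_drop leq_subLR addnn -mul2n.
have h2 : (#|` transport m C xs| <= 2 * #|` C|)%N.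
  by apply: leq_trans h _; rewrite mul2n -addnn leq_add2l.
apply: leq_trans (leq_mul h2 (leqnn _)) _.
by rewrite mulnACA -[(4 * d * _)%N]mulnA [(d * _)%N]mulnC.
Qed.

(** The fraction of weight guaranteed to a site for which 1 plus the distance is at most [Lam] times
    that of any competitor; [d.+1] is the price of using [l1] instead of the Euclidean norm. *)
Definition cL (Lam : nat) : R := ((Lam * d.+1)%:R `^ beta)^-1.

Lemma cL_gt0 Lam : (0 < Lam)%N -> 0 < cL Lam.
Proof. by move=> L0; rewrite invr_gt0 powR_gt0 // ltr0n muln_gt0 L0. Qed.

Lemma cL_le1 Lam : (0 < Lam)%N -> cL Lam <= 1.
Proof.
move=> L0; rewrite invf_le1 ?powR_gt0 ?ltr0n ?muln_gt0 ?L0 //.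
apply: le_trans (_ : 1 `^ beta <= _); first by rewrite powR1.
apply: ge0_ler_powR; rewrite ?nnegrE //.
by rewrite ler1n muln_gt0 L0.
Qed.

Lemma phi_ratio (Lam : nat) (u x y : L) : (0 < Lam)%N ->
  (1 + l1 (u - x) <= Lam * (1 + l1 (u - y)))%N ->
  cL Lam * phi beta u y <= phi beta u x.
Proof.
move=> L0 h; apply: le_trans (phi_ge beta_ge0 u x).
apply: le_trans (ler_wpM2l (ltW (cL_gt0 L0)) (phi_le beta_ge0 u y)) _.
rewrite /cL natrM powRM ?ler0n // invfM -mulrA mulKf; last first.
  by rewrite gt_eqF // powR_gt0 // ltr0n.
have p0 : 0 < Lam%:R :> R by rewrite ltr0n.
rewrite -powRN -powRM ?ler0n ?addr_ge0 //.
apply: gt0_powRN_anti => //.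
by rewrite -[1]/(1%:R) -!natrD -natrM ler_nat.
Qed.

Lemma good_l1 (Lam : nat) C xs x : (0 < Lam)%N -> x \in supp m C xs ->
  (xs <> [::] -> forall y, y \in supp m C xs ->
     (1 + l1 (last 0%R xs - x)%R <= Lam * (1 + l1 (last 0%R xs - y)%R))%N) ->
  good (cL Lam) C xs x.
Proof.
move=> L0 xs0 h; split=> [|y ys0]; first exact: xs0.
rewrite /wt; case: eqP => [_|e]; first by rewrite mulr1 cL_le1.
by apply: phi_ratio => //; apply: h => // xs_nil; apply: e; rewrite xs_nil.
Qed.

(** Lower bound for the probability of one prescribed step: [2 * m] good draws, each from at most
    [4 * d * n] candidates. *)
Definition trp (n Lam : nat) : R := (cL Lam / (4 * d * n)%:R) ^+ (2 * m).

Lemma trp_gt0 n Lam : (0 < n)%N -> (0 < Lam)%N -> 0 < trp n Lam.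
Proof.
move=> n0 L0; rewrite exprn_gt0 // divr_gt0 ?cL_gt0 // ltr0n !muln_gt0.
by rewrite n0 d_gt0.
Qed.

Lemma trp_le1 n Lam : (0 < n)%N -> (0 < Lam)%N -> trp n Lam <= 1.
Proof.
move=> n0 L0; have D0 : (0 < 4 * d * n)%N by rewrite !muln_gt0 n0 d_gt0.
rewrite exprn_ile1 // ?ler_pdivrMr ?ltr0n // ?mul1r.
  by rewrite divr_ge0 ?ler0n // ltW // cL_gt0.
by apply: le_trans (cL_le1 L0) _; rewrite ler1n.
Qed.

(* CAT jumps from [C] to [C'] with probability at least [p], tested against
   nonnegative observables. *)
Definition trans (p : R) C C' : Prop :=
  forall psi : {fset L} -> R, (forall D, 0 <= psi D) -> p * psi C' <= Estep m beta C psi.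

Lemma pr_lower (c : R) C xs x : good c C xs x ->
  (m < #|` C|)%N -> (size xs < 2 * m)%N -> c / (4 * d * #|` C|)%:R <= pr m beta C xs x.
Proof.
move=> [xs0 h] mC sx; have C0 : (0 < #|` C|)%N by apply: leq_ltn_trans mC.
rewrite /pr ler_pdivrMr ?ltr0n ?muln_gt0 ?d_gt0 //.
rewrite mulrAC ler_pdivlMr ?(sum_wt_gt0 _ xs0) //.
rewrite mulr_sumr big_seq; apply: le_trans (ler_sum _ h) _.
rewrite -big_seq big_const_seq count_predT iter_addr_0 -[leLHS]mulr_natr.
rewrite ler_wpM2l ?(ltW (wt_gt0 _ _ _)) // ler_nat.
by apply: card_supp; [exact: ltnW|exact: ltnW].
Qed.

Lemma goodseq_trans (Lam : nat) C xs : (0 < Lam)%N -> (m < #|` C|)%N ->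
  goodseq (cL Lam) C xs -> size xs = (2 * m)%N ->
  trans (trp #|` C| Lam) C (transport m C xs).
Proof.
move=> L0 mC gx sx psi psi0.
pose q := cL Lam / (4 * d * #|` C|)%:R.
have C0 : (0 < #|` C|)%N by apply: leq_ltn_trans mC.
have q0 : 0 <= q by rewrite divr_ge0 ?ler0n // ltW // cL_gt0.
pose f xs := psi (transport m C xs).
have f0 xs' : 0 <= f xs' by apply: psi0.
have E0 k ys : 0 <= Eseq m beta k C ys f.
  elim: k ys => [|k IH] ys //=; apply: sumr_ge0 => y _.
  by rewrite mulr_ge0 // pr_ge0.
suff h : forall ys k, goodseq (cL Lam) C ys -> (size ys + k = 2 * m)%N ->
    q ^+ size ys * Eseq m beta k C ys f <= Eseq m beta (2 * m) C [::] f.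
  by have := h xs 0%N gx; rewrite addn0 sx /=; apply.
move=> ys k gy; elim: gy k => [|zs x gz IH gd] k.
  by rewrite /= add0n expr0 mul1r => ->.
rewrite size_rcons addSnnS => sz; apply: le_trans (IH _ sz).
rewrite exprSr -mulrA ler_wpM2l ?exprn_ge0 //=.
have [xs0 _] := gd; rewrite (big_fsetD1 x) //=.
rewrite -[leLHS]addr0 lerD //; last by apply: sumr_ge0 => y _; rewrite mulr_ge0 // pr_ge0.
rewrite ler_wpM2r // /q pr_lower //; lia.
Qed.

(** A connected set listed in an order of growth, so that its last site can be removed without
    losing connectivity. *)
Inductive tree : seq L -> Prop :=
| tree1 x : tree [:: x]
| tree_rcons s x y : tree s -> y \in s -> l1 (x - y) = 1%N -> tree (rcons s x).

Lemma tree_belast s x : tree (rcons s x) -> s = [::] \/ tree s.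
Proof.
move=> t; inversion t as [z e|s' x' y ts _ _ e].
  by move: e; rewrite -[[:: z]]/(rcons [::] z) => /rcons_inj [<- _]; left.
by move/rcons_inj: e => [<- _]; right.
Qed.

Lemma tree_neq0 s : tree s -> s <> [::].
Proof. by case=> [x|s' x y _ _ _] //; case: s'. Qed.

Lemma tree_l1 s : tree s -> {in s &, forall x y, (l1 (x - y)%R <= size s)%N}.
Proof.
elim=> [x|s' x y t IH ys xy] u v; rewrite ?size_rcons ?mem_rcons !inE.
  by move=> /eqP -> /eqP ->; rewrite subrr l10.
move=> /orP [/eqP ->|us] /orP [/eqP ->|vs].
- by rewrite subrr l10.
- by apply: leq_trans (l1_tri y _ _) _; rewrite xy add1n ltnS IH.
- by apply: leq_trans (l1_tri y _ _) _; rewrite [l1 (y - x)]l1_sym xy addn1 ltnS IH.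
- exact/leqW/IH.
Qed.

(** The trees may touch; they are not the connected components of [C]. Hence a removal or an
    addition of a site affects a single tree. *)
Definition forest C ss : Prop :=
  [/\ forall s, s \in ss -> tree s, uniq (flatten ss) & flatten ss =i C].

Lemma forest_perm C ss ss' : perm_eq ss ss' -> forest C ss -> forest C ss'.
Proof.
move=> pss [ts us eC]; have pf := perm_flatten pss; split.
- by move=> s; rewrite -(perm_mem pss); apply: ts.
- by rewrite -(perm_uniq pf).
- by move=> x; rewrite -(perm_mem pf) eC.
Qed.

Lemma forest_remove C s x ss : forest C (rcons s x :: ss) ->
  forest (C `\ x)%fset (if s is [::] then ss else s :: ss).
Proof.
move=> [ts us eC]; have us' : uniq (x :: flatten (s :: ss)).
  by rewrite /= -[_ && _]/(uniq (x :: (s ++ flatten ss))) -cat_cons -(perm_uniq (_ : perm_eq (rcons s x ++ flatten ss) _)) // perm_cat2r perm_rcons.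
have eC' : flatten (s :: ss) =i (C `\ x)%fset.
  move=> z; rewrite in_fsetD1 -eC /= !mem_cat mem_rcons inE.
  case: eqVneq => [->|_] //=; move: us'; rewrite /= mem_cat => /andP [/negPf -> _].
  by [].
have ts' s' : s' \in ss -> tree s' by move=> s's; apply: ts; rewrite inE s's orbT.
have tsx := ts _ (mem_head _ _).
case/andP: us' => _ us'; case: s => [|z s] in ts us eC us' eC' tsx *; first by split.
split=> // s'; rewrite inE => /orP [/eqP ->|/ts' //].
by have [|] := tree_belast tsx.
Qed.

Lemma forest_attach C s x y ss : forest C (s :: ss) -> y \in s -> x \notin C ->
  l1 (x - y) = 1%N -> forest (x |` C)%fset (rcons s x :: ss).
Proof.
move=> [ts us eC] ys xC xy; split.
- move=> s'; rewrite inE => /orP [/eqP ->|s's]; last by apply: ts; rewrite inE s's orbT.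
  by apply: tree_rcons xy => //; apply: ts; rewrite mem_head.
- rewrite /= cat_rcons -cat1s uniq_catCA cat1s cons_uniq us andbT.
  by move: xC; rewrite -eC /= mem_cat.
- by move=> z; rewrite in_fset1U -eC /= !mem_cat mem_rcons inE orbA.
Qed.

Lemma ex_nearest A x z : z \in A ->
  exists2 y, y \in A & forall w, w \in A -> (l1 (x - y)%R <= l1 (x - w)%R)%N.
Proof.
move=> zA; have ex : exists k, [exists y : A, l1 (x - val y) == k].
  by exists (l1 (x - z)); apply/existsP; exists [` zA]%fset => /=.
case: (ex_minnP ex) => k /existsP [y /eqP yk] kmin; exists (val y); first exact: valP.
move=> w wA; rewrite yk; apply: kmin; apply/existsP; by exists [` wA]%fset => /=.
Qed.

Lemma fset_rcons_D C xs x :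
  (C `\` [fset y in rcons xs x] = (C `\` [fset y in xs]) `\ x)%fset.
Proof.
by apply/fsetP => z; rewrite !inE /= mem_rcons inE negb_or -andbA.
Qed.

(** The sites are activated from the last leaf backwards. They are within [n] of one another, so
    each draw has a weight comparable to the largest possible one. *)
Lemma remove_tree n C s ss xs :
  goodseq (cL n.+1) C xs -> (xs <> [::] -> forall y, y \in s -> (l1 (last 0%R xs - y)%R <= n)%N) ->
  (size s <= n)%N -> forest (C `\` [fset y in xs])%fset (s :: ss) ->
  (size xs + size s <= m)%N ->
  exists xs', [/\ goodseq (cL n.+1) C xs', size xs' = (size xs + size s)%N &
    forest (C `\` [fset y in xs'])%fset ss].
Proof.
move=> gx nx sn fo sm.
have ts : tree s by case: fo => ts _ _; apply: ts; rewrite mem_head.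
elim/last_ind: s xs ts sn sm gx nx fo => [|s x IH] xs ts sn sm gx nx fo.
  by have := tree_neq0 ts.
have gx' : goodseq (cL n.+1) C (rcons xs x).
  apply: good_rcons => //; apply: good_l1 => //.
    have xC : x \in (C `\` [fset y in xs])%fset.
      by case: fo => _ _ <-; rewrite /= mem_cat mem_rcons mem_head.
    rewrite /supp; case: ifP => [/nilP e|_]; first by move: xC; rewrite e !inE.
    case: ifP => // /negP []; apply: leq_trans sm; rewrite size_rcons; lia.
  move=> x0 y _; have := nx x0 x; rewrite mem_rcons mem_head => /(_ isT); nia.
have fo' := forest_remove fo.
rewrite -fset_rcons_D in fo'.
case: s => [|z s] in IH ts sn sm nx fo fo' *.
  by exists (rcons xs x); rewrite size_rcons addn1.
have tzs : tree (z :: s) by have [|] := tree_belast ts.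
have [||||||xs' [g' s' f']] := IH (rcons xs x) => //.
- by move: sn; rewrite size_rcons => /ltnW.
- by move: sm; rewrite !size_rcons addSnnS.
- move=> _ y ys; rewrite last_rcons; apply: leq_trans sn.
  by apply: (tree_l1 ts); rewrite mem_rcons ?mem_head // inE ys orbT.
by exists xs'; split=> //; rewrite s' !size_rcons addSnnS.
Qed.

(** The site nearest to the last activated one need not be a removable leaf, but the last leaf of
    its tree is at most [n] further away, which costs only a factor [n.+1]. *)
Lemma remove_some n C ss xs k :
  #|` C| = n -> (m < n)%N -> goodseq (cL n.+1) C xs -> xs <> [::] ->
  (size xs + k = m)%N -> forest (C `\` [fset y in xs])%fset ss ->
  exists xs' ss', [/\ goodseq (cL n.+1) C xs', size xs' = m,
    forest (C `\` [fset y in xs'])%fset ss' & (size ss' <= size ss)%N].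
Proof.
move=> Cn mn; elim: k xs ss => [|k IH] xs ss gx x0 sx fo.
  by exists xs, ss; rewrite -sx addn0.
have sm : (size xs < m)%N by rewrite -sx addnS ltnS leq_addr.
have [ux xC] := legal_prefix (goodseq_legal gx) (ltnW sm).
have [z zR] : exists z, z \in (C `\` [fset y in xs])%fset.
  apply/fset0Pn; rewrite -cardfs_gt0 cardfsD subn_gt0 Cn.
  apply: leq_ltn_trans (fsubset_leq_card (fsubsetIr _ _)) _.
  by rewrite card_imfset //= undup_id //; apply: ltn_trans mn.
have [y yR ymin] := ex_nearest (last 0 xs) zR.
have [s sss ys] : exists2 s, s \in ss & y \in s.
  by move: yR; case: (fo) => _ _ <- /flattenP [s]; exists s.
have ts : tree s by case: fo => ts _ _; exact: ts.
have fo1 := forest_perm (perm_to_rem sss) fo.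
case/lastP: s => [|s x] in sss ys ts fo1 *; first by [].
have xR : x \in (C `\` [fset y in xs])%fset.
  by case: fo1 => _ _ <-; rewrite /= mem_cat mem_rcons mem_head.
have sn : (size (rcons s x) <= n)%N.
  case: fo1 => _ uf ef; rewrite -Cn; apply: uniq_leq_size.
    by move: uf; rewrite /= cat_uniq => /andP [].
  move=> w ws; have : w \in (C `\` [fset y in xs])%fset by rewrite -ef /= mem_cat ws.
  by rewrite !inE => /andP [].
have supE : supp m C xs = (C `\` [fset y in xs])%fset.
  by rewrite /supp sm; case: ifP => // /nilP.
have gx' : goodseq (cL n.+1) C (rcons xs x).
  apply: good_rcons => //; apply: good_l1 => //; rewrite supE // => _ w wR.
  have h1 := ymin _ wR.
  have h2 : (l1 (y - x)%R <= n)%N.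
    by apply: leq_trans sn; apply: (tree_l1 ts) => //; rewrite mem_rcons mem_head.
  exact: near_arith (l1_tri y (last 0 xs) x) h1 h2.
have fo2 := forest_remove fo1; rewrite -fset_rcons_D in fo2.
have [||xs' [ss' [g' s' f' l']]] := IH _ _ gx' _ _ fo2.
- by case: (xs).
- by rewrite size_rcons addSnnS.
exists xs', ss'; split=> //; apply: leq_trans l' _.
rewrite -[leqRHS](perm_size (_ : perm_eq (rcons s x :: seq.rem (rcons s x) ss) ss)).
  by case: (s).
by rewrite perm_sym perm_to_rem.
Qed.

(** Each site is put on the nearest boundary site and joins a tree present next to it, so no tree is
    created. *)
Lemma attach_some (Lam : nat) C ss xs k :
  (0 < Lam)%N -> (m < #|` C|)%N -> goodseq (cL Lam) C xs -> (m <= size xs)%N ->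
  (size xs + k = 2 * m)%N -> forest (transport m C xs) ss ->
  exists xs' ss', [/\ goodseq (cL Lam) C xs', size xs' = (2 * m)%N,
    forest (transport m C xs') ss' & size ss' = size ss].
Proof.
move=> L0 mC; elim: k xs ss => [|k IH] xs ss gx mx sx fo.
  by exists xs, ss; rewrite -sx addn0.
have x0 : xs <> [::] by move=> e; move: mx; rewrite e leqNgt m_gt0.
have supE : supp m C xs = bd (transport m C xs).
  by rewrite /supp ltnNge mx /=; case: ifP => // /nilP.
have [z zT] : exists z, z \in transport m C xs.
  have [cT _] := legal_transport m_gt0 (goodseq_legal gx) (ltnW mC) mx.
  by apply/fset0Pn; rewrite -cardfs_gt0; lia.
have [w wB] := bd_neq0 d_gt0 zT.
have [x xB xmin] := ex_nearest (last 0 xs) wB.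
have gx' : goodseq (cL Lam) C (rcons xs x).
  apply: good_rcons => //; apply: good_l1 => //; rewrite supE // => _ v vB.
  apply: leq_trans (leq_pmull _ L0); rewrite leq_add2l; exact: xmin.
have /bdP [xT [y yT xy]] := xB.
have [s sss ys] : exists2 s, s \in ss & y \in s.
  by move: yT; case: (fo) => _ _ <- /flattenP [s]; exists s.
have fo1 := forest_attach (forest_perm (perm_to_rem sss) fo) ys xT xy.
rewrite -transport_rcons // in fo1.
have [||xs' [ss' [g' s' f' l']]] := IH _ _ gx' _ _ fo1.
- by rewrite size_rcons leqW.
- by rewrite size_rcons addSnnS.
exists xs', ss'; split=> //; rewrite l' /=.
by rewrite (perm_size (perm_to_rem sss)).
Qed.

Lemma merge_step C ss s : (m < #|` C|)%N -> forest C ss -> s \in ss -> (size s <= m)%N ->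
  exists C' ss', [/\ trans (trp #|` C| #|` C|.+1) C C', #|` C'| = #|` C|,
    forest C' ss' & (size ss' < size ss)%N].
Proof.
move=> mC fo sss sm; set n := #|` C|.
have fo1 := forest_perm (perm_to_rem sss) fo.
have C0 : (C `\` [fset y in [::]] = C)%fset by apply/fsetP => z; rewrite !inE.
have [||||xs [gx sx fx]] := @remove_tree n C s (seq.rem s ss) [::] (good_nil _ _).
- by [].
- exact: ltnW (leq_ltn_trans sm mC).
- by rewrite C0.
- by [].
have s0 : (0 < size s)%N.
  by case: fo => ts _ _; have := tree_neq0 (ts _ sss); case: (s).
have x0 : xs <> [::] by move=> e; move: sx s0; rewrite e /= add0n => <-.
have [|xs1 [ss1 [g1 s1 f1 l1]]] := @remove_some n C _ xs (m - size s) erefl mC gx x0 _ fx.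
  by rewrite sx add0n subnKC.
rewrite -(@transport_lt _ m) ?s1 // in f1.
have [|||xs2 [ss2 [g2 s2 f2 l2]]] := @attach_some n.+1 C ss1 xs1 m _ mC g1 _ _ f1.
- by [].
- by rewrite s1.
- by rewrite s1 addnn mul2n.
exists (transport m C xs2), ss2; split=> //.
- exact: goodseq_trans.
- by have [] := legal_full m_gt0 (goodseq_legal g2) mC s2.
- rewrite l2 (perm_size (perm_to_rem sss)) /=.
  exact: leq_ltn_trans l1 _.
Qed.

Inductive reach (p : R) : nat -> {fset L} -> {fset L} -> Prop :=
| reach0 C : reach p 0 C C
| reachS k C C1 C2 : trans p C C1 -> #|` C1| = #|` C| -> reach p k C1 C2 -> reach p k.+1 C C2.

(* While some tree has at most [m] sites, it can be activated whole, completed by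
   leaves of the trees closest to it, and reattached elsewhere: the number of
   trees drops. *)
Lemma merge C : (m < #|` C|)%N ->
  exists k C' ss, [/\ (k <= #|` C|)%N, reach (trp #|` C| #|` C|.+1) k C C',
    #|` C'| = #|` C|, forest C' ss & forall s, s \in ss -> (m < size s)%N].
Proof.
move=> mC; set n := #|` C|.
suff h N : forall D ss, (m < #|` D|)%N -> #|` D| = n -> forest D ss -> (size ss <= N)%N ->
    exists k C' ss', [/\ (k <= N)%N, reach (trp n n.+1) k D C', #|` C'| = n, forest C' ss' &
      forall s, s \in ss' -> (m < size s)%N].
  apply: (h n C [seq [:: x] | x <- enum_fset C]) => //; last by rewrite size_map.
  have fE : flatten [seq [:: x] | x <- enum_fset C] = enum_fset C by apply: flatten_seq1.
  split; rewrite ?fE ?fset_uniq //; by move=> s /mapP [x _ ->]; exact: tree1.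
elim: N => [|N IH] D ss mD Dn fo sN.
  exists 0%N, D, ss; split=> //; first exact: reach0.
  by move: sN; rewrite leqn0 => /nilP ->.
have [al|] := boolP (all (fun s => (m < size s)%N) ss).
  exists 0%N, D, ss; split=> //; first exact: reach0.
  by move=> s /(allP al).
move=> /allPn [s sss]; rewrite -leqNgt => sm.
have [D' [ss' [t cD f l]]] := merge_step mD fo sss sm.
have [|||k [C' [ss2 [kN r c f2 a]]]] := IH D' ss' _ _ f.
- by rewrite cD.
- by rewrite cD.
- by rewrite -ltnS (leq_trans l).
exists k.+1, C', ss2; split=> //; apply: reachS r => //.
by rewrite -Dn.
Qed.

End Moves.

(** * Crawling along a path *)

Section Crawl.
Variables (R : realType) (d m : nat) (beta : R).
Hypothesis m_gt0 : (0 < m)%N.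
Hypothesis d_gt0 : (0 < d)%N.
Hypothesis beta_ge0 : 0 <= beta.
Notation L := (lattice d).
Implicit Types (A C G : {fset L}) (x y z : L) (h : nat -> L).

Definition window h s k : {fset L} := [fset h i | i in iota s k]%fset.

Lemma windowP h s k x :
  reflect (exists2 i, (s <= i < s + k)%N & x = h i) (x \in window h s k).
Proof.
apply: (iffP (imfsetP _ _ _ _)) => [[i /=]|[i ik ->]].
  by rewrite mem_iota => ik ->; exists i.
by exists i => //=; rewrite mem_iota.
Qed.

Lemma eq_window h h' s s' k : (forall i, (i < k)%N -> h (s + i)%N = h' (s' + i)%N) ->
  window h s k = window h' s' k.
Proof.
move=> e; apply/fsetP => x; apply/windowP/windowP => -[i /andP [i1 i2] ->].
  exists (s' + (i - s))%N; first by rewrite leq_addr ltn_add2l ltn_subLR.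
  by rewrite -e ?subnKC // ltn_subLR.
exists (s + (i - s'))%N; first by rewrite leq_addr ltn_add2l ltn_subLR.
by rewrite e ?subnKC // ltn_subLR.
Qed.

(* Activating the first [m] sites of the window and transporting them one by one
   in front of it slides the window by [m] along [h]. *)
Lemma window_step h a s B (Rest : {fset L}) : (m < a)%N ->
  (forall i j, (s <= i < s + a + m)%N -> (s <= j < s + a + m)%N -> h i = h j -> i = j) ->
  (forall l, (l < m)%N -> l1 (h (s + a + l)%N - h (s + a + l).-1)%R = 1%N) ->
  (forall i, (s <= i < s + a + m)%N -> h i \notin Rest) ->
  (forall i j, (s <= i < s + a + m)%N -> (s <= j < s + a + m)%N -> (l1 (h i - h j)%R <= B)%N) ->
  let C := (window h s a `|` Rest)%fset in let C' := (window h (s + m) a `|` Rest)%fset in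
  trans m beta (trp d m beta #|` C| B.+1) C C' /\ #|` C'| = #|` C|.
Proof.
move=> ma hinj hadj hR hB C C'.
(* [ix] gives the positions along [h] in the order of the draws: the [m] rearmost sites of the
   window, then the [m] sites in front of it. *)
pose ix l := if (l < m)%N then (s + l)%N else (s + a + (l - m))%N.
have ixr l : (l < 2 * m)%N -> (s <= ix l < s + a + m)%N by rewrite /ix; case: ifP; lia.
have ixI l l' : (l < 2 * m)%N -> (l' < 2 * m)%N -> ix l = ix l' -> l = l'.
  by rewrite /ix; do 2![case: ifP]; lia.
pose xs := mkseq (fun l => h (ix l)).
have xsS l : xs l.+1 = rcons (xs l) (h (ix l)) by rewrite /xs mkseqS.
have sx l : size (xs l) = l by rewrite size_mkseq.
have tE l : (l <= m)%N -> transport m C (xs (m + l)%N) = (window h (s + m) (a - m + l) `|` Rest)%fset.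
  elim: l => [|l IH] lm.
    rewrite !addn0 transport_lt ?sx //; apply/fsetP => z; rewrite in_fsetD !in_fsetU in_fset.
    apply/andP/orP => [[zx /orP [/windowP [i ir zi]|->]]|[/windowP [i ir zi]|zR]]; last 1 first.
    - split; last by rewrite zR orbT.
      apply/negP => /mapP [l]; rewrite mem_iota => lr zl.
      have lm2 : (l < 2 * m)%N by move: lr; lia.
      by have := hR _ (ixr _ lm2); rewrite -zl zR.
    - left; apply/windowP; exists i => //.
      move: zx; case: (ltnP i (s + m)) => [ism|]; last by move: ir; lia.
      case/negP; apply/mapP; exists (i - s)%N; first by rewrite mem_iota; lia.
      by rewrite zi /ix ifT; [congr h; lia|lia].
    - by right.
    - split; last by apply/orP; left; apply/windowP; exists i => //; lia.
      apply/negP => /mapP [l]; rewrite mem_iota => lr; rewrite zi => e.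
      have lm' : (l < 2 * m)%N by lia.
      have := hinj _ _ _ (ixr l lm') e.
      rewrite /ix ifT; last by lia.
      lia.
  rewrite !addnS xsS transport_rcons ?sx ?leq_addr // IH; last by lia.
  apply/fsetP => z; rewrite !inE orbA; congr (_ || _).
  apply/orP/windowP => [[/eqP ->|/windowP [i ir ->]]|[i ir ->]].
  - exists (ix (m + l)%N) => //; rewrite /ix ifF; lia.
  - by exists i => //; lia.
  - case: (ltnP i (s + a + l)) => il; first by right; apply/windowP; exists i => //; lia.
    by left; apply/eqP; congr h; rewrite /ix ifF; lia.
have gx l : (l <= 2 * m)%N -> goodseq m beta (cL d beta B.+1) C (xs l).
  elim: l => [|l IH] lm; first exact: good_nil.
  rewrite xsS; apply: good_rcons; first exact/IH/ltnW.
  apply: good_l1 => //; last first.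
    case: l lm {IH} => [|l] lm _ // y _.
    rewrite xsS last_rcons; apply: (@near_arith B _ 0%N _ _ (leqnn _) isT).
    exact: hB _ _ (ixr l (ltnW lm)) (ixr _ lm).
  rewrite /supp sx; case: (ltnP l m) => lm'.
    have xlC : h (ix l) \in (C `\` [fset y in xs l])%fset.
      rewrite !inE; apply/andP; split.
        apply/negP => /mapP [l']; rewrite mem_iota => lr e.
        have l'm : (l' < 2 * m)%N by lia.
        have := ixI _ _ lm l'm (hinj _ _ (ixr _ lm) (ixr _ l'm) e); lia.
      by apply/orP; left; apply/windowP; exists (ix l) => //; rewrite /ix lm'; lia.
    case: eqP => [l0|_] //; by move: xlC; rewrite !inE => /andP [].
  rewrite ifF; last by apply/eqP; lia.
  rewrite -(subnKC lm') tE; last by lia.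
  rewrite subnKC //; set l' := (l - m)%N.
  have ixl : ix l = (s + a + l')%N by rewrite /ix ifF //; lia.
  apply/bdP; rewrite ixl; split.
    rewrite !inE negb_or hR ?andbT; last by lia.
    apply/windowP => -[i ir /hinj]; rewrite /l'; lia.
  exists (h (s + a + l').-1); last by apply: hadj; lia.
  by rewrite !inE; apply/orP; left; apply/windowP; exists (s + a + l').-1 => //; lia.
have CE : C' = transport m C (xs (2 * m)%N).
  by rewrite mul2n -addnn tE // subnK // ltnW.
have ca : (a <= #|` C|)%N.
  apply: leq_trans (fsubset_leq_card (fsubsetUl _ _)).
  rewrite card_in_imfset /=; last first.
    by move=> i j; rewrite /= !mem_iota => ir jr /hinj; apply; lia.
  by rewrite undup_id ?iota_uniq // size_iota.
have mC : (m < #|` C|)%N by exact: leq_trans ca.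
rewrite CE; split; first by apply: goodseq_trans; rewrite ?sx //; exact: gx.
by have [] := legal_full m_gt0 (goodseq_legal (gx _ (leqnn _))) mC (sx _).
Qed.

End Crawl.

Lemma ex_seq_max (T : eqType) (s : seq T) (f : T -> int) x : x \in s ->
  exists2 y, y \in s & forall z, z \in s -> f z <= f y.
Proof.
elim: s x => [//|a s IH] x _; case: s IH => [|b s] IH.
  by exists a; rewrite ?mem_head // => z; rewrite inE => /eqP ->.
have [y ys ymax] := IH b (mem_head _ _).
have [fya|/ltW fay] := leP (f y) (f a).
  exists a; first exact: mem_head.
  by move=> z; rewrite inE => /orP [/eqP -> //|/ymax /le_trans]; apply.
exists y; first by rewrite inE ys orbT.
by move=> z; rewrite inE => /orP [/eqP -> //|/ymax].
Qed.

Section Lines.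
Variables (R : realType) (d m : nat) (beta : R).
Hypothesis m_gt0 : (0 < m)%N.
Hypothesis d_gt0 : (0 < d)%N.
Hypothesis beta_ge0 : 0 <= beta.
Notation L := (lattice d).
Implicit Types (A C G : {fset L}) (x y z : L) (h : nat -> L).

Lemma reach_weaken p q k C C' : 0 <= q -> q <= p ->
  reach m beta p k C C' -> reach m beta q k C C'.
Proof.
move=> q0 qp; elim=> [D|l D D1 D2 t c _ IH]; first exact: reach0.
apply: reachS IH => // psi psi0; apply: le_trans (t psi psi0).
exact: ler_wpM2r.
Qed.

Lemma reach_cat p k l A B C :
  reach m beta p k A B -> reach m beta p l B C -> reach m beta p (k + l) A C.
Proof. by elim=> [//|j D D1 D2 t c _ IH] /IH h; apply: reachS t c h. Qed.

Lemma reach_card p k A B : reach m beta p k A B -> #|` B| = #|` A|.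
Proof. by elim=> [//|j D D1 D2 t c _ ->]. Qed.

Lemma window_reach h a s B (Rest : {fset L}) t n : (m < a)%N ->
  (forall i j, (s <= i < s + a + m * t)%N -> (s <= j < s + a + m * t)%N -> h i = h j -> i = j) ->
  (forall i, (s + a <= i < s + a + m * t)%N -> l1 (h i - h i.-1)%R = 1%N) ->
  (forall i, (s <= i < s + a + m * t)%N -> h i \notin Rest) ->
  (forall i j, (s <= i < s + a + m * t)%N -> (s <= j < s + a + m * t)%N -> (l1 (h i - h j)%R <= B)%N) ->
  #|` window h s a `|` Rest|%fset = n ->
  reach m beta (trp d m beta n B.+1) t (window h s a `|` Rest)%fset
    (window h (s + m * t) a `|` Rest)%fset.
Proof using m_gt0 d_gt0 beta_ge0.
move=> ma; elim: t s => [|t IH] s hinj hadj hR hB Cn.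
  by rewrite muln0 addn0; apply: reach0.
have [||||tr cd] := @window_step R d m beta m_gt0 d_gt0 beta_ge0 h a s B Rest ma.
- by move=> i j ir jr; apply: hinj; rewrite mulnS; lia.
- by move=> l lm; apply: hadj; rewrite mulnS; lia.
- by move=> i ir; apply: hR; rewrite mulnS; lia.
- by move=> i j ir jr; apply: hB; rewrite mulnS; lia.
rewrite Cn in tr cd.
apply: reachS tr _ _; first by rewrite cd Cn.
rewrite mulnS addnA; apply: IH => //.
- by move=> i j ir jr; apply: hinj; rewrite mulnS; lia.
- by move=> l lm; apply: hadj; rewrite mulnS; lia.
- by move=> i ir; apply: hR; rewrite mulnS; lia.
- by move=> i j ir jr; apply: hB; rewrite mulnS; lia.
Qed.

Definition e0 : 'I_d := Ordinal d_gt0.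

Definition line a x : {fset L} := window (fun i => x + unitv e0 *+ i) 0 a.

(** The path [h] lists [G] in any order with [y] last, then follows the ray from [y] in direction
    [e0]. Only new sites have to be adjacent to their predecessors, so [G] need not be connected.
    Maximality of [y] keeps the ray off [G], and [t >= #|G|] steps bring the whole window onto
    it. *)
Lemma crawl (G Rest : {fset L}) y D t :
  (m < #|` G|)%N -> y \in G -> (forall x, x \in G -> x ord0 e0 <= y ord0 e0) ->
  {in G &, forall x z, (l1 (x - z)%R <= D)%N} ->
  (forall x, x \in G -> x \notin Rest) ->
  (forall j, (0 < j <= m * t)%N -> y + unitv e0 *+ j \notin Rest) ->
  (#|` G| <= t)%N ->
  reach m beta (trp d m beta #|` G `|` Rest|%fset (D + 2 * (m * t)).+1) t (G `|` Rest)%fset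
    (line #|` G| (y + unitv e0 *+ (m * t - #|` G|.-1)) `|` Rest)%fset.
Proof.
set a := #|` G| => ma yG ymax GD GR yR at_.
pose gs := enum_fset (G `\ y)%fset.
have sg : size gs = a.-1 by rewrite /a (cardfsD1 y) yG.
have gsG x : (x \in gs) = (x != y) && (x \in G) by rewrite in_fsetD1.
pose h i := if (i < a.-1)%N then nth 0 gs i else y + unitv e0 *+ (i - a.-1).
have a0 : (0 < a)%N by apply: leq_trans ma.
have hs i : (i < a.-1)%N -> h i \in G /\ h i != y.
  move=> ia; rewrite /h ia; have : nth 0 gs i \in gs by rewrite mem_nth ?sg.
  by rewrite gsG => /andP [-> ->].
have hE i : (a.-1 <= i)%N -> h i = y + unitv e0 *+ (i - a.-1).
  by move=> ai; rewrite /h ltnNge ai.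
have coord k : (y + unitv e0 *+ k) ord0 e0 = y ord0 e0 + k%:Z.
  by rewrite mxE mulmxnE unitvE eqxx mulr1n natz.
have hne i j : (i < a.-1)%N -> (a.-1 <= j)%N -> h i <> h j.
  move=> ia aj; have [iG iy] := hs _ ia; rewrite (hE j aj) => e.
  have := ymax _ iG; rewrite e coord => h0.
  have j0 : (j - a.-1)%N = 0%N by move: h0; lia.
  by move: iy; rewrite e j0 mulr0n addr0 eqxx.
have GE : window h 0 a = G.
  apply/fsetP => x; apply/windowP/idP => [[i /= ia ->]|xG].
    case: (ltnP i a.-1) => [/hs []//|ai].
    have -> : i = a.-1 by lia.
    by rewrite hE // subnn mulr0n addr0.
  case: (eqVneq x y) => [->|xy].
    by exists a.-1; [lia|rewrite hE // subnn mulr0n addr0].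
  have xgs : x \in gs by rewrite gsG xy.
  have ix : (index x gs < a.-1)%N by rewrite -sg index_mem.
  by exists (index x gs); [lia|rewrite /h ix nth_index].
have GL : window h (m * t) a = line a (y + unitv e0 *+ (m * t - a.-1)).
  apply: eq_window => i ia; have mt : (a <= m * t)%N by apply: leq_trans (leq_pmull _ m_gt0).
  rewrite hE; last by lia.
  by rewrite add0n -addrA -mulrnDr; congr (_ + _ *+ _); lia.
rewrite -GL; have := @window_reach h a 0 (D + 2 * (m * t)) Rest t #|` G `|` Rest|%fset.
rewrite GE !add0n; apply => //.
- move=> i j /= ir jr; case: (ltnP i a.-1) => ia; case: (ltnP j a.-1) => ja.
  + rewrite /h ia ja => /eqP; rewrite nth_uniq ?sg // ?fset_uniq //.
    by move=> /eqP.
  + by move=> e; case: (hne _ _ ia ja e).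
  + by move=> e; case: (hne _ _ ja ia (esym e)).
  + rewrite !hE // => /addrI /(congr1 (@l1 d)); rewrite !l1_unitv; lia.
- move=> i /andP [ai _]; rewrite !hE; try lia.
  have -> : (i - a.-1 = (i.-1 - a.-1).+1)%N by lia.
  by rewrite mulrS addrCA addrK; exact: (l1_unitv e0 1).
- move=> i /= ir; case: (ltnP i a.-1) => ia; first by have [/GR] := hs _ ia.
  rewrite hE //; case: (posnP (i - a.-1)) => [->|i0]; first by rewrite mulr0n addr0 GR.
  by apply: yR; lia.
- have far k : (l1 ((y + unitv e0 *+ k) - y)%R <= k)%N.
    by rewrite addrC addKr l1_unitv.
  have near i : (i < a + m * t)%N -> (a.-1 <= i)%N -> (l1 (h i - y)%R <= m * t)%N.
    by move=> ir ai; rewrite hE //; apply: leq_trans (far _) _; lia.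
  move=> i j /= ir jr; case: (ltnP i a.-1) => ia; case: (ltnP j a.-1) => ja.
  + have [iG _] := hs _ ia; have [jG _] := hs _ ja.
    by apply: leq_trans (GD _ _ iG jG) _; lia.
  + have [iG _] := hs _ ia; have := GD _ _ iG yG; have := near _ jr ja.
    have := l1_tri y (h i) (h j); rewrite [l1 (y - h j)]l1_sym.
    move: (l1 _) (l1 _) (l1 _) => u v w; lia.
  + have [jG _] := hs _ ja; have := GD _ _ yG jG; have := near _ ir ia.
    have := l1_tri y (h i) (h j).
    move: (l1 _) (l1 _) (l1 _) => u v w; lia.
  + have := near _ jr ja; have := near _ ir ia.
    have := l1_tri y (h i) (h j); rewrite [l1 (y - h j)]l1_sym.
    move: (l1 _) (l1 _) (l1 _) => u v w; lia.
Qed.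

Lemma line_in a x y : y \in line a x -> exists2 i, (i < a)%N & y = x + unitv e0 *+ i.
Proof. by move=> /windowP [i /= ia ->]; exists i. Qed.

(** Merging leaves trees of more than [m] sites, and two of them would need [2 * m + 2 > a] sites.
    The single tree has diameter at most [a] and crawls onto a ray. *)
Lemma reach_line a : (m < a <= 2 * m + 1)%N ->
  exists2 p : R, 0 < p <= 1 & forall C, #|` C| = a ->
    exists k x, (k <= 2 * a)%N /\ reach m beta p k C (line a x).
Proof using m_gt0 d_gt0 beta_ge0.
move=> /andP [ma am]; have a0 : (0 < a)%N by apply: leq_trans ma.
have [p1 [p1_gt0 p1_le1 p1E]] : exists p, [/\ 0 < p, p <= 1 & p = trp d m beta a a.+1].
  exists (trp d m beta a a.+1); split.
  - exact: (trp_gt0 m beta d_gt0 a0 (ltn0Sn _)).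
  - exact: (trp_le1 m d_gt0 beta_ge0 a0 (ltn0Sn _)).
  - reflexivity.
have [p2 [p2_gt0 p2E]] : exists p, 0 < p /\ p = trp d m beta a (a + 2 * (m * a)).+1.
  exists (trp d m beta a (a + 2 * (m * a)).+1); split; last reflexivity.
  exact: (trp_gt0 m beta d_gt0 a0 (ltn0Sn _)).
have p_gt0 : 0 < Num.min p1 p2 by rewrite lt_min p1_gt0.
exists (Num.min p1 p2); first by rewrite p_gt0 ge_min p1_le1.
move=> C Ca; have mC : (m < #|` C|)%N by rewrite Ca.
have [k [C' [ss [kn r c f big]]]] := merge m_gt0 d_gt0 beta_ge0 mC.
have [s [fs sC]] : exists s, forest C' [:: s] /\ s =i C'.
  case: ss f big => [|s ss] f big.
    have : C' = fset0 by apply/fsetP => z; case: f => _ _ <-; rewrite inE.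
    by move=> e; move: c; rewrite e cardfs0 Ca => e0; move: a0; rewrite -e0.
  case: ss f big => [|s2 ss] f big.
    by exists s; split=> //; case: f => _ _ h z; rewrite -h /= cats0.
  have : (size (flatten (s :: s2 :: ss)) <= a)%N.
    case: f => _ uf ef; rewrite -Ca -c; apply: uniq_leq_size => // z.
    by rewrite ef.
  have := big s (mem_head _ _); have := big s2; rewrite !inE eqxx orbT => /(_ isT).
  by rewrite /= !size_cat; lia.
have ts : tree s by case: fs => ts _ _; apply: ts; rewrite mem_head.
have sa : size s = a.
  case: fs => _; rewrite /= cats0 => us _; rewrite -Ca -c.
  exact: perm_size (uniq_perm us (fset_uniq C') sC).
have [z zs] : exists z, z \in s by case: (s) sa a0 => [<- //|z s' _ _]; exists z; exact: mem_head.
have [y ys ymax] := ex_seq_max (fun x : L => x ord0 e0) zs.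
rewrite Ca -p1E in r.
have r2 : reach m beta p2 a C' (line a (y + unitv e0 *+ (m * a - a.-1))).
  rewrite p2E.
  have := @crawl C' fset0 y a a; rewrite !fsetU0 c Ca; apply => //.
  - by rewrite -sC.
  - by move=> x; rewrite -sC; exact: ymax.
  - by move=> x w; rewrite -!sC -sa; exact: tree_l1.
exists (k + a)%N, (y + unitv e0 *+ (m * a - a.-1)).
split; first by move: kn; rewrite Ca; lia.
apply: reach_cat; [apply: reach_weaken (ltW p_gt0) _ r|apply: reach_weaken (ltW p_gt0) _ r2].
  by rewrite ge_min lexx.
by rewrite ge_min lexx orbT.
Qed.

End Lines.

(** * Comparison of a cluster with and without the others *)

Section Compare.
Variables (R : realType) (d m : nat) (beta : R).
Hypothesis m_gt0 : (0 < m)%N.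
Hypothesis d_gt0 : (0 < d)%N.
Hypothesis beta_ge0 : 0 <= beta.
Notation L := (lattice d).
Implicit Types (A C : {fset L}) (x y z : L) (xs zs : seq L).

Lemma legal_take C xs l : legal m C xs -> legal m C (take l xs).
Proof.
elim=> [|ys x ly IH xs0] //=; first exact: legal_nil.
case: (leqP l (size ys)) => ls; first by rewrite -cats1 takel_cat.
by rewrite take_oversize ?size_rcons //; apply: legal_rcons.
Qed.

Section Fixed.
Variables (A C : {fset L}) (r D : nat).
Hypothesis AC : (A `<=` C)%fset.
Hypothesis mA : (m < #|` A|)%N.
Hypothesis rm : (m.+1 < r)%N.
Hypothesis sepA : forall x y, x \in A -> y \in C -> y \notin A -> (r <= l1 (x - y)%R)%N.
Hypothesis diamA : {in A &, forall x y, (l1 (x - y)%R <= D)%N}.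

Lemma near_transport xs : legal m A xs -> (m <= size xs <= 2 * m)%N ->
  forall z, z \in transport m A xs -> exists2 y, y \in A & (l1 (z - y)%R <= m)%N.
Proof using m_gt0 mA.
move=> lx /andP [mx xm] z zT; have [_ h] := legal_transport m_gt0 lx (ltnW mA) mx.
have [y yA zy] := h z zT; exists y => //; apply: leq_trans zy _.
by rewrite leq_subLR addnn -mul2n.
Qed.

Lemma transport_sub xs : legal m A xs -> transport m C xs = (transport m A xs `|` (C `\` A))%fset.
Proof using AC.
move=> lx; have lp : {subset take m xs <= A}.
  by have [|] := legal_prefix (legal_take m lx); first by rewrite size_take_min geq_minl.
apply/fsetP => z; rewrite !inE.
case: (boolP (z \in A)) => zA.
  by rewrite (fsubsetP AC _ zA) /= orbF.
case zt : (z \in take m xs); first by move: (lp _ zt); rewrite (negPf zA).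
by case: (z \in C); rewrite /= ?orbT ?orbF //; case: (_ \in _).
Qed.

Lemma last_near xs : legal m A xs -> xs <> [::] -> (size xs <= 2 * m)%N ->
  exists2 a, a \in A & (l1 (last 0%R xs - a)%R <= m)%N.
Proof using m_gt0 mA.
move=> lx x0 sx; case: (leqP (size xs) m) => sm.
  have [_ xA] := legal_prefix lx sm; exists (last 0 xs); last by rewrite subrr l10.
  by move: x0 xA; case: (xs) => // x s _; apply; rewrite /= mem_last.
apply: (near_transport lx); first by rewrite ltnW.
case/lastP: xs x0 lx sx sm => [//|xs x] _ _ _; rewrite size_rcons ltnS => sm.
by rewrite transport_rcons // last_rcons fset1U1.
Qed.

(** Since [m.+1 < r], the other clusters are too far away to occupy a boundary site of this one. *)
Lemma supp_sub xs : legal m A xs -> xs <> [::] -> (size xs <= 2 * m)%N ->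
  (supp m A xs `<=` supp m C xs)%fset.
Proof using AC m_gt0 mA rm sepA.
move=> lx x0 sx; apply/fsubsetP => x; rewrite /supp.
have -> : (size xs == 0)%N = false by case: xs x0 {lx sx}.
case: (leqP m (size xs)) => mx; last first.
  by rewrite !inE => /andP [-> /(fsubsetP AC)].
move=> /bdP [xT [y yT xy]]; apply/bdP; rewrite transport_sub // in_fsetU negb_or xT /=.
split; last by exists y => //; rewrite in_fsetU yT.
rewrite in_fsetD; apply/negP => /andP [xA xC].
have [|a aA ya] := near_transport lx _ yT; first by rewrite mx.
have := sepA aA xC xA; apply/negP; rewrite -ltnNge; apply: leq_ltn_trans (l1_tri y _ _) _.
rewrite l1_sym [l1 (y - x)]l1_sym xy addn1; exact: leq_ltn_trans rm.
Qed.

Lemma supp_extra xs x : legal m A xs -> xs <> [::] -> (size xs <= 2 * m)%N ->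
  x \in supp m C xs -> x \notin supp m A xs -> (r <= l1 (last 0%R xs - x)%R + m.+1)%N.
Proof using AC m_gt0 mA sepA.
move=> lx x0 sx; have [a aA la] := last_near lx x0 sx; rewrite /supp.
have -> : (size xs == 0)%N = false by case: xs x0 {lx sx la}.
have h y : y \in C -> y \notin A -> (r <= m + l1 (last 0%R xs - y)%R)%N.
  move=> yC yA; apply: leq_trans (sepA aA yC yA) _.
  by apply: leq_trans (l1_tri (last 0 xs) _ _) _; rewrite leq_add2r l1_sym.
case: (leqP m (size xs)) => mx; last first.
  rewrite !inE => /andP [xxs xC]; rewrite xxs /= => xA.
  by apply: leq_trans (h _ xC xA) _; rewrite addnC leq_add2l.
move=> /bdP []; rewrite transport_sub // in_fsetU negb_or => /andP [xT _] [y yT xy] xb.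
have : y \notin transport m A xs.
  by apply: contra xb => yT'; apply/bdP; split=> //; exists y.
move: yT; rewrite in_fsetU => /orP [-> //|]; rewrite in_fsetD => /andP [yA yC] _.
apply: leq_trans (h _ yC yA) _; rewrite addnC addnS -addSn leq_add2r.
by apply: leq_trans (l1_tri x _ _) _; rewrite xy addn1.
Qed.

Lemma supp_near xs x : legal m A xs -> xs <> [::] -> (size xs <= 2 * m)%N ->
  x \in supp m A xs -> (l1 (last 0%R xs - x)%R <= D + (2 * m).+1)%N.
Proof using m_gt0 mA diamA.
move=> lx x0 sx xs0; have [a aA la] := last_near lx x0 sx.
have [b bA xb] : exists2 b, b \in A & (l1 (b - x)%R <= m.+1)%N.
  move: xs0; rewrite /supp; case: eqP => [e|_]; first by case: x0; exact: size0nil.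
  case: (leqP m (size xs)) => mx; last first.
    by rewrite !inE => /andP [_ xA]; exists x => //; rewrite subrr l10.
  move=> /bdP [_ [y yT xy]]; have [|b bA yb] := near_transport lx _ yT; first by rewrite mx.
  exists b => //; apply: leq_trans (l1_tri y _ _) _.
  by rewrite [l1 (y - x)]l1_sym xy addn1 ltnS l1_sym.
have -> : (D + (2 * m).+1 = m + (D + m.+1))%N by rewrite [RHS]addnCA mul2n -addnn !addnS.
apply: leq_trans (l1_tri a _ _) _; apply: leq_add la _.
exact: leq_trans (l1_tri b _ _) (leq_add (diamA aA bA) xb).
Qed.

(** Weight of a foreign site, at distance at least [r - m.+1], relative to that of an own candidate,
    at distance at most [D + (2 * m).+1]. The numerical factors turn these distances into [1 + r]
    and [1 + D]. *)
Definition eps_ratio : R :=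
  ((d.+1 * m.+3 * (2 * m + 2))%:R * (1 + D%:R) / (1 + r%:R)) `^ beta.

Lemma eps_ratio_ge0 : 0 <= eps_ratio.
Proof. exact: powR_ge0. Qed.

Lemma pr_extra xs x : legal m A xs -> xs <> [::] -> (size xs <= 2 * m)%N ->
  x \in supp m C xs -> x \notin supp m A xs -> pr m beta C xs x <= eps_ratio.
Proof using AC m_gt0 mA rm sepA diamA beta_ge0 d_gt0.
move=> lx x0 sx xC xA.
have [w wA] := supp_neq0 d_gt0 xs mA.
have wC := fsubsetP (supp_sub lx x0 sx) _ wA.
have w_near := supp_near lx x0 sx wA; have x_far := supp_extra lx x0 sx xC xA.
have wtE y : wt beta xs y = phi beta (last 0 xs) y.
  by rewrite /wt; case: eqP => // e; case: x0; exact: size0nil.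
have W0 : 0 < wt beta xs w by apply: wt_gt0.
rewrite /pr; apply: le_trans (_ : wt beta xs x / wt beta xs w <= _).
  rewrite ler_wpM2l ?(ltW (wt_gt0 _ _ _)) // lef_pV2 ?posrE //; last exact: sum_wt_gt0 wC.
  rewrite (big_fsetD1 w wC) lerDl; apply: sumr_ge0 => y _; exact/ltW/wt_gt0.
rewrite ler_pdivrMr // !wtE.
apply: le_trans (phi_le beta_ge0 _ _) _.
apply: le_trans (ler_wpM2l eps_ratio_ge0 (phi_ge beta_ge0 _ _)).
move: w_near x_far; move: (l1 _) (l1 _) => l_x lw w_near x_far.
rewrite -!powR_inv_base // -!powRM ?invr_ge0 // ?mulr_ge0 ?invr_ge0 ?addr_ge0 //.
apply: ge0_ler_powR; rewrite ?nnegrE ?mulr_ge0 ?invr_ge0 ?addr_ge0 //.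
rewrite -[1]/(1%:R) -!natrD -natrM.
rewrite -mulrA -invfM -natrM ler_pdivrMr ?ltr0n // mulrAC ler_pdivlMr ?ltr0n ?muln_gt0 //.
rewrite -!natrM ler_nat.
have h1 : (1 + r <= m.+3 * (1 + l_x))%N by nia.
have h2 : (1 + lw <= (2 * m + 2) * (1 + D))%N by nia.
have := leq_mul h1 h2; have := leqnn d.+1 => hd /(leq_mul hd).
by congr (_ <= _)%N; lia.
Qed.

Lemma pr_sub xs x : legal m A xs -> xs <> [::] -> (size xs <= 2 * m)%N ->
  x \in supp m A xs -> pr m beta C xs x <= pr m beta A xs x.
Proof using AC m_gt0 mA rm sepA.
move=> lx x0 sx xA; have sub := supp_sub lx x0 sx.
have sA := sum_wt_gt0 beta xA; have sC := sum_wt_gt0 beta (fsubsetP sub _ xA).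
rewrite /pr ler_wpM2l ?(ltW (wt_gt0 _ _ _)) // lef_pV2 ?posrE //.
rewrite [leRHS](big_fsetID _ (mem (supp m A xs))) /=.
have -> : [fset x0 in supp m C xs | x0 \in supp m A xs]%fset = supp m A xs.
  by apply/fsetP => z; rewrite !inE /= andbC; case: (boolP (z \in _)) => // /(fsubsetP sub).
by rewrite lerDl; apply: sumr_ge0 => y _; rewrite ltW // wt_gt0.
Qed.

Lemma legal_sub xs : legal m A xs -> (size xs <= 2 * m)%N -> legal m C xs.
Proof using AC m_gt0 mA rm sepA.
elim=> [|ys x ly IH xs0] sx; first exact: legal_nil.
have sy : (size ys <= 2 * m)%N by move: sx; rewrite size_rcons => /ltnW.
apply: legal_rcons; first exact: IH.
case: (eqVneq ys [::]) => [e|/eqP y0]; last exact: (fsubsetP (supp_sub ly y0 sy)).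
by move: xs0; rewrite e /supp /=; exact: (fsubsetP AC).
Qed.

Definition eps : R := (4 * d * #|` C|)%:R * eps_ratio.

Lemma eps_ge0 : 0 <= eps.
Proof. by rewrite mulr_ge0 ?eps_ratio_ge0. Qed.

(* Run inside [C], a path started in the cluster [A] leaves [A] with probability of
   order [r ^ - beta] per draw, and has otherwise at most its weight in [A] alone. *)
Lemma Eseq_compare k xs (f g : seq L -> R) : legal m A xs -> xs <> [::] ->
  (size xs + k <= 2 * m)%N -> (forall zs, 0 <= f zs <= 1) -> (forall zs, 0 <= g zs) ->
  (forall zs, legal m A zs -> size zs = (size xs + k)%N -> f zs <= g zs) ->
  Eseq m beta k C xs f <= Eseq m beta k A xs g + k%:R * eps.
Proof.
move=> lx x0 sx f1 g0; elim: k xs lx x0 sx => [|k IH] xs lx x0 sx fg.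
  by rewrite mul0r addr0; apply: fg; rewrite ?addn0.
have sx' : (size xs <= 2 * m)%N by apply: leq_trans sx; rewrite leq_addr.
have sub := supp_sub lx x0 sx'.
have mC : (m < #|` C|)%N by apply: leq_trans (fsubset_leq_card AC).
have EC1 ys : legal m C ys -> Eseq m beta k C ys f <= 1.
  by move=> ly; rewrite -(Eseq_cst beta d_gt0 k ys 1 mC); apply: Eseq_le => // zs _ _; case/andP: (f1 zs).
have EC0 ys : legal m C ys -> 0 <= Eseq m beta k C ys f.
  by move=> ly; rewrite -(Eseq_cst beta d_gt0 k ys 0 mC); apply: Eseq_le => // zs _ _; case/andP: (f1 zs).
have EA0 ys : legal m A ys -> 0 <= Eseq m beta k A ys g.
  by move=> ly; rewrite -(Eseq_cst beta d_gt0 k ys 0 mA); apply: Eseq_le.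
have [w wA] := supp_neq0 d_gt0 xs mA.
(* Own candidates are drawn with at most their probability in [A], as the normalisation only grows;
   the foreign ones, at most [4 * d * #|C|] in number, cost [eps_ratio] each. *)
rewrite /= (big_fsetID _ (mem (supp m A xs))) /=.
have -> : [fset x0 in supp m C xs | x0 \in supp m A xs]%fset = supp m A xs.
  by apply/fsetP => z; rewrite !inE /= andbC; case: (boolP (z \in _)) => // /(fsubsetP sub).
rewrite -natr1 mulrDl mul1r addrA; apply: lerD.
  have -> : k%:R * eps = \sum_(x <- supp m A xs) pr m beta A xs x * (k%:R * eps).
    by rewrite -mulr_suml (sum_pr beta wA) mul1r.
  rewrite -big_split /= big_seq [leRHS]big_seq; apply: ler_sum => x xA.
  rewrite -mulrDr; have lrx : legal m A (rcons xs x) by apply: legal_rcons.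
  apply: le_trans (_ : pr m beta C xs x * (Eseq m beta k A (rcons xs x) g + k%:R * eps) <= _).
    rewrite ler_wpM2l ?pr_ge0 //; apply: IH => //.
    - by case: (xs).
    - by rewrite size_rcons addSnnS.
    - by move=> zs lz sz; apply: fg => //; rewrite sz size_rcons addSnnS.
  by rewrite ler_wpM2r ?pr_sub // addr_ge0 ?EA0 // mulr_ge0 ?eps_ge0.
apply: le_trans (_ : \sum_(x <- [fset x0 in supp m C xs | x0 \notin supp m A xs]%fset) eps_ratio <= _).
  rewrite big_seq [leRHS]big_seq; apply: ler_sum => x; rewrite !inE /= => /andP [xC xA].
  have lrx : legal m C (rcons xs x) by apply: legal_rcons => //; apply: legal_sub.
  by rewrite -[leRHS]mulr1; apply: ler_pM; rewrite ?pr_ge0 ?EC0 ?EC1 ?pr_extra.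
rewrite big_const_seq count_predT iter_addr_0 -mulr_natl ler_wpM2r ?eps_ratio_ge0 // ler_nat.
apply: leq_trans (card_supp d_gt0 sx' (ltnW mC)).
by apply: fsubset_leq_card; apply/fsubsetP => z; rewrite !inE => /andP [].
Qed.

End Fixed.
End Compare.

(** * Invariance of the dynamics under isometries of the lattice *)

Section Isometry.
Variables (R : realType) (d m : nat) (beta : R).
Notation L := (lattice d).
Implicit Types (A C : {fset L}) (x y z : L) (xs zs : seq L).

Definition isometry (g : L -> L) : Prop :=
  bijective g /\ forall x y, enorm R (g x - g y) = enorm R (x - y).

Variable g : L -> L.
Hypothesis giso : isometry g.

Let g_inj : injective g. Proof. by case: giso => /bij_inj. Qed.

Lemma mem_iso A x : (g x \in (g @` A)%fset) = (x \in A).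
Proof. by rewrite mem_imfset. Qed.

Lemma fset_iso_eq A B : (forall x, (g x \in B) = (x \in A)) -> B = (g @` A)%fset.
Proof.
move=> h; have [[g' gK g'K] _] := giso; apply/fsetP => z.
by rewrite -(g'K z) h mem_iso.
Qed.

Lemma bd_iso A : bd (g @` A)%fset = (g @` bd A)%fset.
Proof.
apply: fset_iso_eq => x; have [_ gd] := giso.
have l1g u v : l1 (g u - g v) = 1%N <-> l1 (u - v) = 1%N.
  by rewrite -!(enorm_eq1 R) gd.
apply/bdP/bdP; rewrite mem_iso => -[xA [y yA xy]]; split=> //.
  by move: yA xy => /imfsetP [w /= wA ->] /l1g xy; exists w.
by exists (g y); rewrite ?mem_iso //; apply/l1g.
Qed.

Lemma transport_iso C xs : transport m (g @` C)%fset (map g xs) = (g @` transport m C xs)%fset.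
Proof.
apply: fset_iso_eq => x; rewrite /transport !inE mem_iso -map_take -map_drop.
by rewrite !(mem_map g_inj).
Qed.

Lemma supp_iso C xs : supp m (g @` C)%fset (map g xs) = (g @` supp m C xs)%fset.
Proof.
rewrite /supp size_map; case: eqP => // _; case: ifP => _.
  by apply: fset_iso_eq => x; rewrite !inE mem_iso (mem_map g_inj).
by rewrite transport_iso bd_iso.
Qed.

Lemma wt_iso xs x : wt beta (map g xs) (g x) = wt beta xs x.
Proof.
rewrite /wt size_map; case: xs => [|y xs] /=; first reflexivity.
by rewrite last_map /phi (proj2 giso).
Qed.

Lemma pr_iso C xs x : pr m beta (g @` C)%fset (map g xs) (g x) = pr m beta C xs x.
Proof.
rewrite /pr wt_iso supp_iso big_imfset /=; last by move=> ? ? _ _; exact: g_inj.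
rewrite (eq_bigr _ (fun y _ => wt_iso xs y)); reflexivity.
Qed.

Lemma Eseq_iso k C xs f :
  Eseq m beta k (g @` C)%fset (map g xs) f = Eseq m beta k C xs (f \o map g).
Proof.
elim: k xs => [//|k IH] xs /=.
rewrite supp_iso big_imfset /=; last by move=> ? ? _ _; exact: g_inj.
by apply: eq_bigr => x _; rewrite pr_iso -map_rcons IH.
Qed.

Lemma Estep_iso C psi : Estep m beta (g @` C)%fset psi = Estep m beta C (fun B => psi (g @` B)%fset).
Proof.
rewrite /Estep -[X in Eseq _ _ _ _ X]/(map g [::]) Eseq_iso.
by congr Eseq; apply: funext => xs; rewrite /= transport_iso.
Qed.

End Isometry.

(** * The killed chain *)

Section Kill.
Variables (R : realType) (d m : nat) (beta : R).
Notation L := (lattice d).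
Implicit Types (C D : {fset L}) (psi : {fset L} -> R).

Lemma Estep_01 psi C : (forall D, 0 <= psi D <= 1) -> 0 <= Estep m beta C psi <= 1.
Proof.
move=> h; rewrite /Estep; set f := fun xs => psi _.
have hf xs : 0 <= f xs <= 1 by exact: h.
elim: (2 * m)%N ([::] : seq L) => [|l IH] xs //=; apply/andP; split.
  by apply: sumr_ge0 => x _; rewrite mulr_ge0 ?pr_ge0 //; case/andP: (IH (rcons xs x)).
have [->|[x xs0]] := fset_0Vmem (supp m C xs); first by rewrite big_seq_fset0.
rewrite -(sum_pr beta xs0); apply: ler_sum => y _.
by rewrite ler_piMr ?pr_ge0 //; case/andP: (IH (rcons xs y)).
Qed.

Variable ok : nat -> {fset L} -> bool.

(** Probability that the chain, being in [C] at time [t], violates [ok] at one of the times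
    [t, ..., t + N]. *)
Fixpoint kill N t C : R :=
  if ok t C then (if N is N'.+1 then Estep m beta C (kill N' t.+1) else 0) else 1.

Lemma kill_01 N t C : 0 <= kill N t C <= 1.
Proof.
elim: N t C => [|N IH] t C /=; case: ifP => _; rewrite ?lexx ?ler01 //.
by apply: Estep_01 => D; exact: IH.
Qed.

Hypothesis d_gt0 : (0 < d)%N.

Lemma Estep_compl psi C : (m < #|` C|)%N -> Estep m beta C (fun D => 1 - psi D) = 1 - Estep m beta C psi.
Proof.
move=> mC; pose c (b : bool) : R := if b then 1 else -1.
pose F (b : bool) (xs : seq L) : R := if b then 1 else psi (transport m C xs).
have := Eseq_sum m beta (2 * m) C [::] [:: true; false] c F.
rewrite big_cons big_seq1 /= mul1r mulN1r Eseq_cst // => <-.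
by rewrite /Estep; congr Eseq; apply: funext => xs; rewrite big_cons big_seq1 mul1r mulN1r.
Qed.

(** One way to survive is to follow the prescribed path, of probability at least [p ^+ j], and then
    to survive from [D]. *)
Lemma reach_kill (p : R) j C D N t : (m < #|` C|)%N -> 0 <= p -> reach m beta p j C D ->
  (forall i B, (i < j)%N -> ok (t + i) B) ->
  p ^+ j * (1 - kill N (t + j) D) <= 1 - kill (N + j) t C.
Proof.
move=> mC p0 r; elim: r t mC => [B|l B B1 B2 tr cB _ IH] t mC hok.
  by rewrite expr0 mul1r !addn0 lexx.
have ok0 : ok t B by have := hok 0%N B; rewrite addn0; exact.
rewrite (addnS N l) /= ok0 -Estep_compl //.
apply: le_trans (tr _ _); last by move=> B'; rewrite subr_ge0; case/andP: (kill_01 (N + l) t.+1 B').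
rewrite exprS -mulrA ler_wpM2l // -addSnnS; apply: IH; first by rewrite cB.
by move=> i B' il; rewrite addSn -addnS; exact: hok.
Qed.

End Kill.

Lemma kill_shift (R : realType) (d m : nat) (beta : R) (ok ok' : nat -> {fset lattice d} -> bool) l N t C :
  (forall t D, ok' (l + t)%N D = ok t D) -> kill m beta ok' N (l + t) C = kill m beta ok N t C.
Proof.
move=> h; elim: N t C => [|N IH] t C /=; rewrite h; case: ifP => // _.
by congr Estep; apply: funext => D; rewrite -addnS IH.
Qed.

(** * Non-interacting clusters *)

Section Tuples.
Variables (R : realType) (d m : nat) (beta : R) (k : nat) (sz : 'I_k -> nat).
Hypothesis m_gt0 : (0 < m)%N.
Hypothesis d_gt0 : (0 < d)%N.
Hypothesis beta_ge0 : 0 <= beta.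
Hypothesis k_gt0 : (0 < k)%N.
Hypothesis sz_ge : forall i, (m < sz i)%N.
Notation L := (lattice d).
Notation cfg := ('I_k -> {fset L}).
Implicit Types (A : cfg) (B C : {fset L}) (x y z : L) (i j : 'I_k).

Definition total : nat := (\sum_i sz i)%N.

Definition upd A i B : cfg := fun j => if j == i then B else A j.

Definition wf A : Prop := forall i, #|` A i| = sz i.

Definition sep (r : nat) A : Prop :=
  forall i j, i != j -> forall x y, x \in A i -> y \in A j -> (r <= l1 (x - y)%R)%N.

Definition diamle (D : nat) A : Prop :=
  forall i, {in A i &, forall x y, (l1 (x - y)%R <= D)%N}.

Definition union A : {fset L} := (\bigcup_(i <- index_enum 'I_k) A i)%fset.

(* The sites occupied after [t] steps started from [A] satisfy this. *)
Definition near (t : nat) A A' : Prop :=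
  forall i z, z \in A' i -> exists2 y, y \in A i & (l1 (z - y)%R <= m * t)%N.

(* The chain in which the clusters do not interact: one of them is chosen with
   probability proportional to its size and performs a CAT step alone. *)
Definition Q (phi : cfg -> R) A : R :=
  \sum_i (sz i)%:R / total%:R * Estep m beta (A i) (fun B => phi (upd A i B)).

Lemma total_gt0 : (0 < total)%N.
Proof using k_gt0 sz_ge.
rewrite /total (bigD1 (Ordinal k_gt0)) //= addn_gt0.
by rewrite (leq_ltn_trans _ (sz_ge _)).
Qed.

Lemma upd_same A i B : upd A i B i = B.
Proof. by rewrite /upd eqxx. Qed.

Lemma upd_other A i j B : j != i -> upd A i B j = A j.
Proof. by rewrite /upd => /negPf ->. Qed.

Lemma wf_upd A i B : wf A -> #|` B| = sz i -> wf (upd A i B).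
Proof. by move=> wA Bi j; rewrite /upd; case: eqP => [->|]. Qed.

Lemma unionP A x : reflect (exists i, x \in A i) (x \in union A).
Proof.
apply: (iffP (bigfcupP _ _ _ _)) => [[i _ xi]|[i xi]]; first by exists i.
by exists i => //; rewrite mem_index_enum.
Qed.

Lemma near_refl A : near 0 A A.
Proof. by move=> i z zA; exists z => //; rewrite subrr l10. Qed.

Lemma near_trans s t A A' A'' : near s A A' -> near t A' A'' -> near (s + t) A A''.
Proof.
move=> h1 h2 i z /h2 [y /h1 [x xA yx] zy]; exists x => //.
by apply: leq_trans (l1_tri y _ _) _; rewrite mulnDr addnC leq_add.
Qed.

Lemma near_upd A i B : (forall z, z \in B -> exists2 y, y \in A i & (l1 (z - y)%R <= m)%N) ->
  near 1 A (upd A i B).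
Proof.
move=> h j z; rewrite muln1 /upd; case: eqP => [->|_ zA]; first exact: h.
by exists z => //; rewrite subrr l10.
Qed.

Lemma near_sep t r A A' : near t A A' -> sep (r + 2 * (m * t)) A -> sep r A'.
Proof.
move=> nA sA i j ij x y /nA [x' xA' xx'] /nA [y' yA' yy'].
have := sA i j ij _ _ xA' yA'; have := l1_tri x x' y'; have := l1_tri y x y'.
rewrite l1_sym in xx'.
move: xx' yy'; move: (l1 _) (l1 _) (l1 _) (l1 _) (l1 _) => a b c e f; move: (m * t)%N => mt.
lia.
Qed.

Lemma near_diam t D A A' : near t A A' -> diamle D A -> diamle (D + 2 * (m * t)) A'.
Proof.
move=> nA dA i x y /nA [x' xA' xx'] /nA [y' yA' yy'].
have := dA i _ _ xA' yA'; have := l1_tri x' x y; have := l1_tri y' x' y.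
rewrite l1_sym in yy'.
move: xx' yy'; move: (l1 _) (l1 _) (l1 _) (l1 _) (l1 _) => a b c e f; move: (m * t)%N => mt.
lia.
Qed.

Lemma Q_le phi phi' A : wf A ->
  (forall A', wf A' -> near 1 A A' -> phi A' <= phi' A') -> Q phi A <= Q phi' A.
Proof using m_gt0 sz_ge.
move=> wA h; apply: ler_sum => i _; apply: ler_wpM2l; first by rewrite divr_ge0.
apply: Eseq_le; first exact: legal_nil.
move=> zs lz sz_zs; have mA : (m < #|` A i|)%N by rewrite wA.
have [cT nT] := legal_full m_gt0 lz mA sz_zs.
by apply: h; [apply: wf_upd => //; rewrite cT|exact: near_upd].
Qed.

Lemma eq_Q phi phi' A : wf A ->
  (forall A', wf A' -> near 1 A A' -> phi A' = phi' A') -> Q phi A = Q phi' A.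
Proof using m_gt0 sz_ge.
by move=> wA h; apply/eqP; rewrite eq_le !Q_le // => A' w n; rewrite h.
Qed.

Lemma Q_sum (I : Type) (s : seq I) (c : I -> R) (F : I -> cfg -> R) A :
  Q (fun A => \sum_(l <- s) c l * F l A) A = \sum_(l <- s) c l * Q (F l) A.
Proof.
rewrite /Q; under [RHS]eq_bigr do rewrite mulr_sumr.
rewrite exchange_big /=; apply: eq_bigr => i _; rewrite /Estep Eseq_sum mulr_sumr.
by apply: eq_bigr => l _; rewrite mulrCA.
Qed.

Lemma QZ (c : R) F A : Q (fun A => c * F A) A = c * Q F A.
Proof.
have := Q_sum [:: tt] (fun=> c) (fun=> F) A; rewrite big_seq1 => <-.
by congr Q; apply: funext => A'; rewrite big_seq1.
Qed.

Lemma QD F G A : Q (fun A => F A + G A) A = Q F A + Q G A.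
Proof.
have := Q_sum [:: true; false] (fun=> 1) (fun b : bool => if b then F else G) A.
rewrite big_cons big_seq1 !mul1r => <-.
by congr Q; apply: funext => A'; rewrite big_cons big_seq1 !mul1r.
Qed.

Lemma Q_cst (c : R) A : wf A -> Q (fun=> c) A = c.
Proof using d_gt0 k_gt0 sz_ge.
move=> wA; rewrite /Q; under eq_bigr => i _.
  by rewrite /Estep Eseq_cst ?wA //; over.
rewrite -mulr_suml -mulr_suml -natr_sum mulfV ?mul1r // pnatr_eq0 -lt0n.
exact: total_gt0.
Qed.

Lemma Q_ge0 phi A : wf A -> (forall A', wf A' -> near 1 A A' -> 0 <= phi A') -> 0 <= Q phi A.
Proof using m_gt0 d_gt0 k_gt0 sz_ge. by move=> wA h; rewrite -(Q_cst 0 wA); apply: Q_le. Qed.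

Lemma Q_cvg (F : nat -> cfg -> R) f A : wf A ->
  (forall A', wf A' -> F n A' @[n --> \oo] --> f A') -> Q (F n) A @[n --> \oo] --> Q f A.
Proof using m_gt0 sz_ge.
move=> wA h; apply: cvg_sum_seq => i _; apply: cvgM; first exact: cvg_cst.
apply: Eseq_cvg; last exact: legal_nil.
move=> zs lz sz_zs; have mA : (m < #|` A i|)%N by rewrite wA.
have [cT _] := legal_full m_gt0 lz mA sz_zs.
by apply: h; apply: wf_upd => //; rewrite cT.
Qed.

Lemma Q_iso (g : 'I_k -> L -> L) phi A : (forall i, isometry R (g i)) ->
  Q phi (fun i => g i @` A i)%fset = Q (fun A' => phi (fun i => g i @` A' i)%fset) A.
Proof.
move=> gi; apply: eq_bigr => i _; rewrite (Estep_iso m beta (gi i)); congr (_ * Estep _ _ _ _).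
apply: funext => B; congr phi; apply: funext => j.
by rewrite /upd; case: eqP => [->|].
Qed.

Lemma Q_trans p phi A i B : wf A -> trans m beta p (A i) B ->
  (forall A', 0 <= phi A') -> (sz i)%:R / total%:R * p * phi (upd A i B) <= Q phi A.
Proof.
move=> wA t phi0; rewrite /Q (bigD1 i) //= -[leLHS]addr0 lerD //.
  by rewrite -mulrA ler_wpM2l ?divr_ge0 //; apply: t => D; apply: phi0.
apply: sumr_ge0 => j _; rewrite mulr_ge0 ?divr_ge0 //.
have E0 l xs (f : seq L -> R) : (forall ys, 0 <= f ys) -> 0 <= Eseq m beta l (A j) xs f.
  move=> f0; elim: l xs => [|l IH] xs //=; apply: sumr_ge0 => y _.
  by rewrite mulr_ge0 // pr_ge0.
exact: E0.
Qed.

Lemma sum_union (F : L -> R) A : sep 1 A ->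
  \sum_(x <- union A) F x = \sum_i \sum_(x <- A i) F x.
Proof.
move=> sA; have dis i j x : x \in A i -> x \in A j -> i = j.
  move=> xi xj; apply/eqP/negPn/negP => ij.
  by have := sA i j ij _ _ xi xj; rewrite subrr l10.
transitivity (\sum_i \sum_(x <- union A) if x \in A i then F x else 0).
  rewrite exchange_big /= big_seq [RHS]big_seq; apply: eq_bigr => x /unionP [i xi].
  rewrite (bigD1 i) //= xi big1 ?addr0 // => j ji.
  by case: ifP => // xj; rewrite (dis _ _ _ xi xj) eqxx in ji.
apply: eq_bigr => i _; rewrite -big_mkcond big_fset_condE.
congr (\sum_(x <- enum_fset _) _); apply/fsetP => x; rewrite !inE /= andbC.
by case: (boolP (x \in A i)) => // xi; apply/unionP; exists i.
Qed.

Lemma card_union A : wf A -> sep 1 A -> #|` union A| = total.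
Proof.
move=> wA sA; have := sum_union (fun=> 1) sA.
have c (s : seq L) : \sum_(x <- s) 1 = (size s)%:R :> R.
  by rewrite big_const_seq count_predT iter_addr_0.
rewrite c; under eq_bigr do rewrite c wA.
by rewrite -natr_sum => /eqP; rewrite eqr_nat => /eqP.
Qed.

Lemma union_upd A i B : sep 1 A -> union (upd A i B) = (B `|` (union A `\` A i))%fset.
Proof.
move=> sA; apply/fsetP => x; rewrite !inE; apply/unionP/orP => [[j]|[xB|/andP [xi /unionP [j xj]]]].
- rewrite /upd; case: eqP => [_ ->|/eqP ji xj]; first by left.
  right; apply/andP; split; last by apply/unionP; exists j.
  by apply/negP => xi; have := sA j i ji _ _ xj xi; rewrite subrr l10.
- by exists i; rewrite upd_same.
- exists j; rewrite upd_other //; apply/eqP => e; move: xi; by rewrite -e xj.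
Qed.

Definition interaction (r D : nat) : R :=
  (2 * m)%:R * ((4 * d * total)%:R *
    ((d.+1 * m.+3 * (2 * m + 2))%:R * (1 + D%:R) / (1 + r%:R)) `^ beta).

(** The first site is uniform in the union, so it selects cluster [i] with probability
    [sz i / total] and is uniform in it, exactly as in [Q]. The remaining [2 * m - 1] draws are
    compared by [Eseq_compare], at the cost [eps] each. *)
Lemma Estep_union psi phi A r D : wf A -> sep r A -> (m.+1 < r)%N -> diamle D A ->
  (forall C, 0 <= psi C <= 1) -> (forall A', 0 <= phi A') ->
  (forall A', wf A' -> near 1 A A' -> psi (union A') <= phi A') ->
  Estep m beta (union A) psi <= Q phi A + interaction r D.
Proof.
move=> wA sA mr dA psi01 phi0 h.
have s1 : sep 1 A by move=> i j ij x y xi yj; apply: leq_trans (sA i j ij x y xi yj); apply: leq_trans mr.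
have cU := card_union wA s1; have t0 := total_gt0.
have [l lE] : exists l, (2 * m = l.+1)%N by exists (2 * m).-1; rewrite prednK // muln_gt0.
have prU B x : pr m beta B [::] x = (#|` B|%:R)^-1.
  by rewrite /pr /wt /supp /= big_const_seq count_predT iter_addr_0 mul1r.
have eps0 : 0 <= eps m beta (union A) r D by apply: eps_ge0.
rewrite /Estep {1}lE /= {1}/supp /=.
under eq_bigr do rewrite prU cU.
rewrite sum_union //.
apply: le_trans (_ : \sum_i \sum_(x <- A i) total%:R^-1 *
    (Eseq m beta l (A i) [:: x] (fun zs => phi (upd A i (transport m (A i) zs))) +
     l%:R * eps m beta (union A) r D) <= _).
  apply: ler_sum => i _; rewrite big_seq [leRHS]big_seq; apply: ler_sum => x xi.
  rewrite ler_wpM2l ?invr_ge0 //.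
  have AiU : (A i `<=` union A)%fset by apply/fsubsetP => z zi; apply/unionP; exists i.
  have mAi : (m < #|` A i|)%N by rewrite wA.
  have sepi y z : y \in A i -> z \in union A -> z \notin A i -> (r <= l1 (y - z)%R)%N.
    move=> yi /unionP [j zj] zi; apply: (sA i j _ _ _ yi zj).
    by apply/eqP => e; move: zi; rewrite e zj.
  apply: (Eseq_compare m_gt0 d_gt0 beta_ge0 AiU mAi mr sepi (dA i)) => //.
  - rewrite -[[:: x]]/(rcons [::] x); apply: legal_rcons; first exact: legal_nil.
    by rewrite /supp.
  - by rewrite lE add1n.
  move=> zs lz; rewrite add1n -lE => sz_zs.
  have [cT nT] := legal_full m_gt0 lz mAi sz_zs.
  rewrite (transport_sub AiU lz) -union_upd //; apply: h.
    by apply: wf_upd => //; rewrite cT.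
  exact: near_upd.
under eq_bigr do (under eq_bigr do rewrite mulrDr; rewrite big_split /=).
rewrite big_split /=; apply: lerD.
  apply: ler_sum => i _; rewrite /Estep lE /= {1}/supp /=.
  under [X in _ <= _ * X]eq_bigr do rewrite prU wA.
  rewrite -!mulr_sumr mulrA [_ / _ / _]mulrAC mulfV ?mul1r //.
  by rewrite pnatr_eq0 -lt0n (leq_ltn_trans _ (sz_ge i)).
under eq_bigr => i _ do rewrite big_const_seq count_predT iter_addr_0 wA.
rewrite sumrMnr -/total -[leLHS]mulr_natl mulVKf; last by rewrite pnatr_eq0 -lt0n.
apply: le_trans (_ : (2 * m)%:R * eps m beta (union A) r D <= _).
  by rewrite ler_wpM2r // ler_nat lE.
by rewrite /interaction /eps cU.
Qed.

(* In a canonical configuration every cluster is a straight segment; these are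
   the times at which the positions of the clusters are observed. *)
Definition iscan A : bool :=
  `[< exists x : 'I_k -> L, forall i, A i = line d_gt0 (sz i) (x i) >].

(* For the chain stopped at its first canonical configuration and watched for [N]
   steps: the expectation of [phi] at the stopping time, the probability of not
   having stopped, and the expected total of [g] before stopping. *)
Fixpoint hit N (phi : cfg -> R) A : R :=
  if N is N'.+1 then (if iscan A then phi A else Q (hit N' phi) A) else 0.

Fixpoint surv N A : R :=
  if N is N'.+1 then (if iscan A then 0 else Q (surv N') A) else 1.

Fixpoint cost N (g : cfg -> R) A : R :=
  if N is N'.+1 then (if iscan A then 0 else g A + Q (cost N' g) A) else 0.

Lemma hit_ge0 N phi A : (forall A', 0 <= phi A') -> wf A -> 0 <= hit N phi A.
Proof using m_gt0 d_gt0 k_gt0 sz_ge.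
move=> p0; elim: N A => [//|N IH] A wA /=; case: ifP => // _.
by apply: Q_ge0 => // A' wA' _; exact: IH.
Qed.

Lemma surv_ge0 N A : wf A -> 0 <= surv N A.
Proof using m_gt0 d_gt0 k_gt0 sz_ge.
elim: N A => [//|N IH] A wA /=; case: ifP => // _.
by apply: Q_ge0 => // A' wA' _; exact: IH.
Qed.

Lemma surv_le1 N A : wf A -> surv N A <= 1.
Proof using m_gt0 d_gt0 k_gt0 sz_ge.
elim: N A => [//|N IH] A wA /=; case: ifP => // _.
by rewrite -[leRHS](Q_cst 1 wA); apply: Q_le => // A' wA' _; exact: IH.
Qed.

Lemma surv_anti N A : wf A -> surv N.+1 A <= surv N A.
Proof using m_gt0 d_gt0 k_gt0 sz_ge.
elim: N A => [|N IH] A wA; first exact: surv_le1.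
rewrite [leRHS]/= [leLHS]/=; case: ifP => // _.
by apply: Q_le => // A' wA' _; exact: IH.
Qed.

Lemma surv_add M N (eta : R) A : (forall A', wf A' -> surv M A' <= eta) -> wf A ->
  surv (N + M) A <= eta * surv N A.
Proof using m_gt0 d_gt0 k_gt0 sz_ge.
move=> h; elim: N A => [|N IH] A wA; first by rewrite add0n /= mulr1; exact: h.
rewrite addSn /=; case: ifP => _; first by rewrite mulr0.
by rewrite -QZ; apply: Q_le => // A' wA' _; exact: IH.
Qed.

Lemma hit_surv N A : wf A -> hit N (fun=> 1) A + surv N A = 1.
Proof using m_gt0 d_gt0 k_gt0 sz_ge.
elim: N A => [|N IH] A wA /=; first by rewrite add0r.
case: ifP => _; first by rewrite addr0.
by rewrite -QD -[RHS](Q_cst 1 wA); apply: eq_Q => // A' wA' _; exact: IH.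
Qed.

Lemma hit_mono N phi A : (forall A', 0 <= phi A') -> wf A -> hit N phi A <= hit N.+1 phi A.
Proof using m_gt0 d_gt0 k_gt0 sz_ge.
move=> p0; elim: N A => [|N IH] A wA; first exact: hit_ge0.
rewrite [leLHS]/= [leRHS]/=; case: ifP => // _.
by apply: Q_le => // A' wA' _; exact: IH.
Qed.

Lemma cost_ge0 N g A : (forall A', 0 <= g A') -> wf A -> 0 <= cost N g A.
Proof using m_gt0 d_gt0 k_gt0 sz_ge.
move=> p0; elim: N A => [//|N IH] A wA /=; case: ifP => // _.
by rewrite addr_ge0 //; apply: Q_ge0 => // A' wA' _; exact: IH.
Qed.

Lemma cost_mono N g A : (forall A', 0 <= g A') -> wf A -> cost N g A <= cost N.+1 g A.
Proof using m_gt0 d_gt0 k_gt0 sz_ge.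
move=> p0; elim: N A => [|N IH] A wA; first exact: cost_ge0.
rewrite [leLHS]/= [leRHS]/=; case: ifP => // _; rewrite lerD2l.
by apply: Q_le => // A' wA' _; exact: IH.
Qed.

Lemma surv_sumS (c : nat -> R) N A : iscan A = false ->
  \sum_(t < N.+1) c t * surv t A = c 0%N + Q (fun A' => \sum_(t < N) c t.+1 * surv t A') A.
Proof.
move=> cA; rewrite big_ord_recl /= mulr1; congr (_ + _).
by rewrite (Q_sum _ (fun t : 'I_N => c t.+1) (fun t => surv t)); apply: eq_bigr => t _; rewrite /= cA.
Qed.

Lemma surv_sum_ge0 (c : nat -> R) N A : (forall t, 0 <= c t) -> wf A ->
  0 <= \sum_(t < N) c t * surv t A.
Proof using m_gt0 d_gt0 k_gt0 sz_ge.
by move=> c0 wA; apply: sumr_ge0 => t _; rewrite mulr_ge0 // surv_ge0.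
Qed.

(** Stopping at time [t] requires survival until then, so it has probability at most [surv t]. *)
Lemma hit_bound N phi (c : nat -> R) A : wf A -> (forall t, 0 <= c t) ->
  (forall t A', wf A' -> iscan A' -> near t A A' -> phi A' <= c t) ->
  hit N phi A <= \sum_(t < N) c t * surv t A.
Proof using m_gt0 d_gt0 k_gt0 sz_ge.
elim: N c A => [|N IH] c A wA c0 h; first by rewrite big_ord0.
have pos := surv_sum_ge0 N c0 wA.
rewrite [leLHS]/=; case: ifP => cA.
  rewrite big_ord_recl /= mulr1 ler_wpDr //; last by apply: h => //; exact: near_refl.
  by apply: sumr_ge0 => t _; rewrite mulr_ge0 // cA.
rewrite surv_sumS // ler_wpDl //; apply: Q_le => // A' wA' nA.
apply: (IH (fun t => c t.+1)) => // t A'' wA'' cA'' n2; apply: h => //.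
by rewrite -add1n; apply: near_trans nA n2.
Qed.

Lemma cost_bound N g (c : nat -> R) A : wf A -> (forall t, 0 <= c t) ->
  (forall t A', wf A' -> near t A A' -> g A' <= c t) ->
  cost N g A <= \sum_(t < N) c t * surv t A.
Proof using m_gt0 d_gt0 k_gt0 sz_ge.
elim: N c A => [|N IH] c A wA c0 h; first by rewrite big_ord0.
rewrite [leLHS]/=; case: ifP => cA; first exact: surv_sum_ge0.
rewrite surv_sumS // lerD //; first by apply: h => //; exact: near_refl.
apply: Q_le => // A' wA' nA.
apply: (IH (fun t => c t.+1)) => // t A'' wA'' n2; apply: h => //.
by rewrite -add1n; apply: near_trans nA n2.
Qed.

(** * Geometric tail of the time to a canonical configuration *)

Hypothesis sz_le : forall i, (sz i <= 2 * m + 1)%N.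

Lemma hit1_step (p : R) N A i B : 0 <= p <= 1 -> wf A -> trans m beta p (A i) B -> #|` B| = sz i ->
  p / total%:R * hit N (fun=> 1) (upd A i B) <= hit N.+1 (fun=> 1) A.
Proof using m_gt0 d_gt0 k_gt0 sz_ge.
move=> /andP [p0 p1] wA t cB; have wU := wf_upd wA cB.
have h0 := hit_ge0 N (fun=> ler01) wU.
have t1 : 1 <= total%:R :> R by rewrite ler1n total_gt0.
have t0 : 0 < total%:R :> R by apply: lt_le_trans t1.
have h1 : hit N (fun=> 1) (upd A i B) <= 1.
  by rewrite -[leRHS](hit_surv N wU) lerDl surv_ge0.
rewrite [leRHS]/=; case: ifP => _.
  apply: mulr_ile1 => //; first by rewrite divr_ge0 // ltW.
  by rewrite ler_pdivrMr // mul1r (le_trans p1).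
pose phi A' := `| hit N (fun=> 1) A' |.
have -> : Q (hit N (fun=> 1)) A = Q phi A.
  by apply: eq_Q => // A' wA' _; rewrite /phi ger0_norm // hit_ge0.
have := Q_trans wA t (fun A' => normr_ge0 _ : 0 <= phi A').
rewrite /phi ger0_norm //; apply: le_trans.
rewrite ler_wpM2r // [leRHS]mulrAC ler_wpM2r ?invr_ge0 ?(ltW t0) //.
rewrite -[leLHS]mul1r ler_wpM2r //.
by rewrite ler1n (leq_ltn_trans _ (sz_ge i)).
Qed.

Lemma hit1_reach (p : R) l N A i C B : 0 <= p <= 1 -> wf A -> A i = C ->
  reach m beta p l C B ->
  (p / total%:R) ^+ l * hit N (fun=> 1) (upd A i B) <= hit (N + l) (fun=> 1) A.
Proof using m_gt0 d_gt0 k_gt0 sz_ge.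
move=> p01 wA AiC r; elim: r A wA AiC => [G A wA AiC|l' G D1 D2 t c r IH A wA AiC].
  rewrite expr0 mul1r addn0.
  have -> : upd A i G = A by apply: funext => j; rewrite /upd; case: eqP => [->|].
  exact: lexx.
have c1 : #|` D1| = sz i by rewrite c -AiC wA.
rewrite -AiC in t; have := hit1_step (N + l') p01 wA t c1; rewrite -addnS; apply: le_trans.
have wU := wf_upd wA c1.
rewrite exprS -mulrA ler_wpM2l ?divr_ge0 //; first by case/andP: p01.
have := IH _ wU (upd_same _ _ _); congr (_ * hit _ _ _ <= _).
by apply: funext => j; rewrite /upd; case: eqP.
Qed.

Lemma hit_le_hit N M phi A : (forall A', 0 <= phi A') -> wf A -> (N <= M)%N ->
  hit N phi A <= hit M phi A.
Proof using m_gt0 d_gt0 k_gt0 sz_ge.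
move=> p0 wA /subnKC <-; elim: (M - N)%N => [|l IH]; first by rewrite addn0.
by rewrite addnS; apply: le_trans IH _; exact: hit_mono.
Qed.

(** Under [Q] each cluster is chosen with probability at least [1 / total], so the clusters can be
    straightened one after another while the others rest. The number of steps and the probability
    depend only on the sizes, not on the shapes or positions. *)
Lemma doeblin : exists K (eta : R), 0 <= eta < 1 /\ forall A, wf A -> surv K A <= eta.
Proof using m_gt0 d_gt0 beta_ge0 k_gt0 sz_ge sz_le.
have rl i : exists p : R, 0 < p <= 1 /\ forall C, #|` C| = sz i ->
    exists l x, (l <= 2 * sz i)%N /\ reach m beta p l C (line d_gt0 (sz i) x).
  have [|p p01 h] := @reach_line R d m beta m_gt0 d_gt0 beta_ge0 (sz i).
    by rewrite sz_ge sz_le.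
  by exists p.
have [p hp] := choice rl.
pose q := \prod_i p i; pose K0 := (\sum_i 2 * sz i)%N.
have p01 i : 0 <= p i <= 1 by have [/andP [/ltW -> ->]] := hp i.
have q0 : 0 < q by apply: prodr_gt0 => i _; have [/andP []] := hp i.
have qp i : q <= p i.
  rewrite /q (bigD1 i) //= -[leRHS]mulr1 ler_wpM2l //; first by case/andP: (p01 i).
  by apply: prodr_ile1 => j _.
have q01 : 0 <= q <= 1.
  by rewrite ltW //= (le_trans (qp (Ordinal k_gt0))) //; case/andP: (p01 (Ordinal k_gt0)).
have tot0 : 0 < total%:R :> R by rewrite ltr0n total_gt0.
have q' : 0 < q / total%:R <= 1.
  rewrite divr_gt0 //= ler_pdivrMr // mul1r; case/andP: q01 => _ h; apply: le_trans h _.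
  by rewrite ler1n total_gt0.
have h01 N A : wf A -> 0 <= hit N (fun=> 1) A by move=> wA; apply: hit_ge0.
(* Induction on the list [s] of clusters that may still be bent; [K0] bounds the number of steps
   spent on each. *)
have main (s : seq 'I_k) A : wf A ->
    (forall i, i \notin s -> exists x, A i = line d_gt0 (sz i) x) ->
    (q / total%:R) ^+ (K0 * size s) <= hit (1 + K0 * size s) (fun=> 1) A.
  elim: s A => [|i s IH] A wA hs.
    rewrite muln0 expr0 /= ifT //; apply/asboolP.
    have [x hx] := choice (fun i => hs i isT : exists x, A i = _).
    by exists x.
  have [_ /(_ _ (wA i)) [l [x [lK r]]]] := hp i.
  have r' : reach m beta q l (A i) (line d_gt0 (sz i) x).
    by apply: reach_weaken r; [case/andP: q01|exact: qp].
  have lK0 : (l <= K0)%N.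
    by apply: leq_trans lK _; rewrite /K0 (bigD1 i) //= leq_addr.
  have cB : #|` line d_gt0 (sz i) x| = sz i by rewrite (reach_card r').
  have wU := wf_upd wA cB.
  have := hit1_reach (1 + K0 * size s) q01 wA erefl r'.
  have h2 : hit (1 + K0 * size s + l) (fun=> 1) A <= hit (1 + K0 * size (i :: s)) (fun=> 1) A.
    by apply: hit_le_hit => //; rewrite /= mulnS -addnA leq_add2l addnC leq_add2r.
  move=> /le_trans /(_ h2); apply: le_trans.
  rewrite /= mulnS exprD; apply: ler_pM.
  - by rewrite exprn_ge0 // ltW //; case/andP: q'.
  - by rewrite exprn_ge0 // ltW //; case/andP: q'.
  - by apply: ler_wiXn2l => //; case/andP: q' => /ltW.
  - apply: IH => // j js; rewrite /upd; case: eqP => [->|/eqP ji]; first by exists x.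
    by apply: hs; rewrite inE negb_or ji.
pose e := (q / total%:R) ^+ (K0 * size (index_enum 'I_k)).
have e0 : 0 < e by apply: exprn_gt0; case/andP: q'.
have e1 : e <= 1 by apply: exprn_ile1; case/andP: q' => // /ltW.
exists (1 + K0 * size (index_enum 'I_k))%N, (1 - e); split.
  by rewrite subr_ge0 e1 ltrBlDr ltrDl.
move=> A wA; have := main (index_enum 'I_k) A wA.
rewrite -[surv _ _](addKr (hit (1 + K0 * size (index_enum 'I_k)) (fun=> 1) A)) hit_surv //.
rewrite addrC lerD2l lerN2; apply => i; by rewrite mem_index_enum.
Qed.

Lemma surv_le N M A : wf A -> (N <= M)%N -> surv M A <= surv N A.
Proof.
move=> wA /subnKC <-; elim: (M - N)%N => [|l IH]; first by rewrite addn0.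
by rewrite addnS; apply: le_trans IH; exact: surv_anti.
Qed.

(** Survival loses a factor [eta] over each block of [K.+1] steps, from any configuration; so all
    polynomial moments of the stopping time are bounded uniformly. *)
Lemma surv_sum q : exists2 M : R, 0 <= M &
  forall A N, wf A -> \sum_(t < N) t.+1%:R ^+ q * surv t A <= M.
Proof.
have [K [eta [/andP [eta0 eta1] hK]]] := doeblin.
have hK1 A : wf A -> surv K.+1 A <= eta.
  by move=> wA; apply: le_trans (hK A wA); exact: surv_anti.
have sj (j : nat) A : wf A -> surv (K.+1 * j) A <= eta ^+ j.
  move=> wA; elim: j => [|j IH]; first by rewrite muln0 expr0.
  rewrite mulnSr exprS; apply: le_trans (surv_add _ hK1 wA) _.
  by rewrite ler_wpM2l.
have [|M M0 hM] := @poly_geometric_sum R eta q; first by rewrite eta0.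
exists (K.+1%:R ^+ q.+1 * M); first by rewrite mulr_ge0 ?exprn_ge0.
move=> A N wA; pose F t := t.+1%:R ^+ q * surv t A.
have F0 t : 0 <= F t by rewrite mulr_ge0 ?exprn_ge0 // surv_ge0.
have blk (j : nat) : \sum_(0 <= t < K.+1 * j) F t <= K.+1%:R ^+ q.+1 * \sum_(l < j) l.+1%:R ^+ q * eta ^+ l.
  elim: j => [|j IH]; first by rewrite muln0 big_nil big_ord0 mulr0.
  rewrite big_ord_recr /= mulrDr (big_cat_nat (n := (K.+1 * j)%N)) //=; last by rewrite leq_pmul2l.
  apply: lerD IH _; apply: le_trans (_ : \sum_(K.+1 * j <= t < K.+1 * j.+1)
      (K.+1 * j.+1)%:R ^+ q * eta ^+ j <= _).
    rewrite big_nat_cond [leRHS]big_nat_cond; apply: ler_sum => t /andP [/andP [t1 t2] _].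
    apply: ler_pM; rewrite ?exprn_ge0 ?surv_ge0 //.
      by apply: lerXn2r; rewrite ?nnegrE // ler_nat.
    by apply: le_trans (sj j A wA); exact: surv_le.
  rewrite sumr_const_nat -mulnBr subSn // subnn muln1 -[leLHS]mulr_natl natrM exprMn exprS.
  by rewrite -!mulrA.
apply: le_trans (_ : \sum_(0 <= t < K.+1 * N) F t <= _).
  rewrite -(big_mkord xpredT F) [leRHS](big_cat_nat (n := N)) //=; last by rewrite leq_pmull.
  by rewrite lerDl; apply: sumr_ge0.
apply: le_trans (blk N) _; rewrite ler_wpM2l ?exprn_ge0 //; exact: hM.
Qed.

(** * Distances between clusters and their barycentres *)

Hypothesis k_ge2 : (1 < k)%N.

(* The minimal distance between two clusters. [get] is only meaningful when the
   clusters are nonempty, see [rminP]. *)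
Definition is_rmin A (r : nat) : Prop := sep r A /\
  exists i j x y, [/\ i != j, x \in A i, y \in A j & l1 (x - y)%R = r].

Definition rmin A : nat := get (is_rmin A).

Lemma wf_in A i : wf A -> exists x, x \in A i.
Proof.
by move=> wA; apply/fset0Pn; rewrite -cardfs_gt0 wA (leq_ltn_trans _ (sz_ge i)).
Qed.

Lemma rminP A : wf A -> is_rmin A (rmin A).
Proof.
move=> wA; apply: (@getPex _ (is_rmin A)).
pose P r := `[< exists i j x y, [/\ i != j, x \in A i, y \in A j & l1 (x - y)%R = r] >].
have exP : exists r, P r.
  pose i0 : 'I_k := Ordinal (ltnW k_ge2); pose i1 : 'I_k := Ordinal k_ge2.
  have [x xi] := wf_in i0 wA; have [y yi] := wf_in i1 wA.
  by exists (l1 (x - y)); apply/asboolP; exists i0, i1, x, y.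
case: (ex_minnP exP) => r /asboolP h rmin_; exists r; split=> //.
by move=> i j ij x y xi yj; apply: rmin_; apply/asboolP; exists i, j, x, y.
Qed.

Definition is_dmax A (D : nat) : Prop := diamle D A /\ forall D', diamle D' A -> (D <= D')%N.

Definition dmax A : nat := get (is_dmax A).

Lemma dmaxP A : is_dmax A (dmax A).
Proof.
apply: (@getPex _ (is_dmax A)); pose P D := `[< diamle D A >].
have exP : exists D, P D.
  exists (\sum_i \sum_(x <- A i) \sum_(y <- A i) l1 (x - y))%N; apply/asboolP => i x y xi yi.
  rewrite (bigD1 i) //= (big_fsetD1 x) //= (big_fsetD1 y) //=.
  by rewrite -!addnA leq_addr.
case: (ex_minnP exP) => D /asboolP h Dmin; exists D; split=> // D' hD'.
by apply: Dmin; apply/asboolP.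
Qed.

Lemma near_rmin t A A' : wf A -> wf A' -> near t A A' -> (rmin A <= rmin A' + 2 * (m * t))%N.
Proof.
move=> wA wA' nA; have [sA _] := rminP wA; have [_ [i [j [x [y [ij xi yj <-]]]]]] := rminP wA'.
case: (leqP (rmin A) (2 * (m * t))) => h; first by apply: leq_trans h _; rewrite leq_addl.
rewrite addnC -leq_subLR; apply: (near_sep nA _ ij xi yj).
by move=> i' j' ij' x' y' xi' yj'; rewrite subnK ?(ltnW h) //; exact: sA ij' _ _ xi' yj'.
Qed.

Lemma near_dmax t A A' : near t A A' -> (dmax A' <= dmax A + 2 * (m * t))%N.
Proof. by move=> nA; apply: (dmaxP A').2; apply: near_diam nA _; apply: (dmaxP A).1. Qed.

(** The barycentre of cluster [i], for a cluster of the prescribed size [sz i]. *)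
Definition cen A i c : R := (\sum_(x <- A i) (x ord0 c)%:~R) / (sz i)%:R.

Definition gap A i j c : R := cen A i c - cen A j c.

Lemma cen_avg A i c (h B : R) : wf A ->
  (forall x, x \in A i -> `|(x ord0 c)%:~R - h| <= B) -> `|cen A i c - h| <= B.
Proof.
move=> wA hx; have s0 : 0 < (sz i)%:R :> R by rewrite ltr0n (leq_ltn_trans _ (sz_ge i)).
have cst (y : R) : y = (\sum_(x <- A i) y) / (sz i)%:R.
  rewrite big_const_seq count_predT iter_addr_0 (wA i : size _ = _) -[X in X / _]mulr_natr mulfK //.
  by rewrite gt_eqF.
rewrite {1}(cst h) /cen -mulrBl -sumrB normrM normfV (ger0_norm (ltW s0)).
rewrite [leRHS](cst B) ler_wpM2r //.
apply: le_trans (ler_norm_sum _ _ _) _.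
by rewrite big_seq [leRHS]big_seq; apply: ler_sum => x; exact: hx.
Qed.

Lemma gap_avg A i j c (h B : R) : wf A ->
  (forall x y, x \in A i -> y \in A j -> `|((x ord0 c)%:~R - (y ord0 c)%:~R) - h| <= B) ->
  `|gap A i j c - h| <= B.
Proof.
move=> wA hxy.
have -> : gap A i j c - h = cen A i c - (cen A j c + h) by rewrite /gap; ring.
apply: cen_avg => // x xi.
have -> : (x ord0 c)%:~R - (cen A j c + h) = - (cen A j c - ((x ord0 c)%:~R - h)) :> R by ring.
rewrite normrN; apply: cen_avg => // y yj.
have := hxy x y xi yj; congr (_ <= _); rewrite -normrN; congr `|_|; ring.
Qed.

Lemma norm_coord (x : L) c : `|(x ord0 c)%:~R : R| <= (l1 x)%:R.
Proof. by rewrite -intr_norm -natr_absz ler_nat l1_coord. Qed.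

Lemma norm_coordB (x y : L) c : `|(x ord0 c)%:~R - (y ord0 c)%:~R : R| <= (l1 (x - y))%:R.
Proof. by have := norm_coord (x - y) c; rewrite !mxE rmorphB. Qed.

(** * Symmetries *)

Lemma hit_sum N (I : Type) (s : seq I) (c : I -> R) (F : I -> cfg -> R) A :
  hit N (fun A => \sum_(l <- s) c l * F l A) A = \sum_(l <- s) c l * hit N (F l) A.
Proof.
elim: N A => [|N IH] A /=; first by rewrite big1 // => l _; rewrite mulr0.
have [cA|cA] := boolP (iscan A); first reflexivity.
by rewrite -Q_sum; congr Q; apply: funext => A'; exact: IH.
Qed.

Lemma hit_le N phi phi' A : wf A ->
  (forall A', wf A' -> iscan A' -> phi A' <= phi' A') -> hit N phi A <= hit N phi' A.
Proof.
move=> wA h; elim: N A wA => [//|N IH] A wA /=.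
case: (boolP (iscan A)) => cA; first exact: h.
by apply: Q_le => // A' wA' _; exact: IH.
Qed.

Lemma eq_hit N phi phi' A : wf A ->
  (forall A', wf A' -> iscan A' -> phi A' = phi' A') -> hit N phi A = hit N phi' A.
Proof. by move=> wA h; apply/eqP; rewrite eq_le !hit_le // => A' w c; rewrite h. Qed.

Lemma hit_lower N phi (c : R) A : wf A -> 0 <= c ->
  (forall t A', wf A' -> iscan A' -> (t < N)%N -> near t A A' -> c <= phi A') ->
  c * hit N (fun=> 1) A <= hit N phi A.
Proof.
move=> wA c0; elim: N A wA => [|N IH] A wA h; first by rewrite mulr0.
rewrite [hit _ phi _]/= [hit _ _ A in leLHS]/=; case: (boolP (iscan A)) => cA.
  by rewrite mulr1; apply: (h 0%N) => //; exact: near_refl.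
rewrite -QZ; apply: Q_le => // A' wA' nA; apply: IH => // t A'' wA'' cA'' tN n2.
by apply: (h t.+1) => //; rewrite -add1n; apply: near_trans nA n2.
Qed.

(* Translations and coordinate reflections at once. Canonical configurations are
   fixed by suitable reflections of each cluster in any given coordinate, which
   kills the odd moments of the displacement. *)
Definition aff (s : 'I_d -> bool) (v x : L) : L := \row_c ((-1) ^+ s c * x ord0 c + v ord0 c).

Definition affs s (v : 'I_k -> L) A : cfg := fun i => (aff s (v i) @` A i)%fset.

Definition affinv (s : 'I_d -> bool) (v : L) : L := \row_c - ((-1) ^+ s c * v ord0 c).

Lemma affK s v : cancel (aff s v) (aff s (affinv s v)).
Proof.
move=> x; apply/rowP => c; rewrite !mxE mulrDr addrK mulrA -expr2 sqrr_sign mul1r.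
by [].
Qed.

Lemma affK' s v : cancel (aff s (affinv s v)) (aff s v).
Proof.
move=> x; apply/rowP => c; rewrite !mxE mulrDr mulrA -expr2 sqrr_sign mul1r.
rewrite mulrN mulrA -expr2 sqrr_sign mul1r subrK.
by [].
Qed.

Lemma aff_inj s v : injective (aff s v).
Proof. exact: can_inj (affK s v). Qed.

Lemma aff_iso s v : isometry R (aff s v).
Proof.
split; first by exists (aff s (affinv s v)); [exact: affK|exact: affK'].
move=> x y; congr Num.sqrt; apply: eq_bigr => c _; rewrite !mxE.
rewrite opprD addrACA subrr addr0 -mulrBr rmorphM rmorph_sign exprMn sqrr_sign mul1r.
reflexivity.
Qed.

Lemma affsK s (v : 'I_k -> L) A : affs s (fun i => affinv s (v i)) (affs s v A) = A.
Proof.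
apply: funext => i; apply/fsetP => x; rewrite -{1}(affK s (v i) x).
by rewrite !mem_imfset //; exact: aff_inj.
Qed.

Lemma line_aff s v a x : (0 < a)%N ->
  (aff s v @` line d_gt0 a x)%fset = line d_gt0 a (aff s v x - unitv (e0 d_gt0) *+ (s (e0 d_gt0) * a.-1)).
Proof.
set e := e0 d_gt0 => a0.
have affD y (j : nat) : aff s v (y + unitv e *+ j) = aff s v y + (-1) ^+ s e *: (unitv e *+ j).
  apply/rowP => c; rewrite !mxE mulrDr addrAC; congr (_ + _); rewrite !mulmxnE !unitvE.
  by case: eqP => [->//|_]; rewrite !mul0rn !mulr0.
have ar (j : nat) : (a.-1 - j < a)%N by rewrite (leq_ltn_trans (leq_subr _ _)) ?prednK.
have ja1 (j : nat) : (j < a)%N -> (j <= a.-1)%N by rewrite -[(_ <= a.-1)%N]ltnS prednK.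
apply/fsetP => z; apply/imfsetP/windowP => [[y /= /line_in [j ja ->] ->]|[j /= ja ->]].
  rewrite -/e affD; case: (s e); rewrite ?(mul1n, mul0n) ?expr1 ?expr0.
    exists (a.-1 - j)%N; first exact: ar.
    rewrite -addrA scaleN1r; congr (_ + _).
    by rewrite mulrnBr ?ja1 // addKr.
  by exists j; rewrite // scale1r mulr0n subr0.
rewrite -/e; case se : (s e); rewrite ?(mul1n, mul0n).
  exists (x + unitv e *+ (a.-1 - j)); first by apply/windowP; exists (a.-1 - j)%N => //=; exact: ar.
  rewrite affD se expr1 scaleN1r mulrnBr; last exact: ja1.
  by rewrite opprB addrA addrAC.
exists (x + unitv e *+ j); first by apply/windowP; exists j.
by rewrite affD se expr0 scale1r mulr0n subr0.
Qed.

Lemma iscan_affs s v A : iscan (affs s v A) = iscan A.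
Proof.
have h s' v' A' : iscan A' -> iscan (affs s' v' A').
  move=> /asboolP [x hx]; apply/asboolP.
  exists (fun i => aff s' (v' i) (x i) - unitv (e0 d_gt0) *+ (s' (e0 d_gt0) * (sz i).-1)) => i.
  by rewrite /affs hx line_aff // (leq_ltn_trans _ (sz_ge i)).
apply/idP/idP => [cA|]; last exact: h.
by rewrite -(affsK s v A); apply: h.
Qed.

Lemma hit_affs s v N phi A : hit N phi (affs s v A) = hit N (fun A' => phi (affs s v A')) A.
Proof.
elim: N A => [//|N IH] A /=; rewrite iscan_affs; case: (iscan A) => //.
rewrite (Q_iso _ _ (fun i => aff_iso s (v i))).
by congr Q; apply: funext => A'; exact: IH.
Qed.

Lemma cen_affs s v A i c : wf A ->
  cen (affs s v A) i c = (-1) ^+ s c * cen A i c + (v i ord0 c)%:~R.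
Proof.
move=> wA; have s0 : (sz i)%:R != 0 :> R by rewrite pnatr_eq0 -lt0n (leq_ltn_trans _ (sz_ge i)).
rewrite /cen /affs big_imfset /=; last by move=> ? ? _ _; exact: aff_inj.
under eq_bigr do rewrite mxE rmorphD rmorphM rmorph_sign.
rewrite big_split /= -mulr_sumr mulrDl mulrA; congr (_ * _ / _ + _).
by rewrite big_const_seq count_predT iter_addr_0 (wA i : size _ = _) -[X in X / _]mulr_natr mulfK.
Qed.

Lemma gap_affs s v A i j c : wf A ->
  gap (affs s v A) i j c = (-1) ^+ s c * gap A i j c + (v i ord0 c - v j ord0 c)%:~R.
Proof. by move=> wA; rewrite /gap !cen_affs // rmorphB /=; ring. Qed.

(** All segments start at the origin. Their overlap is harmless, since clusters do not interact
    under [Q]. *)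
Definition can0 : cfg := fun i => line d_gt0 (sz i) 0.

Lemma card_line a x : #|` line d_gt0 a x| = a.
Proof.
rewrite /line /window card_in_imfset /=; first by rewrite undup_id ?iota_uniq ?size_iota.
move=> i j _ _ /addrI /(congr1 (@l1 d)); by rewrite !l1_unitv.
Qed.

Lemma wf_can0 : wf can0.
Proof. by move=> i; rewrite card_line. Qed.

Lemma wf_iscan A : iscan A -> wf A.
Proof. by move=> /asboolP [x hx] i; rewrite hx card_line. Qed.

Definition dev i j c A : R := gap A i j c - gap can0 i j c.

Lemma iscan_affs_can0 A : iscan A -> exists v, A = affs (fun=> false) v can0.
Proof.
move=> /asboolP [x hx]; exists x; apply: funext => i; rewrite /affs line_aff; last first.
  by rewrite (leq_ltn_trans _ (sz_ge i)).
rewrite hx mul0n mulr0n subr0; congr line; apply/rowP => c; rewrite !mxE mulr0 add0r.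
by [].
Qed.

(** Without interaction the clusters can be translated independently, so the law of the displacement
    is the same from every canonical configuration. *)
Lemma Q_hit_can N A i j (psi : ('I_d -> R) -> R) : iscan A ->
  Q (hit N (fun A' => psi (gap A' i j))) A =
  Q (hit N (fun A' => psi (fun c => gap A i j c + dev i j c A'))) can0.
Proof.
move=> cA; have [v AE] := iscan_affs_can0 cA.
rewrite {1}AE (Q_iso _ _ (fun i => aff_iso _ (v i))).
apply: eq_Q; first exact: wf_can0.
move=> A' wA' _; rewrite -/(affs _ v A') hit_affs; apply: eq_hit => // A'' wA'' _.
congr psi; apply: funext => c; rewrite gap_affs // expr0 mul1r {1}AE gap_affs; last exact: wf_can0.
rewrite expr0 mul1r /dev; ring.
Qed.

(** The reflection of coordinate [c], followed by the translation that puts a reversed segment back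
    into place, fixes [can0]. *)
Lemma Q_hit_refl N i j c (psi : ('I_d -> R) -> R) :
  Q (hit N (fun A' => psi (fun c' => dev i j c' A'))) can0 =
  Q (hit N (fun A' => psi (fun c' => (-1) ^+ (c' == c) * dev i j c' A'))) can0.
Proof.
pose v i : L := unitv (e0 d_gt0) *+ ((c == e0 d_gt0) * (sz i).-1).
have E : affs (pred1 c) v can0 = can0.
  apply: funext => i'; rewrite /affs line_aff; last by rewrite (leq_ltn_trans _ (sz_ge i')).
  congr line; apply/rowP => c'; rewrite !mxE mulr0 add0r /v /= eq_sym.
  by rewrite addrC addNr.
rewrite -{1}E (Q_iso _ _ (fun i => aff_iso _ (v i))).
apply: eq_Q; first exact: wf_can0.
move=> A' wA' _; rewrite -/(affs _ v A') hit_affs; apply: eq_hit => // A'' wA'' _.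
congr psi; apply: funext => c'; rewrite /dev -{1}E !gap_affs //; last exact: wf_can0.
rewrite /=; ring.
Qed.

(** Observables growing polynomially with the elapsed time have bounded expectation at the stopping
    time, with a bound that does not depend on the truncation [N]. *)
Lemma hit_poly q : exists2 M : R, 0 <= M & forall N phi (C : R) A, wf A -> 0 <= C ->
  (forall t A', wf A' -> iscan A' -> near t A A' -> phi A' <= C * t.+1%:R ^+ q) ->
  hit N phi A <= C * M.
Proof.
have [M M0 hM] := surv_sum q; exists M => // N phi C A wA C0 h.
apply: le_trans (hit_bound N wA (fun t => mulr_ge0 C0 (exprn_ge0 q (ler0n R t.+1))) h) _.
under eq_bigr do rewrite -mulrA.
by rewrite -mulr_sumr ler_wpM2l // hM.
Qed.

Lemma Qhit_poly q : exists2 M : R, 0 <= M & forall N phi (C : R) A, wf A -> 0 <= C ->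
  (forall t A', wf A' -> iscan A' -> near t.+1 A A' -> phi A' <= C * t.+1%:R ^+ q) ->
  Q (hit N phi) A <= C * M.
Proof.
have [M M0 hM] := hit_poly q; exists M => // N phi C A wA C0 h.
rewrite -[leRHS](Q_cst (C * M) wA); apply: Q_le => // A' wA' nA; apply: hM => // t A'' wA'' cA'' n2.
by apply: h => //; rewrite -add1n; apply: near_trans nA n2.
Qed.

Lemma cost_poly q : exists2 M : R, 0 <= M & forall N g (C : R) A, wf A -> 0 <= C ->
  (forall t A', wf A' -> near t A A' -> g A' <= C * t.+1%:R ^+ q) ->
  cost N g A <= C * M.
Proof.
have [M M0 hM] := surv_sum q; exists M => // N g C A wA C0 h.
apply: le_trans (cost_bound N wA (fun t => mulr_ge0 C0 (exprn_ge0 q (ler0n R t.+1))) h) _.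
under eq_bigr do rewrite -mulrA.
by rewrite -mulr_sumr ler_wpM2l // hM.
Qed.

Lemma Qcost_poly q : exists2 M : R, 0 <= M & forall N g (C : R) A, wf A -> 0 <= C ->
  (forall t A', wf A' -> near t.+1 A A' -> g A' <= C * t.+1%:R ^+ q) ->
  Q (cost N g) A <= C * M.
Proof.
have [M M0 hM] := cost_poly q; exists M => // N g C A wA C0 h.
rewrite -[leRHS](Q_cst (C * M) wA); apply: Q_le => // A' wA' nA; apply: hM => // t A'' wA'' n2.
by apply: h => //; rewrite -add1n; apply: near_trans nA n2.
Qed.

Lemma sz_total i : (sz i <= total)%N.
Proof. by rewrite /total (bigD1 i) //= leq_addr. Qed.

Lemma gap_near_can0 t A i j c : wf A -> near t can0 A -> `|gap A i j c| <= 2 * (m * t + total)%:R.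
Proof.
move=> wA nA; rewrite -[gap A i j c]subr0; apply: gap_avg => // x y xi yj; rewrite subr0.
have pt i' z : z \in A i' -> `|(z ord0 c)%:~R : R| <= (m * t + total)%:R.
  move=> /nA [w /line_in [l lsz ->] zw]; apply: le_trans (norm_coord _ _) _; rewrite ler_nat.
  rewrite -(subrK (0 + unitv (e0 d_gt0) *+ l) z).
  apply: leq_trans (l1D _ _) _; apply: leq_add zw _.
  by rewrite add0r l1_unitv (leq_trans _ (sz_total i')) // ltnW.
by rewrite mulr_natl mulr2n; apply: le_trans (ler_normB _ _) _; apply: lerD; [exact: pt xi|exact: pt yj].
Qed.

Lemma dev_near t A i j c : wf A -> near t.+1 can0 A ->
  `|dev i j c A| <= (2 * m + 4 * total)%:R * t.+1%:R.
Proof.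
move=> wA nA; apply: le_trans (ler_normB _ _) _.
have h1 := gap_near_can0 i j c wA nA; have h2 := gap_near_can0 i j c wf_can0 (@near_refl _).
apply: le_trans (lerD h1 h2) _; rewrite -!natrM -natrD ler_nat muln0 add0n.
by rewrite mulnDl mulnDr -addnA leq_add // ?mulnA // -mulnDl leq_pmulr.
Qed.

(** * Positivity of the variances *)

Lemma Q_trans_wf (p : R) phi A i B : wf A -> trans m beta p (A i) B -> #|` B| = sz i ->
  (forall A', wf A' -> 0 <= phi A') -> (sz i)%:R / total%:R * p * phi (upd A i B) <= Q phi A.
Proof.
move=> wA t cB phi0; have wU := wf_upd wA cB.
have := Q_trans wA t (fun A' => normr_ge0 (phi A')); rewrite ger0_norm ?phi0 // => /le_trans; apply.
by apply: Q_le => // A' wA' _; rewrite ger0_norm ?phi0.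
Qed.

Lemma sum_unitv (e : 'I_d) n : \sum_c (unitv e *+ n : L) ord0 c = n%:Z.
Proof.
rewrite (bigD1 e) //= big1 ?addr0; first by rewrite mulmxnE unitvE eqxx mulr1n natz.
by move=> c ce; rewrite mulmxnE unitvE eq_sym (negPf ce) mul0rn.
Qed.

(* A path which follows a segment in direction [e0], makes [m] steps in direction
   [c], and then continues in direction [e0]. Windows along it are canonical
   again only after the coordinate [c] has changed, so that the displacement
   between canonical configurations has positive variance in every direction. *)
Definition climb_u (a l : nat) : nat := minn (l - a.-1) m.

Definition climb (a : nat) (c : 'I_d) (l : nat) : L :=
  unitv (e0 d_gt0) *+ (l - climb_u a l) + unitv c *+ climb_u a l.

Lemma climb_sum a c l : \sum_c' climb a c l ord0 c' = l%:Z.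
Proof.
under eq_bigr do rewrite mxE.
rewrite big_split /= !sum_unitv -PoszD subnK //.
by rewrite /climb_u (leq_trans (geq_minl _ _)) // leq_subr.
Qed.

Lemma climb_l1 a c l : (l1 (climb a c l) <= l)%N.
Proof.
apply: leq_trans (l1D _ _) _; rewrite !l1_unitv subnK //.
by rewrite /climb_u (leq_trans (geq_minl _ _)) // leq_subr.
Qed.

Lemma climb_uS a l : (climb_u a l.+1 = climb_u a l /\ l.+1 - climb_u a l.+1 = (l - climb_u a l).+1
  \/ climb_u a l.+1 = (climb_u a l).+1 /\ l.+1 - climb_u a l.+1 = l - climb_u a l)%N.
Proof. rewrite /climb_u; move: (m) => m'; lia. Qed.

Lemma climb_adj a c l : l1 (climb a c l.+1 - climb a c l) = 1%N.
Proof.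
have s1 c' n : unitv c' *+ n.+1 - unitv c' *+ n = unitv c' :> L by rewrite mulrSr addrAC subrr add0r.
rewrite /climb; case: (climb_uS a l) => -[-> ->].
  by rewrite addrAC -addrA opprD !addrA subrK s1 (l1_unitv _ 1).
by rewrite opprD addrACA subrr add0r s1 (l1_unitv _ 1).
Qed.

Lemma climb_trans a c t : (m < a)%N -> exists2 p : R, 0 < p &
  trans m beta p (window (climb a c) (m * t) a) (window (climb a c) (m * t.+1) a) /\
  #|` window (climb a c) (m * t.+1) a| = #|` window (climb a c) (m * t) a|.
Proof.
move=> ma; set W := window (climb a c) (m * t) a; pose B := (2 * (m * t + a + m))%N.
have [||||tr cd] := @window_step R d m beta m_gt0 d_gt0 beta_ge0 (climb a c) a (m * t) B fset0 ma.
- move=> i j _ _ /(congr1 (fun x : L => \sum_c' x ord0 c')).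
  by rewrite !climb_sum => -[].
- by move=> l _; rewrite -[X in climb a c X - _]prednK ?climb_adj // !addn_gt0 (leq_trans _ ma) ?orbT.
- by move=> i _; rewrite inE.
- move=> i j /andP [_ ir] /andP [_ jr]; apply: leq_trans (l1D _ _) _; rewrite l1N /B mul2n -addnn.
  by apply: leq_add; apply: leq_trans (climb_l1 _ _ _) _; exact: ltnW.
rewrite !fsetU0 -/W addnC -mulnS in tr cd.
exists (trp d m beta #|` W| B.+1) => //; apply: trp_gt0 => //.
rewrite cardfs_gt0; apply/fset0Pn; exists (climb a c (m * t)).
by apply/windowP; exists (m * t)%N; rewrite // leqnn -[X in (X < _)%N]addn0 ltn_add2l (leq_trans _ ma).
Qed.

Lemma window_climb0 a c : window (climb a c) (m * 0) a = line d_gt0 a 0.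
Proof.
apply: eq_window => l la; rewrite muln0 !add0n /climb /climb_u.
have -> : (l - a.-1 = 0)%N by apply/eqP; rewrite subn_eq0 -ltnS prednK // (leq_ltn_trans _ la).
by rewrite min0n subn0 mulr0n addr0 add0r.
Qed.

Lemma climb_line a c : (0 < a)%N ->
  window (climb a c) (m * a.+1) a = line d_gt0 a (climb a c (m * a.+1)).
Proof.
move=> a0; have ge l : (m <= m * a.+1 + l - a.-1)%N.
  rewrite mulnS -addnA -addnBA ?leq_addr // (leq_trans (leq_pred _)) //.
  by rewrite (leq_trans (leq_pmull a m_gt0)) ?leq_addr.
apply: eq_window => l la; rewrite add0n /climb /climb_u (minn_idPr (ge l)).
have := ge 0%N; rewrite addn0 => g0; rewrite (minn_idPr g0).
have -> : (m * a.+1 + l - m = m * a.+1 - m + l)%N by rewrite addnBAC // mulnS leq_addr.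
by rewrite mulrnDr addrAC.
Qed.

(** For [c] other than [e0] the front site of the window has already moved in direction [c], and on
    a segment this coordinate is constant. For [c = e0] all sites of the window have moved. *)
Lemma climb_coord a c t v : (0 < a)%N -> window (climb a c) (m * t.+1) a = line d_gt0 a v ->
  0 < v ord0 c.
Proof.
move=> a0 E; have t1 : (0 < m * t.+1)%N by rewrite muln_gt0 m_gt0.
case: (eqVneq c (e0 d_gt0)) => [ce|ce].
  have /windowP [l /andP [l1_ _] vE] : v \in window (climb a c) (m * t.+1) a.
    by rewrite E; apply/windowP; exists 0%N => //=; rewrite mulr0n addr0.
  rewrite vE /climb ce -mulrnDr subnK; last first.
    by rewrite /climb_u (leq_trans (geq_minl _ _)) // leq_subr.
  by rewrite mulmxnE unitvE eqxx mulr1n natz ltz_nat (leq_trans t1).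
pose l := (m * t.+1 + a.-1)%N.
have /line_in [i ia hE] : climb a c l \in line d_gt0 a v.
  by rewrite -E; apply/windowP; exists l; rewrite // leq_addr ltn_add2l prednK /=.
have := congr1 (fun x : L => x ord0 c) hE; rewrite /climb /= !mxE.
rewrite !mulmxnE !unitvE eqxx eq_sym (negPf ce) !mul0rn add0r addr0 mulr1n => <-.
by rewrite natz ltz_nat /climb_u /l addnK leq_min t1.
Qed.

(** Otherwise no possible path could end in a canonical configuration with nonzero displacement. The
    windows of [climb] form such a path: one of them is canonical after at most [(sz i).+1] steps,
    and the first that is has a positive displacement. *)
Lemma var_gt0 i j c : i != j -> exists N, 0 < Q (hit N (fun A => dev i j c A ^+ 2)) can0.
Proof.
move=> ij; apply/not_existsP => V0; set f := fun A => dev i j c A ^+ 2.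
have f0 A : 0 <= f A by exact: sqr_ge0.
have a0 : (0 < sz i)%N by apply: leq_ltn_trans (sz_ge i).
have h0 N A : wf A -> 0 <= hit N f A by move=> wA; apply: hit_ge0.
have prop A B (p : R) N : wf A -> 0 < p -> trans m beta p (A i) B -> #|` B| = sz i ->
    Q (hit N f) A <= 0 -> hit N f (upd A i B) <= 0.
  move=> wA p0 t cB Q0; have := Q_trans_wf wA t cB (h0 N).
  move=> /le_trans /(_ Q0); rewrite pmulr_rle0 // mulr_gt0 // divr_gt0 // ltr0n //.
  exact: total_gt0.
pose W t := window (climb (sz i) c) (m * t) (sz i); pose B t := upd can0 i (W t).
have cW t : #|` W t| = sz i.
  elim: t => [|t IH]; first by rewrite /W window_climb0 card_line.
  by have [p _ [_ ->]] := climb_trans c t (sz_ge i).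
have wB t : wf (B t) by apply: wf_upd => //; exact: wf_can0.
have BS t : B t.+1 = upd (B t) i (W t.+1).
  by apply: funext => i'; rewrite /B /upd; case: eqP.
have cpos t : iscan (B t.+1) -> 0 < f (B t.+1).
  move=> cB; have [v Bv] := iscan_affs_can0 cB.
  have Wv : W t.+1 = line d_gt0 (sz i) (v i).
    have := congr1 (fun A : cfg => A i) Bv; rewrite /B upd_same => ->.
    rewrite /affs line_aff // mul0n mulr0n subr0; congr line.
    by apply/rowP => c'; rewrite !mxE mulr0 add0r.
  have vc := climb_coord a0 Wv.
  have -> : f (B t.+1) = ((v i ord0 c)%:~R) ^+ 2.
    rewrite /f /dev; congr (_ ^+ 2).
    have e1 : cen (B t.+1) i c = cen can0 i c + (v i ord0 c)%:~R.
      by rewrite Bv cen_affs ?expr0 ?mul1r //; exact: wf_can0.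
    have e2 : cen (B t.+1) j c = cen can0 j c by rewrite /cen /B upd_other // eq_sym.
    rewrite /gap e1 e2; ring.
  by rewrite exprn_gt0 // ltr0z.
(* Null expectations propagate along the path while the windows are not canonical; a canonical one
   would contradict the induction hypothesis for [N = 1]. *)
have I t N : hit N f (B t.+1) <= 0.
  elim: t N => [|t IH] N.
    have [p p0 [tr _]] := climb_trans c 0 (sz_ge i).
    apply: (prop _ _ p) => //; first exact: wf_can0.
      by rewrite /can0 -(window_climb0 (sz i) c).
    by rewrite leNgt; apply/negP; exact: V0.
  have [p p0 [tr _]] := climb_trans c t.+1 (sz_ge i).
  case: (boolP (iscan (B t.+1))) => cB.
    by have := IH 1%N; rewrite /= cB leNgt cpos.
  rewrite BS; apply: (prop _ _ p) => //; first by rewrite /B upd_same.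
  by have := IH N.+1; rewrite /= (negPf cB).
have cB : iscan (B (sz i).+1).
  apply/asboolP; exists (fun i' => if i' == i then climb (sz i) c (m * (sz i).+1) else 0) => i'.
  by rewrite /B /upd; case: eqP => [->|//]; rewrite /W climb_line.
by have := I (sz i) 1%N; rewrite /= cB leNgt cpos.
Qed.

(** The truncated variances increase with [N] and are bounded, so 9/10 of their supremum is reached.
    An interval in place of the limit lets the drift be proved at finite [N]. *)
Lemma var_lim i j c : i != j -> exists (sig : R) N0, 0 < sig /\ forall N, (N0 <= N)%N ->
  9 / 10 * sig <= Q (hit N (fun A => dev i j c A ^+ 2)) can0 <= sig.
Proof.
move=> ij; pose V (N : nat) := Q (hit N (fun A => dev i j c A ^+ 2)) can0.
have [N1 V1] : exists N, 0 < V N by exact: var_gt0.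
have mono N N' : (N <= N')%N -> V N <= V N'.
  move=> NN; apply: Q_le; first exact: wf_can0.
  by move=> A wA _; apply: hit_le_hit => // A'; exact: sqr_ge0.
have [M M0 hM] := Qhit_poly 2; pose b := (2 * m + 4 * total)%N.
have bnd N : V N <= b%:R ^+ 2 * M.
  apply: hM; [exact: wf_can0|by rewrite exprn_ge0|] => t A wA cA nA.
  rewrite -exprMn -[leLHS]real_normK ?num_real //.
  by apply: lerXn2r; rewrite ?nnegrE ?mulr_ge0 //; exact: dev_near.
have hs : has_sup (range V).
  by split; [exists (V 0%N); exists 0%N|exists (b%:R ^+ 2 * M) => _ [N _ <-]].
have le_sig N : V N <= sup (range V) by apply: sup_upper_bound => //; exists N.
have sig0 : 0 < sup (range V) by apply: lt_le_trans V1 (le_sig N1).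
have [|_ [N0 _ <-] h] := @sup_adherent _ (range V) (sup (range V) / 10) _ hs.
  by rewrite divr_gt0.
exists (sup (range V)), N0; split=> // N NN; apply/andP; split; last exact: le_sig.
by apply: le_trans (mono _ _ NN); move: h; lra.
Qed.

(** * Drift of the gap between two clusters *)

(** By reflection the expectation equals its own negative. *)
Lemma Q_hit_odd N i j c (psi : ('I_d -> R) -> R) :
  (forall f, psi (fun c' => (-1) ^+ (c' == c) * f c') = - psi f) ->
  Q (hit N (fun A => psi (fun c' => dev i j c' A))) can0 = 0.
Proof.
move=> h; set e := Q _ _.
have e1 : e = - e.
  rewrite -mulN1r /e -QZ; have -> := Q_hit_refl N i j c psi.
  congr Q; apply: funext => A.
  have := hit_sum N [:: tt] (fun=> -1) (fun _ A' => psi (fun c' => dev i j c' A')) A.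
  rewrite big_seq1 => <-; congr hit; apply: funext => A'.
  by rewrite h big_seq1 mulN1r.
by move: e1; lra.
Qed.

Lemma pair_drift (a : R) sig i j N0 : (3 <= d)%N -> 0 < a <= 1 / 100 -> (forall c, 0 < sig c) ->
  (forall c N, (N0 <= N)%N -> 9 / 10 * sig c <= Q (hit N (fun A => dev i j c A ^+ 2)) can0 <= sig c) ->
  exists2 K0 : R, 1 <= K0 & forall K N A u, K0 <= K -> (N0 <= N)%N -> iscan A ->
    u = K + \sum_c gap A i j c ^+ 2 / sig c ->
    Q (hit N (fun A' => (K + \sum_c gap A' i j c ^+ 2 / sig c) `^ (- a))) A <=
      u `^ (- a) * (1 - a / 20 / u).
Proof.
(* The displacement grows at most linearly in time, and the sixth power of a quadratic form in it is
   needed, hence the exponent 12. *)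
move=> d3 a01 sig0 var; have [M M0 hM] := Qhit_poly 12.
pose b : R := (2 * m + 4 * total)%:R; pose S : R := 1 + \sum_c b ^+ 2 / sig c.
have S0 : 0 <= S.
  by rewrite addr_ge0 // sumr_ge0 // => c _; rewrite divr_ge0 ?sqr_ge0 // ltW.
have S1 : 1 <= S.
  by rewrite lerDl sumr_ge0 // => c _; rewrite divr_ge0 ?sqr_ge0 // ltW.
have [K0 K1 hK] := @quadratic_drift R cfg d a (S ^+ 6 * M) sig d3 a01 (mulr_ge0 (exprn_ge0 _ S0) M0) sig0.
exists K0 => // K N A u KK NN cA uE.
rewrite (Q_hit_can N i j (fun h => (K + \sum_c h c ^+ 2 / sig c) `^ (- a)) cA).
have w0 := wf_can0.
apply: (hK (fun phi => Q (hit N phi) can0) (fun c A => dev i j c A)) => //.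
- by move=> phi phi' h; apply: Q_le => // A' wA' _; apply: hit_le.
- move=> I s c F; rewrite -Q_sum; congr Q; apply: funext => A'; exact: hit_sum.
- rewrite -[leRHS](Q_cst 1 w0); apply: Q_le => // A' wA' _.
  by rewrite -[leRHS](hit_surv N wA') lerDl surv_ge0.
- by move=> c; apply: (@Q_hit_odd N i j c (fun f => f c)) => f; rewrite eqxx expr1 mulN1r.
- move=> c c' cc'; apply: (@Q_hit_odd N i j c (fun f => f c * f c')) => f.
  by rewrite eqxx expr1 eq_sym (negPf cc') expr0 mul1r mulN1r mulNr.
- move=> c c'; apply: (@Q_hit_odd N i j c (fun f => f c * f c' ^+ 2)) => f.
  by rewrite eqxx expr1 exprMn sqrr_sign mul1r mulN1r mulNr.
- by move=> c; apply: var.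
move=> p /andP [p2 p6]; apply: hM => //; first exact: exprn_ge0.
move=> t A' wA' cA' nA'.
have t1 : 1 <= t.+1%:R :> R by rewrite ler1n.
apply: le_trans (_ : (S * t.+1%:R ^+ 2) ^+ p <= _).
  apply: lerXn2r; rewrite ?nnegrE ?addr_ge0 ?mulr_ge0 ?exprn_ge0 //.
    by apply: sumr_ge0 => c _; rewrite divr_ge0 ?sqr_ge0 // ltW.
  rewrite mulrDl mul1r mulr_suml; apply: lerD; first exact: exprn_ege1.
  apply: ler_sum => c _; rewrite [leRHS]mulrAC ler_wpM2r ?invr_ge0 ?(ltW (sig0 c)) //.
  rewrite -exprMn -[leLHS]real_normK ?num_real //.
  by apply: lerXn2r; rewrite ?nnegrE ?mulr_ge0 //; exact: dev_near.
rewrite exprMn -exprM; apply: ler_pM; rewrite ?exprn_ge0 //.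
  by apply: ler_weXn2l.
by apply: ler_weXn2l => //; rewrite -[12%N]/(2 * 6)%N leq_mul2l.
Qed.

Lemma all_pairs_drift (a : R) : (3 <= d)%N -> 0 < a <= 1 / 100 ->
  exists (sig : 'I_k -> 'I_k -> 'I_d -> R) K N0,
  [/\ forall i j c, 0 < sig i j c, 1 <= K &
  forall i j N A u, i != j -> (N0 <= N)%N -> iscan A ->
    u = K + \sum_c gap A i j c ^+ 2 / sig i j c ->
    Q (hit N (fun A' => (K + \sum_c gap A' i j c ^+ 2 / sig i j c) `^ (- a))) A <=
      u `^ (- a) * (1 - a / 20 / u)].
Proof.
move=> d3 a01.
have ex (x : 'I_k * 'I_k * 'I_d) : exists s : R * nat, 0 < s.1 /\ (x.1.1 != x.1.2 ->
    forall N, (s.2 <= N)%N ->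
    9 / 10 * s.1 <= Q (hit N (fun A => dev x.1.1 x.1.2 x.2 A ^+ 2)) can0 <= s.1).
  case: (eqVneq x.1.1 x.1.2) => [e|ne]; first by exists (1, 0%N).
  by have [s [N0 [s0 h]]] := var_lim x.2 ne; exists (s, N0).
have [s hs] := choice ex.
pose sig i j c := (s (i, j, c)).1; pose N0 := \max_x (s x).2.
have sig0 i j c : 0 < sig i j c by have [] := hs (i, j, c).
have exK (x : 'I_k * 'I_k) : exists K0 : R, 1 <= K0 /\ (x.1 != x.2 -> forall K N A u,
    K0 <= K -> (N0 <= N)%N -> iscan A ->
    u = K + \sum_c gap A x.1 x.2 c ^+ 2 / sig x.1 x.2 c ->
    Q (hit N (fun A' => (K + \sum_c gap A' x.1 x.2 c ^+ 2 / sig x.1 x.2 c) `^ (- a))) A <=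
      u `^ (- a) * (1 - a / 20 / u)).
  case: (eqVneq x.1 x.2) => [e|ne]; first by exists 1.
  have [|K0 K1 hK] := @pair_drift a (sig x.1 x.2) x.1 x.2 N0 d3 a01 (sig0 x.1 x.2).
    move=> c N NN; have [_ /(_ ne N)] := hs (x.1, x.2, c); apply.
    by apply: leq_trans NN; rewrite /N0 (leq_bigmax (x.1, x.2, c)).
  by exists K0.
have [K hK] := choice exK.
have K0 (x : 'I_k * 'I_k) : 0 <= K x by have [/(le_trans ler01)] := hK x.
have Kle (x : 'I_k * 'I_k) : K x <= \sum_x K x by rewrite (bigD1 x) //= lerDl sumr_ge0.
exists sig, (\sum_x K x), N0; split=> //.
  pose i0 : 'I_k := Ordinal k_gt0.
  by apply: le_trans (Kle (i0, i0)); have [] := hK (i0, i0).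
by move=> i j N A u ij NN cA uE; have [_ /(_ ij)] := hK (i, j); apply => //; exact: Kle.
Qed.

(** * The Lyapunov function *)

Definition rmin1 A : R := 1 + (rmin A)%:R.
Definition dmax1 A : R := 1 + (dmax A)%:R.

Lemma rmin1_ge1 A : 1 <= rmin1 A. Proof. by rewrite lerDl. Qed.
Lemma rmin1_gt0 A : 0 < rmin1 A. Proof. exact: lt_le_trans (rmin1_ge1 A). Qed.
Lemma dmax1_ge1 A : 1 <= dmax1 A. Proof. by rewrite lerDl. Qed.
Hint Resolve rmin1_ge1 rmin1_gt0 dmax1_ge1 : core.

(** A factor by which [rmin1] can at most shrink and [dmax1] at most grow in [t] steps, each of
    which moves sites by at most [m]. *)
Definition tfac (t : nat) : R := (2 * m + 1)%:R * t.+1%:R.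

Lemma tfac_ge (t : nat) : 1 + (2 * (m * t))%:R <= tfac t.
Proof. by rewrite /tfac -natrM -[1]/(1%:R) -natrD ler_nat; nia. Qed.

Lemma tfac_ge1 t : 1 <= tfac t.
Proof. by apply: le_trans (tfac_ge t); rewrite lerDl. Qed.

Lemma rmin1_near t A A' : wf A -> wf A' -> near t A A' -> rmin1 A <= rmin1 A' * tfac t.
Proof.
move=> wA wA' nA; apply: le_trans (ler_wpM2l (ltW (rmin1_gt0 A')) (tfac_ge t)).
have := near_rmin wA wA' nA; rewrite -(ler_nat R) natrD /rmin1.
have : 0 <= (rmin A')%:R :> R by []. have : 0 <= (2 * (m * t))%:R :> R by [].
by move: (_%:R) (_%:R) (_%:R) => x y z; nra.
Qed.

Lemma dmax1_near t A A' : near t A A' -> dmax1 A' <= dmax1 A * tfac t.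
Proof.
move=> nA; apply: le_trans (ler_wpM2l (le_trans ler01 (dmax1_ge1 A)) (tfac_ge t)).
have := near_dmax nA; rewrite -(ler_nat R) natrD /dmax1.
have : 0 <= (dmax A)%:R :> R by []. have : 0 <= (2 * (m * t))%:R :> R by [].
by move: (_%:R) (_%:R) (_%:R) => x y z; nra.
Qed.

Lemma rmin1_pow_near (s : R) t A A' : 0 <= s <= 3 -> wf A -> wf A' -> near t A A' ->
  rmin1 A' `^ (- s) <= rmin1 A `^ (- s) * tfac t ^+ 3.
Proof.
move=> /andP [s0 s3] wA wA' nA; have c1 := tfac_ge1 t; have c0 := lt_le_trans ltr01 c1.
apply: le_trans (_ : (rmin1 A / tfac t) `^ (- s) <= _).
  apply: gt0_powRN_anti => //; first by rewrite divr_gt0.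
  by rewrite ler_pdivrMr // rmin1_near.
rewrite powRM ?invr_ge0 ?(ltW c0) ?(ltW (rmin1_gt0 A)) // ler_wpM2l ?powR_ge0 //.
rewrite powR_inv_base ?(ltW c0) // opprK -powR_mulrn ?(ltW c0) //.
exact: ler_powR.
Qed.

Section Barrier.
Variables (a : R) (q : nat).
Hypothesis a01 : 0 < a <= 1 / 100.

(* The Lyapunov function [f] of [barrier] is comparable to [decay] for clusters of
   bounded diameter, and decreases by a multiple of [slack] in each step. *)
Definition decay A : R := rmin1 A `^ (- (2 * a)).
Definition slack A : R := dmax1 A ^+ q * rmin1 A `^ (- (2 + 2 * a)).

Lemma decay_gt0 A : 0 < decay A. Proof. exact: powR_gt0. Qed.
Lemma slack_gt0 A : 0 < slack A.
Proof. by rewrite mulr_gt0 ?powR_gt0 // exprn_gt0 // (lt_le_trans ltr01). Qed.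

Lemma decay_near t A A' : wf A -> wf A' -> near t A A' -> decay A' <= decay A * tfac t ^+ 3.
Proof.
by move=> wA wA' nA; apply: rmin1_pow_near => //; move/andP: a01 => []; lra.
Qed.

Lemma slack_near t A A' : wf A -> wf A' -> near t A A' ->
  slack A' <= slack A * (2 * m + 1)%:R ^+ (q + 3) * t.+1%:R ^+ (q + 3).
Proof.
move=> wA wA' nA; rewrite -mulrA -exprMn -/(tfac t) exprD.
have -> : slack A * (tfac t ^+ q * tfac t ^+ 3) =
   (dmax1 A * tfac t) ^+ q * (rmin1 A `^ (- (2 + 2 * a)) * tfac t ^+ 3) by rewrite /slack (exprMn q (dmax1 A) (tfac t)) mulrACA.
have t0 := le_trans ler01 (tfac_ge1 t); have d0 (B0 : cfg) := le_trans ler01 (dmax1_ge1 B0).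
apply: ler_pM; rewrite ?exprn_ge0 ?powR_ge0 //.
  by apply: lerXn2r; rewrite ?nnegrE ?mulr_ge0 //; exact: dmax1_near.
by apply: rmin1_pow_near => //; move/andP: a01 => []; lra.
Qed.

Lemma can_diam A : iscan A -> diamle total A.
Proof.
move=> /asboolP [p hA] i x y; rewrite hA => /line_in [l l1_ ->] /line_in [l' l1' ->].
rewrite opprD addrACA subrr add0r; apply: leq_trans (sz_total i).
have h (u v : nat) : (u <= v)%N -> (v < sz i)%N -> (l1 ((unitv (e0 d_gt0) *+ v : L) - unitv (e0 d_gt0) *+ u) <= sz i)%N.
  by move=> uv vs; rewrite -mulrnBr // l1_unitv (leq_trans (leq_subr _ _)) // ltnW.
by case: (leqP l l') => ll; [rewrite l1_sym; exact: h|apply: h => //; exact: ltnW].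
Qed.

Lemma can_slack A : iscan A -> slack A <= (1 + total%:R) ^+ q * rmin1 A `^ (- (2 + 2 * a)).
Proof.
move=> cA; rewrite ler_wpM2r ?powR_ge0 //; apply: lerXn2r; rewrite ?nnegrE ?(le_trans ler01) //.
  by rewrite lerDl.
by rewrite lerD2l ler_nat; apply: (dmaxP A).2; exact: can_diam.
Qed.

Lemma can_gap_coord A i j c x y : iscan A -> x \in A i -> y \in A j ->
  `|gap A i j c - ((x ord0 c)%:~R - (y ord0 c)%:~R)| <= (2 * total)%:R.
Proof.
move=> cA xi yj; apply: gap_avg => [|x' y' xi' yj']; first exact: wf_iscan.
have dA := can_diam cA.
have h1 : `|(x' ord0 c)%:~R - (x ord0 c)%:~R : R| <= total%:R.
  by apply: le_trans (norm_coordB _ _ _) _; rewrite ler_nat; exact: dA xi' xi.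
have h2 : `|(y' ord0 c)%:~R - (y ord0 c)%:~R : R| <= total%:R.
  by apply: le_trans (norm_coordB _ _ _) _; rewrite ler_nat; exact: dA yj' yj.
move: h1 h2; rewrite mul2n -addnn natrD; move: (x' _ _)%:~R (x _ _)%:~R (y' _ _)%:~R (y _ _)%:~R => u v w z.
by rewrite !ler_norml => /andP [? ?] /andP [? ?]; apply/andP; split; lra.
Qed.

Variables (K : R) (sig : 'I_k -> 'I_k -> 'I_d -> R) (N0 : nat).
Hypothesis sig_gt0 : forall i j c, 0 < sig i j c.
Hypothesis K1 : 1 <= K.

Definition energy i j A : R := K + \sum_c gap A i j c ^+ 2 / sig i j c.

Hypothesis drift : forall i j N A u, i != j -> (N0 <= N)%N -> iscan A -> u = energy i j A ->
  Q (hit N (fun A' => energy i j A' `^ (- a))) A <= u `^ (- a) * (1 - a / 20 / u).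

Lemma energy_sum_ge0 i j A : 0 <= \sum_c gap A i j c ^+ 2 / sig i j c.
Proof. by apply: sumr_ge0 => c _; rewrite divr_ge0 ?sqr_ge0 // ltW. Qed.

Lemma energy_ge1 i j A : 1 <= energy i j A.
Proof. by rewrite (le_trans K1) // lerDl energy_sum_ge0. Qed.

(** In a canonical configuration the gap of the barycentres differs by a bounded amount from the
    difference of any two sites, so no pair has an energy of smaller order than [rmin1 A ^+ 2]. *)
Lemma energy_lower : exists2 C : R, 1 <= C & forall i j A, i != j -> iscan A -> rmin1 A ^+ 2 <= C * energy i j A.
Proof.
pose S := \sum_i \sum_j \sum_c sig i j c; pose T : R := 1 + (2 * total * d)%:R.
have sS i j c : sig i j c <= S.
  have s0 i' j' : 0 <= \sum_c sig i' j' c by apply: sumr_ge0 => c' _; exact: ltW.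
  rewrite /S (bigD1 i) //= (bigD1 j) //= (bigD1 c) //= -!addrA lerDl.
  rewrite addr_ge0 //; first by apply: sumr_ge0 => c' _; exact: ltW.
  by rewrite addr_ge0 //; do 3?[apply: sumr_ge0 => ? _]; exact: ltW.
have S0 : 0 <= S.
  by apply: sumr_ge0 => i _; apply: sumr_ge0 => j _; apply: sumr_ge0 => c _; exact: ltW.
have T1 : 1 <= T by rewrite lerDl.
have T2 : 1 <= T ^+ 2 by exact: exprn_ege1.
exists (2 * T ^+ 2 + 2 * (d%:R * S)).
  have : 0 <= d%:R * S by rewrite mulr_ge0.
  by move: T2; lra.
move=> i j A ij cA; have wA := wf_iscan cA.
have [x xi] := wf_in i wA; have [y yj] := wf_in j wA.
have h1 : rmin1 A <= T + \sum_c `|gap A i j c|.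
  rewrite /rmin1 /T -addrA lerD2l; apply: le_trans (_ : (l1 (x - y))%:R <= _).
    by rewrite ler_nat; exact: (rminP wA).1 ij _ _ xi yj.
  rewrite /l1 natr_sum; apply: le_trans (_ : \sum_(c < d) ((2 * total)%:R + `|gap A i j c|) <= _).
    apply: ler_sum => c _; have := can_gap_coord c cA xi yj.
    have -> : (absz ((x - y)%R ord0 c))%:R = `|(x ord0 c)%:~R - (y ord0 c)%:~R : R|.
      by rewrite natr_absz intr_norm !mxE rmorphB.
    move: (gap A i j c) ((x ord0 c)%:~R - (y ord0 c)%:~R) => h w hw.
    by have := ler_normD (w - h) h; rewrite subrK distrC; move: hw; lra.
  by rewrite big_split /= sumr_const card_ord -[_ *+ d]mulr_natr -natrM.
have h2 : (\sum_c `|gap A i j c|) ^+ 2 <= d%:R * S * \sum_c gap A i j c ^+ 2 / sig i j c.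
  apply: le_trans (sqr_sum_le _) _; rewrite -mulrA ler_wpM2l // mulr_sumr.
  apply: ler_sum => c _; rewrite real_normK ?num_real // mulrCA ler_peMr ?sqr_ge0 //.
  by rewrite ler_pdivlMr // mul1r.
have h3 : rmin1 A ^+ 2 <= (T + \sum_c `|gap A i j c|) ^+ 2.
  apply: lerXn2r => //; rewrite nnegrE ?(ltW (rmin1_gt0 A)) //.
  by rewrite addr_ge0 ?(le_trans ler01 T1) // sumr_ge0.
apply: le_trans h3 _; rewrite /energy; have := energy_sum_ge0 i j A; move: h2 K1 T2 (mulr_ge0 (ler0n R d) S0).
have := sqr_ge0 (T - \sum_c `|gap A i j c|).
move: (\sum_c `|_|) (\sum_c _ / _) (d%:R * S) => u w v.
move=> e1 e2 e3 e4 e5 e6.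
have e7 : 0 <= T ^+ 2 * (K - 1) by rewrite mulr_ge0 ?sqr_ge0 // subr_ge0.
have e8 : 0 <= T ^+ 2 * w by rewrite mulr_ge0 ?sqr_ge0.
have e9 : 0 <= v * K by rewrite mulr_ge0 // (le_trans ler01).
move: e1 e2 e7 e8 e9; lra.
Qed.

(** The pair realising [rmin] has energy of this order; it alone determines the order of the
    potential. *)
Lemma energy_upper : exists2 C : R, 1 <= C & forall A, iscan A ->
  exists i j, i != j /\ energy i j A <= C * rmin1 A ^+ 2.
Proof.
pose T : R := 1 + (2 * total)%:R; pose S := \sum_i \sum_j \sum_c (sig i j c)^-1.
have sS i j : \sum_c (sig i j c)^-1 <= S.
  have s0 i' j' : 0 <= \sum_c (sig i' j' c)^-1 by apply: sumr_ge0 => c' _; rewrite invr_ge0 ltW.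
  rewrite /S (bigD1 i) //= (bigD1 j) //= -!addrA lerDl.
  by rewrite addr_ge0 //; do 3?[apply: sumr_ge0 => ? _]; rewrite invr_ge0 ltW.
have S0 : 0 <= S.
  apply: sumr_ge0 => i _; apply: sumr_ge0 => j _; apply: sumr_ge0 => c _.
  by rewrite invr_ge0 ltW.
exists (K + T ^+ 2 * S); first by rewrite (le_trans K1) // lerDl mulr_ge0 ?sqr_ge0.
move=> A cA; have wA := wf_iscan cA; have [_ [i [j [x [y [ij xi yj xy]]]]]] := rminP wA.
exists i, j; split=> //; rewrite /energy mulrDl; apply: lerD.
  by rewrite ler_peMr ?(le_trans ler01 K1) // exprn_ege1.
apply: le_trans (_ : \sum_c (T * rmin1 A) ^+ 2 * (sig i j c)^-1 <= _).
  apply: ler_sum => c _; rewrite ler_wpM2r ?invr_ge0 ?(ltW (sig_gt0 _ _ _)) //.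
  rewrite -[leLHS]real_normK ?num_real //.
  have T0 : 0 <= T by rewrite addr_ge0.
  apply: lerXn2r; rewrite ?nnegrE ?mulr_ge0 ?(ltW (rmin1_gt0 A)) //.
  have := can_gap_coord c cA xi yj; have := norm_coordB x y c; rewrite xy => h1 h2.
  have h3 : `|gap A i j c| <= (rmin A)%:R + (2 * total)%:R.
    rewrite -[gap A i j c](subrK ((x ord0 c)%:~R - (y ord0 c)%:~R)) addrC.
    exact: le_trans (ler_normD _ _) (lerD h1 h2).
  apply: le_trans h3 _; rewrite /T /rmin1.
  have : 0 <= (rmin A)%:R :> R by []. have : 0 <= (2 * total)%:R :> R by [].
  by move: (_%:R) (_%:R) => u v; nra.
by rewrite -mulr_sumr exprMn mulrAC ler_wpM2r ?sqr_ge0 // ler_wpM2l ?sqr_ge0.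
Qed.

Definition potential A : R := \sum_i \sum_(j | j != i) energy i j A `^ (- a).

Lemma potential_ge0 A : 0 <= potential A.
Proof. by apply: sumr_ge0 => i _; apply: sumr_ge0 => j _; exact: powR_ge0. Qed.

Lemma sqr_powR (x s : R) : 0 <= x -> (x ^+ 2) `^ s = x `^ (2 * s).
Proof. by move=> x0; rewrite -powR_mulrn // -powRrM. Qed.

Lemma potential_upper : exists2 C : R, 0 < C & forall A, iscan A -> potential A <= C * decay A.
Proof.
have /andP [a0 _] := a01; have [C C1 hC] := energy_lower; have C0 := lt_le_trans ltr01 C1.
exists (\sum_(i < k) \sum_(j < k) C `^ a).
  pose i0 : 'I_k := Ordinal k_gt0.
  rewrite (bigD1 i0) //= (bigD1 i0) //= -addrA ltr_pwDl ?powR_gt0 //.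
  by repeat first [exact: powR_ge0|apply: sumr_ge0 => ? _|apply: addr_ge0].
move=> A cA; rewrite mulr_suml; apply: ler_sum => i _; rewrite mulr_suml.
rewrite big_mkcond; apply: ler_sum => j _; case: ifP => ji; last by rewrite mulr_ge0 ?powR_ge0.
have rr0 := ltW (rmin1_gt0 A).
apply: le_trans (_ : (C^-1 * rmin1 A ^+ 2) `^ (- a) <= _).
  apply: gt0_powRN_anti; [exact: ltW|by rewrite mulr_gt0 ?invr_gt0 ?exprn_gt0|].
  by rewrite ler_pdivrMl //; apply: hC => //; rewrite eq_sym.
rewrite powRM ?invr_ge0 ?sqr_ge0 ?(ltW C0) // powR_inv_base ?(ltW C0) // opprK.
by rewrite sqr_powR // mulrN.
Qed.

Lemma energy_min_pow (s C : R) A : 0 <= s -> 1 <= C -> (exists i j, i != j /\ energy i j A <= C * rmin1 A ^+ 2) ->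
  C `^ (- s) * rmin1 A `^ (- (2 * s)) <= \sum_i \sum_(j | j != i) energy i j A `^ (- s).
Proof.
move=> s0 C1 [i [j [ij h]]]; have C0 := lt_le_trans ltr01 C1.
have u0 : 0 < energy i j A by apply: lt_le_trans (energy_ge1 i j A).
rewrite (bigD1 i) //= (bigD1 j) ?(eq_sym j) //= -addrA; apply: ler_wpDr.
  by repeat first [exact: powR_ge0|apply: sumr_ge0 => ? _|apply: addr_ge0].
apply: le_trans (gt0_powRN_anti s0 u0 h).
by rewrite powRM ?sqr_ge0 ?(ltW C0) // sqr_powR ?(ltW (rmin1_gt0 A)) // mulrN.
Qed.

Lemma potential_lower : exists2 c : R, 0 < c & forall A, iscan A -> c * decay A <= potential A.
Proof.
have /andP [a0 _] := a01; have [C C1 hC] := energy_upper.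
exists (C `^ (- a)); first by rewrite powR_gt0 // (lt_le_trans ltr01).
by move=> A cA; apply: energy_min_pow => //; [exact: ltW|exact: hC].
Qed.

(** Every pair loses [a / 20] times its energy to the power [- (1 + a)]; the loss of a closest pair
    already has the required order. *)
Lemma potential_drift : exists2 c : R, 0 < c & forall A N, iscan A -> (N0 <= N)%N ->
  Q (hit N potential) A <= potential A - c * rmin1 A `^ (- (2 + 2 * a)).
Proof.
have /andP [a0 _] := a01; have [C C1 hC] := energy_upper.
exists (a / 20 * C `^ (- (1 + a))); first by rewrite mulr_gt0 ?divr_gt0 // powR_gt0 // (lt_le_trans ltr01).
move=> A N cA NN.
have E : Q (hit N potential) A = \sum_i \sum_(j | j != i) Q (hit N (fun A' => energy i j A' `^ (- a))) A.
  pose pairs := [seq p <- index_enum (('I_k * 'I_k)%type : finType) | p.2 != p.1].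
  have fE (G : 'I_k -> 'I_k -> R) : \sum_i \sum_(j | j != i) G i j = \sum_(p <- pairs) 1 * G p.1 p.2.
    rewrite pair_big_dep /= big_filter; apply: eq_bigr => p _; by rewrite mul1r.
  rewrite fE -(Q_sum pairs (fun=> 1) (fun p => hit N (fun A' => energy p.1 p.2 A' `^ (- a)))).
  congr Q; apply: funext => A'.
  rewrite -(hit_sum N pairs (fun=> 1) (fun p A' => energy p.1 p.2 A' `^ (- a))).
  by congr hit; apply: funext => A''; rewrite /potential fE.
rewrite E; apply: le_trans (_ : \sum_i \sum_(j | j != i)
    (energy i j A `^ (- a) - a / 20 * energy i j A `^ (- (1 + a))) <= _).
  apply: ler_sum => i _; apply: ler_sum => j ji.
  apply: le_trans (drift _ NN cA erefl) _; first by rewrite eq_sym.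
  have u0 : 0 < energy i j A by apply: lt_le_trans (energy_ge1 i j A).
  rewrite mulrBr mulr1 lerD2l lerN2 opprD powRD; last by rewrite (gt_eqF u0) implybT.
  by rewrite powR_inv1 ?(ltW u0) // [leRHS]mulrC -[leRHS]mulrA.
under eq_bigr do rewrite sumrB.
rewrite sumrB lerD2l lerN2.
under eq_bigr do rewrite -mulr_sumr.
rewrite -mulr_sumr -[leLHS]mulrA ler_wpM2l ?divr_ge0 ?(ltW a0) //.
have -> : 2 + 2 * a = 2 * (1 + a) by ring.
by apply: energy_min_pow => //; [by move: a0; lra|exact: hC].
Qed.

(** This keeps [decay] from dropping too far before the stopping time. The diameters enter because
    the sites realising [rmin] may have been moved. *)
Lemma near_rmin_up t A A' : wf A -> wf A' -> near t A A' ->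
  (rmin A' <= rmin A + 2 * dmax A + 2 * (m * t))%N.
Proof.
have ar (u v w : nat) : (v + w + (u + (w + v)) <= u + 2 * w + 2 * v)%N by lia.
move=> wA wA' nA; have [_ [i [j [x [y [ij xi yj <-]]]]]] := rminP wA.
have [x' xi'] := wf_in i wA'; have [y' yj'] := wf_in j wA'.
have [x1 x1i xx1] := nA _ _ xi'; have [y1 y1j yy1] := nA _ _ yj'.
have h := (rminP wA').1 _ _ ij _ _ xi' yj'; apply: leq_trans h _.
have h1 := (dmaxP A).1 _ _ _ x1i xi; have h2 := (dmaxP A).1 _ _ _ yj y1j.
have h3 : (l1 (x' - x) <= m * t + dmax A)%N.
  by apply: leq_trans (l1_tri x1 _ _) (leq_add xx1 h1).
have h4 : (l1 (y - y') <= dmax A + m * t)%N.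
  by apply: leq_trans (l1_tri y1 _ _) _; apply: leq_add h2 _; rewrite l1_sym.
have h5 := leq_trans (l1_tri x x' y') (leq_add h3 (l1_tri y x y')).
apply: leq_trans h5 _; apply: leq_trans (leq_add (leqnn _) (leq_add (leqnn _) h4)) _.
exact: ar.
Qed.

(* [f] is the expected potential at the first canonical configuration plus the
   expected total of [g] until then. The cost [g] pays for the decrease at
   noncanonical times, and is so small that its total is absorbed by the drift of
   the potential at canonical times. *)
Lemma barrier_aux : (2 < q)%N -> exists f (c C : R), [/\ 0 < c, 0 < C & forall A, wf A ->
  [/\ c * decay A <= f A, f A <= C * (decay A + slack A), Q f A <= f A - c * slack A & slack A <= C * (1 + f A)]].
Proof.
move=> q3; have /andP [a0 a1] := a01.
have [Cu Cu0 hCu] := potential_upper; have [cl cl0 hcl] := potential_lower; have [cd cd0 hcd] := potential_drift.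
have [Mh Mh0 hMh] := hit_poly 3; have [Mc Mc0 hMc] := cost_poly (q + 3).
have [Mq Mq0 hMq] := Qcost_poly (q + 3).
pose b : R := (2 * m + 1)%:R; have b1 : 1 <= b by rewrite /b ler1n addn1.
pose T : R := (1 + total%:R) ^+ q; have T1 : 1 <= T by rewrite exprn_ege1 // lerDl.
(* [Z] bounds the expected total of [slack] after one step until the next canonical time, relative
   to [rmin1 A ^ (- (2 + 2 a))]; [kap] is chosen so small that the cost uses at most half of the
   drift. The power of 2 comes from [t.+2 <= 2 * t.+1], one step having been made already. *)
pose Z := T * b ^+ (q + 3) * 2 ^+ (q + 3) * Mq.
have b0 := le_trans ler01 b1; have T0 := le_trans ler01 T1.
have Z0 : 0 <= Z by rewrite !mulr_ge0 ?exprn_ge0.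
have rg (p z u v w x : R) : p * (z * v * w * x) * u = p * (z * u) * v * w * x by ring.
have [kap kap0 kapE] : exists2 kap : R, 0 < kap & kap * Z <= cd / 2.
  have Z2 : 0 < 2 * (1 + Z) by rewrite mulr_gt0 // ltr_pwDl.
  exists (cd / (2 * (1 + Z))); first by rewrite divr_gt0.
  by rewrite mulrAC ler_pdivrMr //; move: cd0 Z0; nra.
pose g A := kap * slack A; have g0 A : 0 <= g A by rewrite mulr_ge0 ?ltW // slack_gt0.
pose fN N A := hit N potential A + cost N g A.
have fmono A : wf A -> nondecreasing_seq (fN^~ A).
  move=> wA; apply/nondecreasing_seqP => N; apply: lerD.
    by apply: hit_mono => // A'; exact: potential_ge0.
  exact: cost_mono.
pose C1 := Cu * b ^+ 3 * Mh; pose C2 := kap * b ^+ (q + 3) * Mc.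
have C10 : 0 <= C1 by rewrite !mulr_ge0 ?exprn_ge0 // ltW.
have C20 : 0 <= C2 by rewrite !mulr_ge0 ?exprn_ge0 // ltW.
have fup N A : wf A -> fN N A <= (C1 + C2) * (decay A + slack A).
  move=> wA; have y0 := ltW (decay_gt0 A); have x0 := ltW (slack_gt0 A).
  apply: le_trans (_ : C1 * decay A + C2 * slack A <= _); last first.
    by rewrite mulrDl !mulrDr; move: (mulr_ge0 C10 x0) (mulr_ge0 C20 y0); lra.
  apply: lerD.
    have -> : C1 * decay A = Cu * decay A * b ^+ 3 * Mh by rewrite /C1; ring.
    apply: hMh => //; first by rewrite !mulr_ge0 ?exprn_ge0 // ltW.
    move=> t A' wA' cA' nA'; apply: le_trans (hCu _ cA') _.
    have -> : Cu * decay A * b ^+ 3 * t.+1%:R ^+ 3 = Cu * (decay A * tfac t ^+ 3).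
      by rewrite /tfac -/b exprMn; ring.
    by rewrite ler_wpM2l ?(ltW Cu0) //; exact: decay_near.
  have -> : C2 * slack A = kap * slack A * b ^+ (q + 3) * Mc by rewrite /C2; ring.
  apply: hMc => //; first by rewrite mulr_ge0 ?exprn_ge0 // mulr_ge0 // ltW.
  move=> t A' wA' nA'; rewrite /g.
  have -> : kap * slack A * b ^+ (q + 3) * t.+1%:R ^+ (q + 3) =
    kap * (slack A * b ^+ (q + 3) * t.+1%:R ^+ (q + 3)) by ring.
  by rewrite ler_wpM2l ?(ltW kap0) //; exact: slack_near.
have fcv A : wf A -> cvgn (fN^~ A).
  move=> wA; apply: nondecreasing_is_cvgn; first exact: fmono.
  by exists ((C1 + C2) * (decay A + slack A)) => _ [N _ <-]; exact: fup.
(* The truncations increase and are bounded, so the limit exists; it turns the recursion of [fN]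
   into an identity for [f] at noncanonical configurations. *)
pose f A := limn (fN^~ A).
have fle N A : wf A -> fN N A <= f A.
  by move=> wA; apply: nondecreasing_cvgn_le; [exact: fmono|exact: fcv].
have Qcv A : wf A -> Q (fN n) A @[n --> \oo] --> Q f A.
  by move=> wA; apply: Q_cvg => // A' wA'; exact: fcv.
have QfN N A : Q (fN N) A = Q (hit N potential) A + Q (cost N g) A by exact: QD.
have noncan A : wf A -> ~~ iscan A -> f A = g A + Q f A.
  move=> wA cA; have h : fN n.+1 A @[n --> \oo] --> g A + Q f A.
    apply: cvg_trans (cvgD (cvg_cst (g A)) (Qcv A wA)); apply: near_eq_cvg; near=> n.
    transitivity (g A + Q (fN n) A); first reflexivity.
    by rewrite QfN {1}/fN /= (negPf cA) addrCA.
  have h2 : fN n.+1 A @[n --> \oo] --> f A by rewrite (cvg_shiftS (fN^~ A)); exact: fcv.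
  exact: cvg_unique h2 h.
have canf A : iscan A -> potential A <= f A.
  by move=> cA; apply: le_trans (fle 1%N A (wf_iscan cA)); rewrite /fN /= cA addr0.
have gf A : wf A -> ~~ iscan A -> g A <= f A.
  move=> wA cA; apply: le_trans (fle 1%N A wA); rewrite /fN /= (negPf cA).
  have -> : Q (hit 0%N potential) A = 0 by exact: Q_cst.
  by rewrite add0r addr0.
have [Kd [eta [/andP [eta0 eta1] hK]]] := doeblin.
pose V : R := 1 + 2 * (1 + total%:R) + tfac Kd.
have tf0 := le_trans ler01 (tfac_ge1 Kd); have V1 : 1 <= V by rewrite /V -addrA lerDl addr_ge0 // mulr_ge0 // addr_ge0.
pose c1 := cl * V `^ (- (2 * a)) * (1 - eta).
have c10 : 0 < c1 by rewrite !mulr_gt0 ?powR_gt0 ?subr_gt0 // (lt_le_trans ltr01).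
(* With probability at least [1 - eta] a canonical configuration occurs within [Kd] steps; if the
   diameter is not too large, [rmin1] has grown by then at most by the factor [V]. *)
have lowE A : wf A -> dmax1 A <= (1 + total%:R) * rmin1 A -> c1 * decay A <= f A.
  move=> wA hdd; apply: le_trans (fle Kd A wA); apply: ler_wpDr; first exact: cost_ge0.
  have e : c1 * decay A = cl * V `^ (- (2 * a)) * decay A * (1 - eta) by rewrite /c1; ring.
  rewrite e; pose c' := cl * V `^ (- (2 * a)) * decay A.
  have c'0 : 0 <= c' by rewrite !mulr_ge0 ?powR_ge0 // ltW.
  apply: le_trans (_ : c' * hit Kd (fun=> 1) A <= _).
    by apply: ler_wpM2l => //; rewrite lerBlDr -[leLHS](hit_surv Kd wA) lerD2l hK.
  apply: hit_lower => // t A' wA' cA' tK nA; apply: le_trans (hcl A' cA').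
  rewrite /c' -mulrA ler_wpM2l ?(ltW cl0) // /decay -powRM ?(ltW (rmin1_gt0 _)) ?(le_trans ler01 V1) //.
  apply: gt0_powRN_anti => //; first by rewrite mulr_ge0 // ltW.
  apply: le_trans (_ : rmin1 A + 2 * dmax1 A + tfac Kd <= _); last first.
    by rewrite /V; move: (rmin1_ge1 A) tf0 hdd (ler0n R total); nra.
  have h1 := near_rmin_up wA wA' nA.
  have h2 : tfac t <= tfac Kd by rewrite /tfac ler_wpM2l // ler_nat ltnS ltnW.
  apply: le_trans (lerD (lexx _) h2); apply: le_trans (lerD (lexx _) (tfac_ge t)).
  by move: h1; rewrite -(ler_nat R) !natrD natrM /rmin1 /dmax1; lra.
(* If the diameter exceeds that bound, [A] is not canonical and the cost at [A] suffices:
   [slack A >= decay A], because [dmax1 A >= rmin1 A] and [q >= 2]. *)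
have low : exists2 c2 : R, 0 < c2 & forall A, wf A -> c2 * decay A <= f A.
  exists (Num.min c1 kap); first by rewrite lt_min c10.
  move=> A wA; have y0 := ltW (decay_gt0 A).
  have [h|h] := leP (dmax1 A) ((1 + total%:R) * rmin1 A).
    by apply: le_trans (lowE A wA h); rewrite ler_wpM2r // ge_min lexx.
  have cA : ~~ iscan A.
    apply/negP => cA; move: h; rewrite ltNge => /negP; apply.
    apply: le_trans (_ : 1 + total%:R <= _); last by rewrite ler_peMr.
    by rewrite lerD2l ler_nat; apply: (dmaxP A).2; exact: can_diam.
  apply: le_trans (gf A wA cA); rewrite /g; apply: ler_pM => //; first by rewrite le_min !ltW.
    by rewrite ge_min lexx orbT.
  have hr : rmin1 A <= dmax1 A by apply: le_trans (ltW h); rewrite ler_peMl ?(ltW (rmin1_gt0 A)) // lerDl.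
  rewrite /slack opprD powRD; last by rewrite (gt_eqF (rmin1_gt0 A)) implybT.
  rewrite mulrA ler_peMl //; have r0 := ltW (rmin1_gt0 A).
  rewrite powRN powR_mulrn // ler_pdivlMr ?exprn_gt0 // mul1r.
  apply: le_trans (_ : dmax1 A ^+ 2 <= _); first by apply: lerXn2r => //; rewrite nnegrE // (le_trans r0).
  by apply: ler_weXn2l => //; exact: ltnW.
have [c2 c20 hc2] := low.
pose c3 := Num.min c2 (Num.min kap (cd / 2 / T)).
have cd2 : 0 < cd / 2 / T by rewrite !divr_gt0 // (lt_le_trans ltr01).
have T00 : 0 < T by apply: lt_le_trans T1.
have f0 A : wf A -> 0 <= f A.
  by move=> wA; apply: le_trans (hc2 A wA); rewrite mulr_ge0 // ltW // decay_gt0.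
exists f, c3, (1 + C1 + C2 + kap^-1 + T); split.
- by rewrite !lt_min c20 kap0.
- by rewrite -!addrA ltr_pwDl // !addr_ge0 // invr_ge0 ltW.
move=> A wA; have y0 := ltW (decay_gt0 A); have x0 := ltW (slack_gt0 A).
have ik : 0 <= kap^-1 by rewrite invr_ge0 ltW.
split.
- by apply: le_trans (hc2 A wA); rewrite ler_wpM2r // ge_min lexx.
- apply: le_trans (_ : (C1 + C2) * (decay A + slack A) <= _).
    apply: limr_le; first exact: fcv.
    by near=> n; exact: fup.
  by rewrite ler_wpM2r ?addr_ge0 //; move: ik T0; lra.
- have [cA|cA] := boolP (iscan A); last first.
    have h : c3 * slack A <= g A by rewrite /g ler_wpM2r // !ge_min lexx !orbT.
    by have := noncan A wA cA; move: h; move: (c3 * _) (g A) (f A) (Q _ _) => u v w z; lra.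
  (* At a canonical configuration half of the drift pays for the expected cost up to the next one;
     the other half remains as the loss. *)
  apply: le_trans (_ : potential A - cd / 2 * rmin1 A `^ (- (2 + 2 * a)) <= _).
    have Ql : limn (fun n => Q (fN n) A) = Q f A by apply/cvg_lim; [exact: Rhausdorff|exact: Qcv].
    rewrite -Ql; apply: limr_le; first by apply/cvg_ex; exists (Q f A); exact: Qcv.
    near=> n; rewrite QfN.
    have h1 : Q (hit n potential) A <= potential A - cd * rmin1 A `^ (- (2 + 2 * a)).
      by apply: hcd => //; near: n; exact: nbhs_infty_ge.
    have h2 : Q (cost n g) A <= cd / 2 * rmin1 A `^ (- (2 + 2 * a)).
      apply: le_trans (_ : kap * slack A * b ^+ (q + 3) * 2 ^+ (q + 3) * Mq <= _).
        apply: hMq => //.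
          by rewrite mulr_ge0 ?exprn_ge0 // mulr_ge0 ?exprn_ge0 // mulr_ge0 // ltW.
        move=> t A' wA' nA'; rewrite /g.
        have -> : kap * slack A * b ^+ (q + 3) * 2 ^+ (q + 3) * t.+1%:R ^+ (q + 3) =
          kap * (slack A * b ^+ (q + 3) * (2 ^+ (q + 3) * t.+1%:R ^+ (q + 3))).
          by move: (slack A) (b ^+ _) (2 ^+ _) (t.+1%:R ^+ _) => u v w z; ring.
        rewrite ler_wpM2l ?(ltW kap0) //; apply: le_trans (slack_near wA wA' nA') _.
        apply: ler_wpM2l; first by rewrite mulr_ge0 ?exprn_ge0.
        rewrite -exprMn.
        apply: lerXn2r; rewrite ?nnegrE ?mulr_ge0 // -natrM ler_nat.
        by rewrite mul2n -addnn addSn addnS !ltnS leq_addr.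
      apply: le_trans (_ : kap * Z * rmin1 A `^ (- (2 + 2 * a)) <= _).
        have -> : kap * Z * rmin1 A `^ (- (2 + 2 * a)) =
          kap * (T * rmin1 A `^ (- (2 + 2 * a))) * b ^+ (q + 3) * 2 ^+ (q + 3) * Mq.
          by rewrite /Z; exact: rg.
        do 3!(apply: ler_wpM2r; first by rewrite ?exprn_ge0).
        by rewrite ler_wpM2l ?(ltW kap0) //; exact: can_slack.
      by rewrite ler_wpM2r ?powR_ge0.
    by apply: le_trans (lerD h1 h2) _; move: (rmin1 A `^ _) => w; lra.
  apply: lerD; first exact: canf.
  rewrite lerN2; apply: le_trans (_ : cd / 2 / T * slack A <= _).
    by rewrite ler_wpM2r // !ge_min lexx !orbT.
  rewrite mulrAC ler_pdivrMr // -[leRHS]mulrA ler_wpM2l ?divr_ge0 ?(ltW cd0) //.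
  by rewrite [leRHS]mulrC; exact: can_slack.
have fA := f0 A wA.
have [cA|cA] := boolP (iscan A).
  apply: le_trans (can_slack cA) _; apply: le_trans (_ : T <= _).
    rewrite ler_piMr //; apply: le_trans (_ : 1 `^ (- (2 + 2 * a)) <= _).
      by apply: gt0_powRN_anti => //; move: a0; lra.
    by rewrite powR1.
  rewrite mulrDr mulr1; apply: ler_wpDr; last by move: C10 C20 ik; lra.
  by rewrite mulr_ge0 //; move: C10 C20 ik T0; lra.
apply: le_trans (_ : kap^-1 * f A <= _).
  by rewrite mulrC ler_pdivlMr // mulrC; exact: gf.
by move: C10 C20 ik T0 fA; nra.
Unshelve. all: by end_near.
Qed.

End Barrier.

Lemma barrier (a : R) q : (3 <= d)%N -> (2 < q)%N -> 0 < a <= 1 / 100 ->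
  exists f (c C : R), [/\ 0 < c, 0 < C & forall A, wf A ->
  [/\ c * decay a A <= f A, f A <= C * (decay a A + slack a q A), Q f A <= f A - c * slack a q A &
      slack a q A <= C * (1 + f A)]].
Proof.
move=> d3 q3 a01; have [sig [K [N0 [sig0 K1 drift]]]] := all_pairs_drift d3 a01.
exact: (barrier_aux a01 sig0 K1 drift q3).
Qed.

(** * Survival of well separated clusters *)

(** The exponents compare as [beta <= q] for the diameter and [2 + 2 * a <= beta] for the distance;
    [beta > 2] leaves room for a positive [a]. *)
Lemma interaction_slack (a : R) q : 2 + 2 * a <= beta <= q%:R -> exists2 Ci : R, 0 <= Ci &
  forall A, interaction (rmin A) (dmax A) <= Ci * slack a q A.
Proof.
move=> /andP [b1 b2]; pose B : R := (d.+1 * m.+3 * (2 * m + 2))%:R.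
exists ((2 * m)%:R * ((4 * d * total)%:R * B `^ beta)).
  by rewrite !mulr_ge0 // powR_ge0.
move=> A; rewrite /interaction -!mulrA ler_wpM2l // ler_wpM2l //.
have r0 := ltW (rmin1_gt0 A); have d0 := le_trans ler01 (dmax1_ge1 A).
rewrite -/(rmin1 A) -/(dmax1 A) powRM ?mulr_ge0 ?invr_ge0 // ler_wpM2l ?powR_ge0 //.
rewrite powRM ?invr_ge0 // /slack; apply: ler_pM; rewrite ?powR_ge0 //.
  by rewrite -powR_mulrn //; apply: ler_powR.
by rewrite powR_inv_base //; apply: ler_powR => //; rewrite lerN2.
Qed.

Lemma rmin_diam A : wf A -> (rmin A)%:R <= d%:R * diam R (union A).
Proof.
move=> wA; have [_ [i [j [x [y [ij xi yj <-]]]]]] := rminP wA.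
apply: le_trans (l1_le_enorm R (x - y)) _; rewrite ler_wpM2l //.
have xU : x \in union A by apply/unionP; exists i.
have yU : y \in union A by apply/unionP; exists j.
apply: sup_upper_bound; last by exists x, y.
split; first by exists (enorm R (x - y)), x, y.
exists (\sum_(u <- union A) \sum_(v <- union A) enorm R (u - v)) => _ [u [v [uU vU ->]]].
rewrite (big_fsetD1 u) //= (big_fsetD1 v) //= -addrA lerDl.
have e0 w : 0 <= enorm R (w : L) by exact: sqrtr_ge0.
by rewrite addr_ge0 // sumr_ge0 // => w _; rewrite sumr_ge0.
Qed.

Definition spread (delta : R) (t : nat) C : bool :=
  `[< t%:R `^ (2^-1 - delta) <= diam R C >].

(** By induction on [N], [kill N t] is at most [W t = w t * f + e t]. Where [W t >= 1] there is
    nothing to show; where [W t < 1], the clusters are so far apart that [ok] holds and the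
    comparison with [Q] applies, the interaction being absorbed by half of the loss of [f]. *)
Lemma survival (delta : R) (D0 : nat) : (3 <= d)%N -> 2 < beta -> 0 < delta < 2^-1 ->
  exists r0 : nat, forall A N, wf A -> sep r0 A -> diamle D0 A ->
  kill m beta (spread delta) N 0%N (union A) <= 2^-1.
Proof.
move=> d3 b2 hdelta; have /andP [de0 de1] := hdelta; set ok := spread delta.
have q4 : 4^-1 + 4^-1 <= 2^-1 :> R by lra.
have E4 (v : R) : 0 <= v -> v <= 4^-1 * (4 * v + 1) by lra.
have [a a01 ab] : exists2 a : R, 0 < a <= 1 / 100 & 2 + 2 * a <= beta.
  exists (Num.min (1 / 100) ((beta - 2) / 2)).
    rewrite ge_min lexx lt_min; apply/andP; split=> //; apply/andP; split; first lra.
    by rewrite divr_gt0 // subr_gt0.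
  have : Num.min (1 / 100) ((beta - 2) / 2) <= (beta - 2) / 2 by rewrite ge_min lexx orbT.
  by move: (Num.min _ _) => v; lra.
have /andP [a0 a1] := a01.
have [q q3 bq] : exists2 q, (2 < q)%N & beta <= q%:R.
  exists (Num.bound beta + 3)%N; first by rewrite addnC.
  by rewrite natrD; have := archi_boundP beta_ge0; lra.
have [Ci Ci0 hCi] := @interaction_slack a q (introT andP (conj ab bq)).
have [f [c [C [c0 C0 hf]]]] := barrier d3 q3 a01.
have fge A : wf A -> 0 <= f A.
  by move=> /hf [h _ _ _]; apply: le_trans h; rewrite mulr_ge0 // ltW // decay_gt0.
have pw1 (v : R) : 1 `^ v = 1 by rewrite powR1.
pose s := 1 + a^-1; have s0 : 0 < s by rewrite ltr_wpDl // invr_gt0.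
pose X1 := (2 * C) `^ a^-1; pose C3 := (2 * C) `^ s * (1 + X1).
have X10 : 0 <= X1 by exact: powR_ge0.
have C30 : 0 < C3 by rewrite mulr_gt0 ?powR_gt0 ?mulr_gt0 // ltr_pwDl.
(* [decay] to the power [1 + 1 / a] is [rmin1 ^ (- (2 + 2 a))], hence at most [slack]; this brings
   the loss into the form that [time_weights] requires. *)
have fpow A : wf A -> f A <= 1 -> f A `^ s <= C3 * slack a q A.
  move=> wA f1; have [_ h1 _ h2] := hf A wA.
  have x0 := slack_gt0 a q A; have y0 := decay_gt0 a A.
  have x2C : slack a q A <= 2 * C.
    by apply: le_trans h2 _; rewrite mulrC ler_pM2r //; move: f1; lra.
  have mx0 : 0 <= Num.max (decay a A) (slack a q A) by rewrite le_max (ltW x0) orbT.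
  have h3 : f A <= 2 * C * Num.max (decay a A) (slack a q A).
    apply: le_trans h1 _; rewrite (mulrC 2 C) -[leRHS]mulrA ler_wpM2l ?(ltW C0) //.
    have : decay a A <= Num.max (decay a A) (slack a q A) by rewrite le_max lexx.
    have : slack a q A <= Num.max (decay a A) (slack a q A) by rewrite le_max lexx orbT.
    by move: (Num.max _ _) => w; lra.
  apply: le_trans (_ : (2 * C * Num.max (decay a A) (slack a q A)) `^ s <= _).
    by apply: ge0_ler_powR; rewrite ?nnegrE ?(ltW s0) ?fge // mulr_ge0 // mulr_ge0 // ltW.
  rewrite powRM // ?mulr_ge0 ?(ltW C0) // -mulrA ler_wpM2l ?powR_ge0 //.
  have hy : decay a A `^ s <= slack a q A.
    rewrite /decay -powRrM; have -> : - (2 * a) * s = - (2 + 2 * a).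
      by rewrite /s; field; rewrite gt_eqF.
    by rewrite /slack ler_peMl ?powR_ge0 // exprn_ege1.
  have hx : slack a q A `^ s <= X1 * slack a q A.
    rewrite /s powRD; last by rewrite (gt_eqF x0) implybT.
    rewrite powRr1 ?(ltW x0) // mulrC ler_wpM2r ?(ltW x0) //.
    apply: ge0_ler_powR => //; rewrite ?nnegrE; last by rewrite mulr_ge0 // ltW.
      by rewrite invr_ge0 ltW.
    exact: ltW.
  have := mulr_ge0 X10 (ltW x0); rewrite mulrDl mul1r.
  move=> h4; have [_|_] := leP (decay a A) (slack a q A).
    by apply: le_trans hx _; move: (ltW x0); lra.
  by apply: le_trans hy _; move: h4; lra.
pose c4 := c / 2 / C3; have c40 : 0 < c4 by rewrite !divr_gt0.
pose rm : R := (m.+2)%:R `^ (- (2 * a)); have rm0 : 0 < rm by exact: powR_gt0.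
pose dp : R := (d.+1)%:R `^ (2 * a); have dp0 : 0 < dp by exact: powR_gt0.
(* One summand for each demand on the weight: to be at least 1, to absorb the interaction, and to
   force [m.+1 < rmin A] and the bound on the diameter when [W t A < 1]. *)
pose W0 := 1 + 2 * Ci / c + (c * rm)^-1 + dp / c.
have i1 : 0 <= 2 * Ci / c by rewrite divr_ge0 ?(ltW c0) // mulr_ge0.
have i2 : 0 <= (c * rm)^-1 by rewrite invr_ge0 mulr_ge0 // ltW.
have i3 : 0 <= dp / c by rewrite divr_ge0 // ltW.
have W01 : 1 <= W0 by rewrite /W0; move: i1 i2 i3; lra.
have W00 : 0 < W0 by apply: lt_le_trans W01.
have [E E0 hE] := time_weights a01 hdelta c40 W00.
set th := a * (1 - 2 * delta) in hE; set b := 2 * a * delta in hE.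
have th0 : 0 <= th by rewrite mulr_ge0 ?(ltW a0) //; lra.
have b0 : 0 < b by rewrite !mulr_gt0.
(* The clock starts so late that the error term is at most 1/4:
   [E * t0 ^ (- b) = E / (4 * E + 1)]. *)
pose t0 := (4 * E + 1) `^ b^-1.
have t01 : 1 <= t0.
  rewrite -(powRr0 (4 * E + 1)); apply: ler_powR; first by rewrite lerDr mulr_ge0.
  by rewrite invr_ge0 ltW.
have t00 : 0 < t0 by apply: lt_le_trans t01.
pose tau (t : nat) := t0 + t%:R; have tau1 t : 1 <= tau t by rewrite ler_wpDr.
have tau0 t : 0 < tau t by apply: lt_le_trans (tau1 t).
pose w t := W0 * tau t `^ th; pose e t := E * tau t `^ (- b).
have w0 t : W0 <= w t.
  rewrite ler_peMr ?(ltW W00) // -[leLHS](pw1 th).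
  by apply: ge0_ler_powR; rewrite ?nnegrE // (le_trans ler01).
have wp t : 0 < w t by apply: lt_le_trans (w0 t).
have e0 t : 0 <= e t by rewrite mulr_ge0 ?powR_ge0.
pose W t A := w t * f A + e t.
have small t A : wf A -> W t A < 1 ->
    [/\ f A <= 1, (m.+1 < rmin A)%N & ok t (union A)].
  move=> wA W1; have fA := fge A wA.
  have wf1 : w t * f A < 1 by apply: le_lt_trans W1; rewrite lerDl.
  have f1 : f A <= 1.
    by apply: le_trans (ltW wf1); rewrite ler_peMl // (le_trans W01).
  have [hyy _ _ _] := hf A wA.
  have r0 := rmin1_gt0 A.
  have hyw : w t * (c * decay a A) < 1 by apply: le_lt_trans wf1; rewrite ler_wpM2l // ltW.
  split=> //.
    rewrite ltnNge; apply/negP => hr; move: hyw; rewrite ltNge => /negP; apply.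
    have : rm <= decay a A.
      apply: gt0_powRN_anti => //; first by rewrite mulr_ge0 // ltW.
      by rewrite /rmin1 -[1]/(1%:R) -natrD ler_nat add1n ltnS.
    move=> h; apply: le_trans (_ : (c * rm)^-1 * (c * rm) <= _).
      by rewrite mulVf // gt_eqF // mulr_gt0.
    apply: ler_pM => //; first by rewrite mulr_ge0 // ltW.
      by apply: le_trans (w0 t); rewrite /W0; move: i1 i3; lra.
    by rewrite ler_wpM2l // ltW.
  apply/asboolP; set z := 2^-1 - delta; have z0 : 0 <= z by rewrite /z; lra.
  have h1 : d.+1%:R * tau t `^ z <= rmin1 A.
    rewrite leNgt; apply/negP => hr; move: hyw; rewrite ltNge => /negP; apply.
    have : (d.+1%:R * tau t `^ z) `^ (- (2 * a)) <= decay a A.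
      apply: gt0_powRN_anti => //; [by rewrite mulr_ge0 // ltW|exact: ltW].
    rewrite powRM ?powR_ge0 // -powRrM.
    have -> : z * - (2 * a) = - th by rewrite /z /th; field.
    move=> h; apply: le_trans (_ : w t * (c * (d.+1%:R `^ (- (2 * a)) * tau t `^ (- th))) <= _).
      rewrite /w; have -> : W0 * tau t `^ th * (c * (d.+1%:R `^ (- (2 * a)) * tau t `^ (- th))) =
        W0 * (c * d.+1%:R `^ (- (2 * a))) * (tau t `^ th * tau t `^ (- th)) by ring.
      rewrite -powRD ?(gt_eqF (tau0 t)) ?implybT // subrr powRr0 mulr1.
      apply: le_trans (_ : dp / c * (c * d.+1%:R `^ (- (2 * a))) <= _).
        by rewrite mulrA divfK ?gt_eqF // /dp -powRD ?subrr ?powRr0 // pnatr_eq0 implybT.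
      rewrite ler_wpM2r ?mulr_ge0 ?powR_ge0 ?(ltW c0) // /W0; move: i1 i2; lra.
    by rewrite ler_wpM2l ?(ltW (wp t)) // ler_wpM2l ?(ltW c0).
  have tz : t%:R `^ z <= tau t `^ z.
    by apply: ge0_ler_powR; rewrite ?nnegrE ?(ltW (tau0 t)) // lerDr ltW.
  apply: le_trans tz _; have dr : 0 < d%:R :> R by rewrite ltr0n.
  rewrite -(ler_pM2l dr); apply: le_trans (rmin_diam wA).
  have t1 : 1 <= tau t `^ z by rewrite -[leLHS](pw1 z); apply: ge0_ler_powR; rewrite ?nnegrE // ?(ltW (tau0 t)).
  by move: h1; rewrite /rmin1 -natr1 mulrDl mul1r; move: t1; lra.
have main N t A : wf A -> kill m beta ok N t (union A) <= W t A.
  elim: N t A => [|N IH] t A wA.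
    have [W1|W1] := leP 1 (W t A); first by apply: le_trans W1; case/andP: (kill_01 m beta ok 0 t (union A)).
    have [_ _ okA] := small t A wA W1; rewrite /= okA.
    by rewrite addr_ge0 // mulr_ge0 ?fge // ltW.
  have [W1|W1] := leP 1 (W t A).
    by apply: le_trans W1; case/andP: (kill_01 m beta ok N.+1 t (union A)).
  have [f1 mr okA] := small t A wA W1; rewrite /= okA.
  have := @Estep_union (kill m beta ok N t.+1) (fun A' => `|W t.+1 A'|) A _ _ wA (rminP wA).1 mr (dmaxP A).1.
  move=> /(_ (kill_01 m beta ok N t.+1) (fun A' => normr_ge0 _)).
  have Wge t' A' : wf A' -> 0 <= W t' A' by move=> wA'; rewrite addr_ge0 // mulr_ge0 ?fge // ltW.
  have h0 A' : wf A' -> near 1 A A' -> kill m beta ok N t.+1 (union A') <= `|W t.+1 A'|.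
    by move=> wA' _; rewrite ger0_norm ?Wge //; exact: IH.
  move=> /(_ h0) /le_trans; apply.
  have -> : Q (fun A' => `|W t.+1 A'|) A = w t.+1 * Q f A + e t.+1.
    rewrite -QZ -{1}(Q_cst (e t.+1) wA) -QD; apply: eq_Q => // A' wA' _.
    by rewrite ger0_norm // Wge.
  have [_ _ hQ _] := hf A wA; have hp := fpow A wA f1.
  have h1 := ler_wpM2l (ltW (wp t.+1)) hQ.
  have h2 : Ci * slack a q A <= w t.+1 * (c / 2 * slack a q A).
    rewrite mulrA ler_wpM2r ?(ltW (slack_gt0 _ _ _)) //.
    apply: le_trans (_ : (2 * Ci / c) * (c / 2) <= _).
      rewrite le_eqVlt; apply/orP; left; apply/eqP.
      by field; rewrite gt_eqF.
    rewrite ler_wpM2r ?divr_ge0 ?(ltW c0) //; apply: le_trans (w0 _).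
    by rewrite /W0; move: i2 i3; lra.
  have h3 : c4 * f A `^ s <= c / 2 * slack a q A.
    by rewrite /c4 mulrAC ler_pdivrMr // -[leRHS]mulrA ler_wpM2l ?divr_ge0 ?(ltW c0) // [leRHS]mulrC.
  have h4 := hE (tau t) (f A) (tau1 t) (fge A wA).
  have tS : tau t + 1 = tau t.+1 by rewrite /tau -addrA natr1.
  rewrite tS -/(w t.+1) -/(w t) -/(e t.+1) -/(e t) -/s in h4.
  have h5 := ler_wpM2l (ltW (wp t.+1)) h3; have h6 := hCi A.
  apply: le_trans h4; move: h1 h2 h5 h6; rewrite !mulrBr.
  have -> : w t.+1 * (c * slack a q A) = 2 * (w t.+1 * (c / 2 * slack a q A)) by field.
  by move: (w t.+1 * (c / 2 * _)) (w t.+1 * (c4 * _)) (w t.+1 * Q f A) (w t.+1 * f A) (interaction _ _) (Ci * _) => u1 u2 u3 u4 u5 u6; lra.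
(* An initial [decay] of at most [eta] makes [w 0 * f A] at most 1/4, given the bound [D0] on the
   diameters. *)
pose eta := (4 * (w 0%N * (C * (1 + (1 + D0%:R) ^+ q))))^-1.
have Dq0 : 0 < 1 + (1 + D0%:R) ^+ q :> R by rewrite ltr_pwDl // exprn_ge0 // addr_ge0.
have wC0 : 0 < w 0%N * (C * (1 + (1 + D0%:R) ^+ q)) by apply: mulr_gt0 => //; apply: mulr_gt0.
have eta0 : 0 < eta by rewrite invr_gt0 mulr_gt0.
exists (Num.bound (eta `^ (- (2 * a)^-1))) => A N wA sA dA.
apply: le_trans (main N 0%N A wA) _.
have yeta : decay a A <= eta.
  have -> : eta = (eta `^ (- (2 * a)^-1)) `^ (- (2 * a)).
    rewrite -powRrM mulrNN mulVf ?powRr1 ?(ltW eta0) //.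
    by rewrite gt_eqF // mulr_gt0.
  apply: gt0_powRN_anti; [by rewrite mulr_ge0 // ltW|exact: powR_gt0|].
  apply: le_trans (ltW (archi_boundP (powR_ge0 _ _))) _.
  have [_ [i [j [x [y [ij xi yj rE]]]]]] := rminP wA.
  by rewrite /rmin1 -rE ler_wpDl // ler_nat; exact: sA ij _ _ xi yj.
have xy : slack a q A <= (1 + D0%:R) ^+ q * decay a A.
  rewrite /slack /decay; have d1 := le_trans ler01 (dmax1_ge1 A).
  have D1 : dmax1 A <= 1 + D0%:R by rewrite lerD2l ler_nat; exact: (dmaxP A).2 dA.
  apply: ler_pM; [exact: exprn_ge0|exact: powR_ge0| |].
    by apply: lerXn2r; rewrite ?nnegrE //; apply: le_trans D1.
  by apply: ler_powR => //; rewrite lerN2 lerDr.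
have fA : f A <= C * (1 + (1 + D0%:R) ^+ q) * decay a A.
  have [_ h _ _] := hf A wA; apply: le_trans h _.
  by rewrite -[leRHS]mulrA ler_wpM2l ?(ltW C0) // mulrDl mul1r lerD2l.
have h1 : w 0%N * f A <= 4^-1.
  apply: le_trans (_ : w 0%N * (C * (1 + (1 + D0%:R) ^+ q)) * eta <= _).
    rewrite -mulrA ler_wpM2l ?(ltW (wp _)) //; apply: le_trans fA _.
    by rewrite ler_wpM2l // mulr_ge0 // ltW.
  by rewrite /eta invfM mulrCA mulfV ?mulr1 // (gt_eqF wC0).
have h2 : e 0%N <= 4^-1.
  rewrite /e /tau addr0 /t0 -powRrM mulrN mulVf ?(gt_eqF b0) // powR_inv1; last first.
    by rewrite addr_ge0 // mulr_ge0.
  rewrite ler_pdivrMr; last by rewrite ltr_wpDl // mulr_ge0.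
  exact: E4.
exact: le_trans (lerD h1 h2) q4.
Qed.

End Tuples.

(** * Reaching separated clusters *)

(** Cutting [m.+1] elements off a list of more than [2 * m + 1] leaves more than [m]. The groups
    need not be connected, since crawling does not require it. *)
Lemma split_groups (T : Type) m (s : seq T) : (m < size s)%N -> exists gs : seq (seq T),
  flatten gs = s /\ all (fun g => m < size g <= 2 * m + 1)%N gs.
Proof.
elim: {s}_.+1 {-2}s (ltnSn (size s)) => [//|l IH] s sl ms.
case: (leqP (size s) (2 * m + 1)) => h.
  by exists [:: s]; rewrite /= cats0 ms h.
have [||gs [fE ga]] := IH (drop m.+1 s); rewrite ?size_drop.
- by rewrite ltn_subLR ?(leq_trans _ ms) // (leq_trans sl) // addSn ltnS leq_addl.
- by rewrite ltn_subRL; move: h; lia.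
exists (take m.+1 s :: gs); split; first by rewrite /= fE cat_take_drop.
by rewrite /= ga andbT size_takel //; apply/andP; split; lia.
Qed.

Section Initial.
Variables (R : realType) (d m n : nat) (beta : R).
Hypothesis m_gt0 : (0 < m)%N.
Hypothesis d_gt0 : (0 < d)%N.
Hypothesis beta_ge0 : 0 <= beta.
Notation L := (lattice d).
Notation e := (e0 d_gt0).
Implicit Types (B C Rest : {fset L}) (x y z : L) (g : seq L) (gs : seq (seq L)).

Definition group g : Prop := (m < size g <= 2 * m + 1)%N /\
  {in g &, forall x y, (l1 (x - y)%R <= n)%N}.

Definition far (r : nat) B B' : Prop := forall x y, x \in B -> y \in B' -> (r <= l1 (x - y)%R)%N.

(** The first [2 * m + 1] steps suffice to bring a group onto its ray. Each additional group allows
    [r + 3] more steps, that is [m * (r + 3) > r + 2 * m] more sites: room for the distance [r] and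
    the length of a segment. *)
Definition crawl_time (r l : nat) : nat := (2 * m + 1 + l * (r + 3))%N.

Lemma far_coord (r : nat) B B' :
  (forall x y, x \in B -> y \in B' -> x ord0 e + r%:Z <= y ord0 e) -> far r B B'.
Proof.
move=> h x y xB yB; apply: leq_trans (l1_coord (x - y) e).
by have := h x y xB yB; rewrite !mxE; move: (x _ _) (y _ _) => u v; lia.
Qed.

Lemma farC r B B' : far r B B' -> far r B' B.
Proof. by move=> h x y xB yB; rewrite l1_sym; exact: h. Qed.

(** [Rest] stands for the groups that have already moved; it lies ahead, beyond the reach of the
    others. *)
Definition spreads r l (p : R) : Prop := forall gs Rest,
  size gs = l -> uniq (flatten gs) -> (forall g, g \in gs -> group g) ->
  #|` [fset x in flatten gs] `|` Rest|%fset = n ->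
  (forall x y, x \in flatten gs -> y \in Rest ->
     x ord0 e + (m * crawl_time r l + r)%:Z < y ord0 e) ->
  exists t (ls : seq {fset L}), [/\ (t <= l * crawl_time r l)%N, size ls = l,
    (forall i j, (i < j < l)%N -> far r (nth fset0 ls i) (nth fset0 ls j)) /\
    (forall i, (i < l)%N -> far r (nth fset0 ls i) Rest),
    forall i, (i < l)%N -> (m < #|` nth fset0 ls i| <= 2 * m + 1)%N /\
      {in nth fset0 ls i &, forall x y, (l1 (x - y)%R <= 2 * m + 1)%N} &
    reach m beta p t ([fset x in flatten gs] `|` Rest)%fset (\bigcup_(B <- ls) B `|` Rest)%fset].

(* The group with the largest [e0]-coordinate moves first and furthest, so that it
   is never in the way of the others. *)
Lemma spread_groups r l : (0 < n)%N -> exists2 p : R, 0 < p <= 1 & spreads r l p.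
Proof.
have ar0 l' : (m * crawl_time r l' + r + 2 * m < m * crawl_time r l'.+1)%N.
  by rewrite /crawl_time mulSn !mulnDr; move: (m * (l' * _))%N m_gt0 => v; nia.
have ar1 (u : int) (v : nat) : ~~ (u + v%:Z < u) by lia.
have ar2 (u : int) (j : nat) : (0 < j)%N -> ~~ (u + j%:Z <= u) by lia.
have ar3 (u : int) (v j : nat) : (j <= v)%N -> ~~ (u + (v + r)%:Z < u + j%:Z) by lia.
have ar4 (u : int) (v w i : nat) : (i < w)%N -> (w <= 2 * m + 1)%N -> (w <= v)%N ->
    u + v%:Z - (2 * m)%:Z <= u + (v - w.-1 + i)%:Z <= u + v%:Z by move: (m) => m'; lia.
have ar5 (u v w : int) (a : nat) : u <= v + a%:Z -> v + (a + r)%:Z < w -> u + r%:Z <= w by lia.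
have ar6 (u v w : int) (a c : nat) : u <= v -> v + a%:Z - (2 * m)%:Z <= w -> (c + 2 * m < a)%N ->
    u + c%:Z < w by move: (m) => m'; lia.
have ar7 (u w : int) (a c : nat) : u + (a + r)%:Z < w -> (c + r + 2 * m < a)%N ->
    u + (c + r)%:Z < w by move: (m) => m'; lia.
move=> n0; elim: l => [|l [p' /andP [p'0 p'1] IH]].
  exists 1; first by rewrite ltr01 lexx.
  move=> gs Rest /size0nil -> _ _ _ _; exists 0%N, [::]; split=> //; first by split=> // i j /andP [].
  rewrite big_nil; have -> : [fset x in flatten [::]]%fset = fset0 :> {fset L}.
    by apply/fsetP => x; rewrite !inE.
  exact: reach0.
pose T := crawl_time r l.+1; pose p0 : R := trp d m beta n (n + 2 * (m * T)).+1.
have p00 : 0 < p0 by exact: trp_gt0.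
have pm0 : 0 < Num.min p' p0 by rewrite lt_min p'0.
exists (Num.min p' p0); first by rewrite pm0 ge_min p'1.
move=> gs Rest sgs ugs ggs cn hR.
have [x0 x0g] : exists x, x \in flatten gs.
  case: gs sgs ggs {ugs cn hR} => // g gs _ /(_ g (mem_head _ _)) [/andP [mg _] _].
  by case: g mg => // x g _; exists x; rewrite /= mem_head.
have [y yg ymax] := ex_seq_max (fun x : L => x ord0 e) x0g.
have /flattenP [g ggs' yg'] := yg.
have [/andP [mg g2] gd] := ggs g ggs'.
pose gs' := rem g gs.
have pg : perm_eq gs (g :: gs') := perm_to_rem ggs'.
have pf : perm_eq (flatten gs) (g ++ flatten gs') by have := perm_flatten pg.
have ugg : uniq (g ++ flatten gs') by rewrite -(perm_uniq pf).
have fin x : (x \in flatten gs) = (x \in g) || (x \in flatten gs').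
  by rewrite (perm_mem pf) mem_cat.
move: (ugg); rewrite cat_uniq => /and3P [ug /hasPn gg' ug'].
pose G : {fset L} := [fset x in g]%fset; pose Rest2 : {fset L} := ([fset x in flatten gs'] `|` Rest)%fset.
have Gin x : (x \in G) = (x \in g) by rewrite !inE.
have R2in x : (x \in Rest2) = (x \in flatten gs') || (x \in Rest) by rewrite !inE.
have cG : #|` G| = size g by rewrite card_fseq undup_id.
have GE : ([fset x in flatten gs] `|` Rest = G `|` Rest2)%fset.
  by apply/fsetP => x; rewrite in_fsetU [RHS]in_fsetU R2in Gin orbA -fin !inE.
have gT : (size g <= T)%N by apply: leq_trans g2 _; rewrite /T /crawl_time leq_addr.
have coord k : (y + unitv e *+ k) ord0 e = y ord0 e + k%:Z.
  by rewrite mxE mulmxnE unitvE eqxx mulr1n natz.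
have cr : reach m beta p0 T (G `|` Rest2)%fset
    (line d_gt0 (size g) (y + unitv e *+ (m * T - (size g).-1)) `|` Rest2)%fset.
  have := @crawl R d m beta m_gt0 d_gt0 beta_ge0 G Rest2 y n T.
  rewrite -GE cn cG Gin; apply=> //.
  - by move=> x; rewrite Gin => xg; apply: ymax; rewrite fin xg.
  - by move=> x z; rewrite !Gin; exact: gd.
  - move=> x; rewrite Gin R2in negb_or => xg; apply/andP; split.
      by apply/negP => /gg'; rewrite /= xg.
    apply/negP => /(hR x x); rewrite fin xg => /(_ isT).
    exact/negP/ar1.
  move=> j /andP [j0 jT]; rewrite R2in negb_or; apply/andP; split; apply/negP => hj.
    have := ymax (y + unitv e *+ j); rewrite fin hj orbT => /(_ isT).
    by rewrite coord; exact/negP/ar2.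
  by have := hR y _ yg hj; rewrite coord -/T; exact/negP/ar3.
set B := line d_gt0 _ _ in cr.
have Bc x : x \in B -> y ord0 e + (m * T)%:Z - (2 * m)%:Z <= x ord0 e <= y ord0 e + (m * T)%:Z.
  move=> /line_in [i ig ->]; rewrite -[y + _ + _]addrA -mulrnDr coord.
  have gm : (size g <= m * T)%N by apply: leq_trans gT _; rewrite leq_pmull.
  exact: ar4.
have cB : #|` B| = size g.
  rewrite /B /line /window card_in_imfset /=; first by rewrite undup_id ?iota_uniq ?size_iota.
  by move=> i j _ _ /addrI /(congr1 (@l1 d)); rewrite !l1_unitv.
have TT : (m * crawl_time r l + r + 2 * m < m * T)%N.
  exact: ar0.
have Bfar : far r B Rest.
  apply: far_coord => x z /Bc /andP [_ xB] zR; have := hR y z yg zR; rewrite -/T.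
  by move=> yz; exact: ar5 xB yz.
have [|//||||t [ls [tl sl [ls1 ls2] ls3 ls4]]] := IH gs' (B `|` Rest)%fset.
- by rewrite /gs' size_rem // sgs.
- by move=> g' /mem_rem; exact: ggs.
- by rewrite fsetUCA -/Rest2 (reach_card cr) -GE cn.
- move=> x z xg' ; rewrite in_fsetU => /orP [/Bc /andP [zB _]|zR].
    have := ymax x; rewrite fin xg' orbT => /(_ isT).
    by move=> xy; exact: ar6 xy zB TT.
  have := hR x z; rewrite fin xg' orbT => /(_ isT zR); rewrite -/T.
  by move=> xz; exact: ar7 xz TT.
have ls2' i : (i < l)%N -> far r B (nth fset0 ls i) /\ far r (nth fset0 ls i) Rest.
  move=> il; have h := ls2 i il; split.
    by apply: farC => x z xi zB; apply: h => //; rewrite in_fsetU zB.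
  by move=> x z xi zB; apply: h => //; rewrite in_fsetU zB orbT.
exists (T + t)%N, (B :: ls); split.
- rewrite mulSn leq_add2l; apply: leq_trans tl _; rewrite leq_mul2l; apply/orP; right.
  by rewrite /crawl_time leq_add2l leq_mul2r leqnSn orbT.
- by rewrite /= sl.
- split=> [[|i] [|j]|[|i]] //=.
    by rewrite ltnS => jl; have [] := ls2' j jl.
    by rewrite !ltnS => ij; exact: ls1.
  by rewrite ltnS => il; have [] := ls2' i il.
- move=> [_|i] /=; last by rewrite ltnS; exact: ls3.
  rewrite cB mg g2; split=> // x z /line_in [i ig ->] /line_in [j jg ->].
  apply: leq_trans g2; rewrite opprD addrACA subrr add0r.
  have h (u v : nat) : (u <= v)%N -> (v < size g)%N -> (l1 ((unitv e *+ v : L) - unitv e *+ u) <= size g)%N.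
    by move=> uv vs; rewrite -mulrnBr // l1_unitv (leq_trans (leq_subr _ _)) // ltnW.
  by case: (leqP i j) => ll; [rewrite l1_sym; exact: h|apply: h => //; exact: ltnW].
rewrite GE; apply: reach_cat; first by apply: reach_weaken cr; [exact: ltW|rewrite ge_min lexx orbT].
have -> : (B `|` Rest2 = [fset x in flatten gs'] `|` (B `|` Rest))%fset by rewrite fsetUCA.
have -> : (\bigcup_(B <- B :: ls) B `|` Rest = \bigcup_(B <- ls) B `|` (B `|` Rest))%fset.
  by rewrite big_cons -fsetUA fsetUCA.
by apply: reach_weaken ls4; [exact: ltW|rewrite ge_min lexx].
Qed.

(** The trees left by merging are cut into groups, of which there are at least two since
    [n > 2 * m + 1]. The product over all possible numbers of groups provides a single [p]. *)
Lemma initial_groups r : (2 * m + 1 < n)%N -> exists (p : R) (T : nat), 0 < p <= 1 /\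
  forall C, #|` C| = n -> exists t l (A : 'I_l -> {fset L}) C',
  [/\ (t <= T)%N, (1 < l <= n)%N,
    forall i, (m < #|` A i| <= 2 * m + 1)%N /\ {in A i &, forall x y, (l1 (x - y)%R <= 2 * m + 1)%N},
    forall i j, i != j -> far r (A i) (A j) &
    reach m beta p t C C' /\ forall x, x \in C' <-> exists i, x \in A i].
Proof.
move=> mn; have n0 : (0 < n)%N by apply: leq_ltn_trans mn.
have hp l : exists p : R, 0 < p <= 1 /\ spreads r l p.
  by have [p p01 h] := spread_groups r l n0; exists p.
have [pl hpl] := choice hp.
pose q0 : R := trp d m beta n n.+1.
have q00 : 0 < q0 by exact: trp_gt0.
have pl0 l : 0 < pl l by have [/andP []] := hpl l.
have pl1 l : pl l <= 1 by have [/andP []] := hpl l.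
pose p := q0 * \prod_(l < n.+1) pl l.
have q01 : q0 <= 1 by exact: trp_le1.
have P0 : 0 < \prod_(l < n.+1) pl l by apply: prodr_gt0.
have P1 : \prod_(l < n.+1) pl l <= 1 by apply: prodr_ile1 => l _; rewrite pl1 ltW.
have p0 : 0 < p by rewrite mulr_gt0.
have pq : p <= q0 by rewrite ler_piMr // ltW.
have ppl l : (l <= n)%N -> p <= pl l.
  move=> ln; apply: le_trans (_ : \prod_(l < n.+1) pl l <= _); first by rewrite ler_piMl // ltW.
  have ln1 : (l < n.+1)%N by rewrite ltnS.
  rewrite (bigD1 (Ordinal ln1)) //= ler_piMr ?(ltW (pl0 _)) //.
  by apply: prodr_ile1 => l' _; rewrite pl1 ltW.
exists p, (n + \sum_(l < n.+1) l * crawl_time r l)%N; split; first by rewrite p0 (le_trans pq).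
move=> C cC; have mC : (m < #|` C|)%N by rewrite cC (leq_ltn_trans _ mn) // mul2n -addnn -addnA leq_addr.
have [k [C' [ss [kn re cC' [ts us ssC] big]]]] := merge m_gt0 d_gt0 beta_ge0 mC.
rewrite cC -/q0 in re; rewrite cC in cC' kn.
have sn s : s \in ss -> (size s <= n)%N.
  move=> sss; rewrite -cC'; apply: uniq_leq_size.
    by move: us; rewrite (perm_uniq (perm_flatten (perm_to_rem sss))) /= cat_uniq => /andP [].
  by move=> x xs; rewrite -ssC; apply/flattenP; exists s.
have [gs [gE ggr]] : exists gs, flatten gs = flatten ss /\ forall g, g \in gs -> group g.
  have : forall s, s \in ss -> [/\ (m < size s)%N, (size s <= n)%N & tree s].
    by move=> s sss; split; [exact: big|exact: sn|exact: ts].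
  elim: (ss) => [|s ss' IH] h; first by exists [::].
  have [|gs [gE gg]] := IH; first by move=> s' s's; apply: h; rewrite inE s's orbT.
  have [ms sn' trs] := h s (mem_head _ _).
  have [gs1 [g1E /allP g1]] := split_groups ms.
  exists (gs1 ++ gs); split; first by rewrite flatten_cat g1E gE.
  move=> g; rewrite mem_cat => /orP [gg1|]; last exact: gg.
  split=> [|x y xg yg]; first exact: g1.
  have sub z : z \in g -> z \in s by move=> zg; rewrite -g1E; apply/flattenP; exists g.
  by apply: leq_trans sn'; apply: tree_l1 => //; exact: sub.
have CE : ([fset x in flatten gs] `|` fset0 = C')%fset.
  by rewrite fsetU0; apply/fsetP => x; rewrite !inE gE ssC.
have sgn : size (flatten gs) = n.
  rewrite gE -cC'; apply/perm_size/uniq_perm => //; exact: fset_uniq.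
have szf (G : seq (seq L)) : (forall g, g \in G -> group g) ->
    (size G <= size (flatten G) <= size G * (2 * m + 1))%N.
  elim: G => // g G IH h; have [|/andP [mg g2] _] := h g; first exact: mem_head.
  have /andP [i1 i2] : (size G <= size (flatten G) <= size G * (2 * m + 1))%N.
    by apply: IH => g' gG; apply: h; rewrite inE gG orbT.
  rewrite /= size_cat mulSn leq_add // andbT -add1n leq_add //.
  exact: leq_trans mg.
have /andP [s1 s2] := szf gs ggr; rewrite sgn in s1 s2.
have l1_ : (1 < size gs)%N.
  by rewrite ltnNge; apply/negP => h; move: mn; rewrite ltnNge => /negP; apply; apply: leq_trans s2 _; rewrite -[leqRHS]mul1n leq_mul2r h orbT.
have [_ /(_ gs fset0 erefl)] := hpl (size gs).
rewrite CE cC' gE => /(_ us ggr erefl) [|t [ls [tl sl [ls1 _] ls3 ls4]]]; first by move=> x y _; rewrite inE.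
exists (k + t)%N, (size gs), (fun i => nth fset0 ls i), (\bigcup_(B <- ls) B)%fset; split.
- apply: leq_add kn _; apply: leq_trans tl _.
  have sg1 : (size gs < n.+1)%N by rewrite ltnS.
  by rewrite (bigD1 (Ordinal sg1)) //= leq_addr.
- by rewrite l1_ s1.
- by move=> i; apply: ls3.
- move=> i j ij; have : (i < j)%N || (j < i)%N by rewrite -neq_ltn; apply: contra ij => /eqP h; apply/eqP/val_inj.
  by case/orP => h; [|apply: farC]; apply: ls1; rewrite h ltn_ord.
split.
  rewrite fsetU0 in ls4.
  by apply: reach_cat; [apply: reach_weaken re|apply: reach_weaken ls4] => //; [exact: ltW|exact: ltW|exact: ppl].
move=> x; split.
  move=> /bigfcupP [B /andP [Bl _] xB]; have := Bl; rewrite -index_mem sl => il.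
  by exists (Ordinal il); rewrite /= nth_index.
move=> [i xi]; apply/bigfcupP; exists (nth fset0 ls i) => //.
by rewrite mem_nth // sl.
Qed.

End Initial.

(** * The Markov chain *)

Section Chain.
Variables (R : realType) (d m : nat) (beta : R).
Hypothesis m_gt0 : (0 < m)%N.
Hypothesis d_gt0 : (0 < d)%N.
Hypothesis beta_ge0 : 0 <= beta.
Notation L := (lattice d).
Notation S := (cat_state d m).
Variables (disp : measure_display) (T : measurableType disp) (P : probability T R) (X : nat -> T -> S) (C0 : S).
Hypothesis chain : markov_chain (cat_kernel beta) C0 P X.

Lemma measurable_state t (p : pred S) : measurable [set w | p (X t w)].
Proof.
have [mX _ _] := chain.
have -> : [set w | p (X t w)] =
    (\bigcup_(n in [set: nat]) (if (@choice.unpickle S n) is Some c then (if p c then [set w | X t w = c] else set0) else set0))%classic.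
  apply/seteqP; split=> w /=.
    by move=> pw; exists (@choice.pickle S (X t w)) => //=; rewrite choice.pickleK pw.
  by move=> [n _]; case: choice.unpickle => // c; case: ifP => // pc /= ->.
by apply: bigcup_measurable => n _; case: choice.unpickle => // c; case: ifP.
Qed.

Lemma measurable_path (p : nat -> pred S) : measurable [set w | forall t, p t (X t w)].
Proof.
have -> : [set w | forall t, p t (X t w)] = (\bigcap_(t in [set: nat]) [set w | p t (X t w)])%classic.
  by apply/seteqP; split=> w h t //=; exact: h.
by apply: bigcapT_measurable => t; exact: measurable_state.
Qed.

Lemma sum_measure_le (s : seq S) (F : S -> set T) (E : set T) : uniq s -> measurable E ->
  (forall c, measurable (F c)) -> (forall c, c \in s -> (F c `<=` E)%classic) ->
  (forall c c' w, F c w -> F c' w -> c = c') ->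
  (\sum_(c <- s) P (F c) <= P E)%E.
Proof.
move=> us mE mF FE Fd; elim: s E us mE FE => [|c s IH] E; first by rewrite big_nil.
move=> /= /andP [cs us] mE FE; rewrite big_cons (measureDI P mE (mF c)) addeC.
have -> : (E `&` F c = F c)%classic by apply/setIidr; apply: FE; exact: mem_head.
apply: leeD2r; apply: IH => //; first exact: measurableD.
move=> c' c's w Fw; split; first by apply: FE Fw; rewrite inE c's orbT.
by move=> Fcw; move: cs; rewrite (Fd _ _ _ Fcw Fw) c's.
Qed.

(** Induction on [N]. For an inequality the event may be restricted to the finitely many possible
    successors of [a t], over which [kernel_Estep] turns the sum into one step of [kill]. *)
Lemma chain_kill (ok : nat -> {fset L} -> bool) N t (a : nat -> S) :
  (P [set w | forall i, (i <= t)%N -> X i w = a i] * (1 - kill m beta ok N t (val (a t)))%:E <=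
   P [set w | (forall i, (i <= t)%N -> X i w = a i) /\
              forall j, (t <= j <= t + N)%N -> ok j (val (X j w))])%E.
Proof.
have [_ _ trK] := chain.
have mpre t' a' : measurable [set w | forall i, (i <= t')%N -> X i w = a' i].
  have -> : [set w | forall i, (i <= t')%N -> X i w = a' i] =
      [set w | forall i, ((i <= t')%N ==> (X i w == a' i))].
    apply/seteqP; split=> w h i; first by apply/implyP => it; apply/eqP; exact: h.
    by move=> it; apply/eqP; exact: (implyP (h i)).
  exact: (measurable_path (fun i c => (i <= t')%N ==> (c == a' i))).
have mev t' N' a' : measurable [set w | (forall i, (i <= t')%N -> X i w = a' i) /\
    forall j, (t' <= j <= t' + N')%N -> ok j (val (X j w))].
  apply: measurableI; first exact: mpre.
  have -> : (fun w => forall j, (t' <= j <= t' + N')%N -> ok j (val (X j w))) =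
      [set w | forall j, (t' <= j <= t' + N')%N ==> ok j (val (X j w))].
    by apply/seteqP; split=> w h i; [apply/implyP; exact: h|exact/implyP/h].
  exact: (measurable_path (fun j c => (t' <= j <= t' + N')%N ==> ok j (val c))).
elim: N t a => [|N IH] t a /=; case okt: (ok t (val (a t))).
- rewrite subr0 mule1; apply: le_measure; rewrite ?inE; [exact: mpre|exact: mev|].
  move=> w h; split=> // j; rewrite addn0 => tj; have -> : j = t by apply/eqP; rewrite eqn_leq andbC.
  by rewrite h.
- by rewrite subrr mule0.
- pose C := a t; have mC := cat_stateP C.
  pose s : {fset S} := [fset c in pmap insub [seq transport m (val C) xs | xs <- outcomes m (2 * m) (val C) [::]]]%fset.
  have sP xs (C' : S) : xs \in outcomes m (2 * m) (val C) [::] -> transport m (val C) xs = val C' -> C' \in s.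
    by move=> xo e; rewrite !inE /= mem_pmap_sub -e; apply/mapP; exists xs.
  pose a' (c : S) i := if i == t.+1 then c else a i.
  have a't c i : (i <= t)%N -> a' c i = a i by move=> it; rewrite /a' ltn_eqF.
  have a'S c : a' c t.+1 = c by rewrite /a' eqxx.
  pose F c := [set w | (forall i, (i <= t.+1)%N -> X i w = a' c i) /\
              forall j, (t.+1 <= j <= t.+1 + N)%N -> ok j (val (X j w))].
  have preE c : [set w | forall i, (i <= t)%N -> X i w = a' c i] = [set w | forall i, (i <= t)%N -> X i w = a i].
    by apply/seteqP; split=> w h i it; rewrite h // a't.
  apply: le_trans (_ : (\sum_(c <- s) P (F c) <= _)%E); last first.
    apply: sum_measure_le; [exact: fset_uniq|exact: (mev t N.+1 a)|by move=> c; exact: (mev t.+1 N)| |].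
      move=> c _ w [h1 h2]; have h0 i : (i <= t)%N -> X i w = a i.
        by move=> it; rewrite h1 ?a't // ltnW.
      split=> // j /andP [tj jN]; move: tj; rewrite leq_eqVlt => /orP [/eqP <-|tj]; first by rewrite h0.
      by apply: h2; rewrite tj addSnnS.
    by move=> c c' w [h1 _] [h2 _]; rewrite -(a'S c) -(a'S c') -h1 // h2.
  apply: le_trans (_ : (\sum_(c <- s) P [set w | forall i, (i <= t.+1)%N -> X i w = a' c i] *
      (1 - kill m beta ok N t.+1 (val c))%:E <= _)%E); last first.
    by apply: lee_sum => c _; have := IH t.+1 (a' c); rewrite a'S.
  under eq_bigr => c _ do rewrite trK preE a'S (a't c t (leqnn t)).
  rewrite -(fineK (fin_num_measure P _ (mpre t a))); set x := fine _.
  under eq_bigr do rewrite -!EFinM -mulrA.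
  rewrite sumEFin -mulr_sumr -EFinM lee_fin.
  by rewrite -Estep_compl // (@kernel_Estep R d m beta m_gt0 (a t) s (fun D => 1 - kill m beta ok N t.+1 D) sP).
- by rewrite subrr mule0.
Qed.

(** Continuity from above: the event is the decreasing limit of its restrictions to the times up to
    [N]. *)
Lemma chain_survival (ok : nat -> {fset L} -> bool) (q : R) l :
  (forall N, (l <= N)%N -> q <= 1 - kill m beta ok N 0 (val C0)) ->
  (q%:E <= P [set w | forall t, ok t (val (X t w))])%E.
Proof.
move=> hq; have [_ X0 _] := chain.
pose F N := [set w | forall t, (t <= N)%N ==> ok t (val (X t w))].
have mF N : measurable (F N) by exact: (measurable_path (fun t c => (t <= N)%N ==> ok t (val c))).
have -> : [set w | forall t, ok t (val (X t w))] = (\bigcap_(N in [set: nat]) F N)%classic.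
  apply/seteqP; split=> w h; first by move=> N _ t; apply/implyP => _; exact: h.
  by move=> t; apply: (implyP (h t I t)).
have cv : (P \o F) N @[N --> \oo] --> P (\bigcap_(N in [set: nat]) F N)%classic.
  apply: nonincreasing_cvg_mu => //; first by rewrite (le_lt_trans (probability_le1 P (mF 0%N))) // ltry.
    exact: bigcapT_measurable.
  apply/nonincreasing_seqP => N; apply/subsetPset => w h t; apply/implyP => tN.
  by apply: (implyP (h t)); rewrite leqW.
rewrite -(cvg_lim _ cv) //; apply: lime_ge; first by apply/cvg_ex; exists (P (\bigcap_(N in [set: nat]) F N)%classic).
near=> N; have := chain_kill ok N 0 (fun=> C0).
have -> : [set w | forall i, (i <= 0)%N -> X i w = C0] = [set w | X 0%N w = C0].
  by apply/seteqP; split=> w /= h; [exact: h|move=> i; rewrite leqn0 => /eqP ->].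
rewrite X0 mul1e => h; apply: le_trans (_ : (1 - kill m beta ok N 0 (val C0))%:E <= _)%E.
  by rewrite lee_fin hq //; near: N; exact: nbhs_infty_ge.
apply: le_trans h _; apply: le_measure; rewrite ?inE //.
  apply: measurableI.
    by have := measurable_path (fun i c => (i <= 0)%N ==> (c == C0)); congr measurable;
      apply/seteqP; split=> w /= h i; [move=> i0; apply/eqP; exact: (implyP (h i))|
        apply/implyP => i0; apply/eqP; exact: h].
  have := measurable_path (fun j c => (0 <= j <= 0 + N)%N ==> ok j (val c)); congr measurable.
  by apply/seteqP; split=> w /= h j; [exact/implyP/h|apply/implyP; exact: h].
by move=> w [_ h] j; apply/implyP => jN; apply: h.
Unshelve. all: by end_near.
Qed.

End Chain.

(** * Uniformity over the initial configuration *)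

(** The distance provided by [survival] depends on the number of clusters and on their sizes;
    [shape] ranges over these finitely many data, and the maximum serves them all. *)
Lemma survival_all (R : realType) (d m n : nat) (beta delta : R) :
  (3 <= d)%N -> (0 < m)%N -> 2 < beta -> 0 < delta < 2^-1 ->
  exists r0 : nat, forall k (A : 'I_k -> {fset lattice d}) N, (1 < k <= n)%N ->
  (forall i, (m < #|` A i| <= 2 * m + 1)%N) -> sep r0 A -> diamle (2 * m + 1) A ->
  kill m beta (spread delta) N 0%N (union A) <= 2^-1.
Proof.
move=> d3 m0 b2 hdelta; have d0 : (0 < d)%N by apply: leq_trans d3.
have b0 : 0 <= beta by apply: le_trans (ltW b2).
pose shape := {k : 'I_n.+1 & {ffun 'I_k -> 'I_(2 * m + 1).+1}}.
have ex (x : shape) : exists r0 : nat, (1 < tag x)%N -> (forall i, (m < tagged x i)%N) ->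
    forall (A : 'I_(tag x) -> {fset lattice d}) N, wf (fun i => tagged x i : nat) A -> sep r0 A -> diamle (2 * m + 1) A ->
    kill m beta (spread delta) N 0%N (union A) <= 2^-1.
  have [k2|] := boolP (1 < tag x)%N; last by exists 0%N.
  have [szx|h] := boolP [forall i, (m < tagged x i)%N]; last first.
    by exists 0%N => _ h2; case/negP: h; apply/forallP.
  have [|r0 h] := @survival R d m beta (tag x) (fun i => tagged x i : nat) m0 d0 b0 (ltnW k2)
    (forallP szx) _ k2 delta (2 * m + 1) d3 b2 hdelta.
    by move=> i; rewrite -ltnS ltn_ord.
  by exists r0.
have [r hr] := choice ex.
exists (\max_x r x)%N => k A N /andP [k2 kn] hA sA dA.
pose kn' : 'I_n.+1 := Ordinal (kn : (k < n.+1)%N).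
pose x : shape := existT (fun k : 'I_n.+1 => {ffun 'I_k -> 'I_(2 * m + 1).+1}) kn'
  [ffun i : 'I_k => inord #|` A i|].
have xE i : tagged x i = #|` A i| :> nat.
  by rewrite ffunE inordK // ltnS; case/andP: (hA i).
apply: (hr x) => //.
- by move=> i; have /andP [h _] := hA i; rewrite -xE in h.
- by move=> i j ij u v ui vj; apply: leq_trans (sA i j ij u v ui vj); exact: leq_bigmax.
Qed.

Theorem theorem1p4 (R : realType) (d m n : nat) (beta : R)
    (hd : (3 <= d)%N) (hm : (1 <= m)%N) (hbeta : 2 < beta)
    (hn : (2 * m + 2 <= n)%N) :
  exists2 gamma : R, 0 < gamma &
  forall delta : R, 0 < delta < 2^-1 ->
  exists (p : R) (s : nat), 0 < p /\
  forall C : cat_state d m, #|` val C| = n ->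
  forall (disp : measure_display) (T : measurableType disp)
         (P : probability T R) (X : nat -> T -> cat_state d m),
  markov_chain (cat_kernel beta) C P X ->
  (p%:E <= P [set w | forall t : nat, (s <= t)%N ->
                (gamma * (t - s)%:R `^ (2^-1 - delta) <= diam R (val (X t w)))%R])%E.
Proof.
have hd0 : (0 < d)%N by apply: leq_trans hd.
have b0 : 0 <= beta by apply: le_trans (ltW hbeta).
(* The constant can be 1, because the dimensional factor has been absorbed into the weight [W0] of
   [survival]. *)
exists 1 => // delta hdelta.
have [r0 hr0] := @survival_all R d m n beta delta hd hm hbeta hdelta.
have [|p [l [/andP [p0 p1] hp]]] := @initial_groups R d m n beta hm hd0 b0 r0.
  by apply: leq_trans hn; rewrite addn1 addn2.
exists (p ^+ l / 2), l; split; first by rewrite divr_gt0 // exprn_gt0.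
move=> C Cn disp T P X chain.
have [t [k [A [C' [tl kn hA sA [re C'A]]]]]] := hp _ Cn.
(* The number [t] of preparatory steps depends on [C] but is at most [l]. [ok] demands nothing
   before [t] and starts its clock there; as [t <= l], the bound with [j - l] follows from that with
   [j - t]. *)
pose ok (j : nat) (D : {fset lattice d}) := (j < t)%N || spread delta (j - t) D.
have UA : union A = C' by apply/fsetP => x; apply/unionP/idP => /C'A.
have hk N : kill m beta ok N t C' <= 2^-1.
  rewrite -[t]addn0 (@kill_shift R d m beta (spread delta) ok t N 0).
    rewrite -UA; apply: (hr0 _ _ _ kn) => [i|//|i]; first by have [] := hA i.
    by have [_] := hA i.
  by move=> j D; rewrite /ok ltnNge leq_addr /= addKn.
have okh i B : (i < t)%N -> ok (0 + i)%N B by rewrite /ok add0n => ->.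
have hq N : (t <= N)%N -> p ^+ l / 2 <= 1 - kill m beta ok N 0 (val C).
  move=> tN; rewrite -(subnK tN).
  have := @reach_kill R d m beta ok hd0 p t (val C) C' (N - t)%N 0%N (cat_stateP C) (ltW p0) re okh.
  rewrite add0n; apply: le_trans; apply: ler_pM; rewrite ?invr_ge0 ?exprn_ge0 ?(ltW p0) //.
    by apply: ler_wiXn2l => //; exact: ltW.
  by have := hk (N - t)%N; lra.
apply: le_trans (@chain_survival R d m beta hm hd0 disp T P X C chain ok _ t hq) _.
apply: le_measure; rewrite ?inE.
- exact: (measurable_path chain (fun j c => ok j (val c))).
- have := measurable_path chain (fun j c => (l <= j)%N ==> `[< 1 * (j - l)%:R `^ (2^-1 - delta) <= diam R (val c) >]).
  congr measurable; apply/seteqP; split=> w h j; first by move=> lj; apply/asboolP; exact: (implyP (h j)).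
  by apply/implyP => lj; apply/asboolP; exact: h.
move=> w h j lj; have := h j; rewrite /ok ltnNge (leq_trans tl lj) /= => /asboolP h1.
rewrite mul1r; apply: le_trans h1; case/andP: hdelta => _ d2.
by apply: ge0_ler_powR; rewrite ?nnegrE ?subr_ge0 ?(ltW d2) // ler_nat leq_sub2l.
Qed.
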